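(* Let $G$ be a Chevalley group, let $K\subset\mathbb{C}$ be a number field, and let $f\in\mathcal{O}_K\smallsetminus\{0\}$. If $\Gamma$ is a finitely generated subgroup of $G(\mathbb{C})$ such that $\Gamma\cap G(\mathcal{O}_{K,f})$ is of finite index in $\Gamma$, then the normal Farb growth of $\Gamma$ is bounded above by $n^{\dim(G)}$, i.e. $\mathrm{F}_\Gamma(n)\preceq n^{\dim(G)}$.
   Context: A Chevalley group is a split simple group scheme $G$ over $\mathbb{Z}$ (smooth, affine, with connected semisimple fibres, a split maximal torus, and irreducible root system), not necessarily simply connected. $\dim(G)$ is its relative dimension over $\mathbb{Z}$ (the dimension of the algebraic group $G_{\mathbb{C}}$). $\mathcal{O}_K$ is the ring of integers of $K$, and $\mathcal{O}_{K,f}=\mathcal{O}_K[1/f]$. For a finitely generated, residually finite group $\Gamma$ and $\gamma\in\Gamma\smallsetminus\{1\}$, let $\mathrm{D}_\Gamma(\gamma)$ be the minimum of $|Q|$ over all finite quotients $Q$ of $\Gamma$ in which the image of $\gamma$ is non-trivial. For a finite generating set $X$ of $\Gamma$ with word length $\|\cdot\|_X$, put $\mathrm{F}_{\Gamma,X}(n)=\max\{\mathrm{D}_\Gamma(\gamma):\gamma\in\Gamma,\ \|\gamma\|_X\le n,\ \gamma\ne1\}$ (a maximum over the empty set is read as $1$). For functions $g,h$ on $\mathbb{N}=\{1,2,\dots\}$ with nonnegative values, $g\preceq h$ means that there is a natural number $M$ with $g(n)\le M h(Mn)$ for all $n$; $g\approx h$ means $g\preceq h$ and $h\preceq g$. The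 class of $\mathrm{F}_{\Gamma,X}$ modulo $\approx$ is independent of $X$; it is denoted $\mathrm{F}_\Gamma$ and called the normal Farb growth of $\Gamma$. (Finitely generated subgroups of $G(\mathbb{C})$ are linear, hence residually finite.) *)

(* Defs.v *)
From HB Require Import structures.
From mathcomp Require Import all_boot all_order all_algebra all_fingroup all_field.
From mathcomp Require Import boolp classical_sets reals.
From mathcomp Require Export complex.
Set Implicit Arguments.
Unset Strict Implicit.
Unset Printing Implicit Defensive.
Import GRing.Theory.
Local Open Scope classical_set_scope.
Local Open Scope ring_scope.

(* An affine group scheme over Z: a commutative ring [cring] together with a
   group structure on Hom(cring, R) that is natural in the commutative ring R.
   By Yoneda this is a Hopf ring structure on [cring].  MathComp's
   [comNzRingType] excludes only the zero ring, over which an affine scheme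
   has exactly one point. *)
Record affine_group := AffineGroup {
  cring : comNzRingType;
  onep : forall R : comNzRingType, {rmorphism cring -> R};
  invp : forall R : comNzRingType,
    {rmorphism cring -> R} -> {rmorphism cring -> R};
  mulp : forall R : comNzRingType,
    {rmorphism cring -> R} -> {rmorphism cring -> R} -> {rmorphism cring -> R};
  mulpA : forall R, associative (@mulp R);
  mul1p : forall R, left_id (@onep R) (@mulp R);
  mulp1 : forall R, right_id (@onep R) (@mulp R);
  mulVp : forall R, left_inverse (@onep R) (@invp R) (@mulp R);
  mulpV : forall R, right_inverse (@onep R) (@invp R) (@mulp R);
  mulp_natural : forall (R S : comNzRingType) (h : {rmorphism R -> S})
      (x y : {rmorphism cring -> R}),
    mulp (h \o x : {rmorphism cring -> S}) (h \o y : {rmorphism cring -> S})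
      = (h \o mulp x y : {rmorphism cring -> S})
}.

Definition points (G : affine_group) (R : comNzRingType) : Type :=
  {rmorphism cring G -> R}.

HB.instance Definition _ G R := gen_eqMixin (points G R).
HB.instance Definition _ G R := gen_choiceMixin (points G R).
HB.instance Definition _ G R := isGroup.Build (points G R)
  (@mulpA G R) (@mul1p G R) (@mulp1 G R) (@mulVp G R) (@mulpV G R).

Definition ev (G : affine_group) (R : comNzRingType) (x : points G R)
    (a : cring G) : R :=
  (x : {rmorphism cring G -> R}) a.

Definition push (G : affine_group) (R S : comNzRingType)
    (h : {rmorphism R -> S}) (x : points G R) : points G S :=
  (h \o (x : {rmorphism cring G -> R}) : {rmorphism cring G -> S}).

Definition pull (T G : affine_group) (phi : {rmorphism cring G -> cring T})
    (R : comNzRingType) (x : points T R) : points G R :=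
  ((x : {rmorphism cring T -> R}) \o phi : {rmorphism cring G -> R}).

Section AbstractGroups.
Variable gT : groupType.
Implicit Types (H N : set gT) (X : seq gT).

Definition is_subgroup H :=
  [/\ H 1%g, forall x y, H x -> H y -> H (x * y)%g
    & forall x, H x -> H (x^-1)%g].

Definition gen_subgroup (S : set gT) : set gT :=
  [set x | forall H, is_subgroup H -> S `<=` H -> H x].

Definition normal_in_all N := forall x y : gT, N x -> N (x ^ y)%g.

Definition derived H : set gT :=
  gen_subgroup [set z | exists x y, [/\ H x, H y & z = [~ x, y]%g]].

Definition solvable_set H := exists n, iter n derived H `<=` [set 1%g].

Definition finite_index (N H : set gT) :=
  exists s : seq gT, (forall g, g \in s -> H g) /\
    forall x, H x -> exists g y, [/\ g \in s, N y & x = (g * y)%g].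

Definition in_ball X (n : nat) (g : gT) :=
  exists w : seq gT, [/\ (size w <= n)%N,
    forall x, x \in w -> (x \in X) \/ (x^-1%g \in X)
    & g = (\prod_(x <- w) x)%g].

Definition detecting_order H (g : gT) (k : nat) :=
  exists (Q : finGroupType) (phi : gT -> Q),
    [/\ forall x y, H x -> H y -> phi (x * y)%g = (phi x * phi y)%g,
        forall q, exists2 x, H x & phi x = q,
        phi g <> 1%g
      & #|Q| = k].

Definition is_depth H (g : gT) (k : nat) :=
  detecting_order H g k /\ forall j, detecting_order H g j -> (k <= j)%N.

(* The values of F on positive arguments are those of the function F_{H,X};
   in particular every non-trivial element of H has a depth as soon as X
   generates H. *)
Definition is_farb_growth H X (F : nat -> nat) :=
  forall n, (0 < n)%N ->
    let B := [set g | [/\ H g, in_ball X n g & g <> 1%g]] in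
    (forall g, B g -> exists2 k, is_depth H g k & (k <= F n)%N) /\
    ((exists2 g, B g & is_depth H g (F n)) \/ (B = set0 /\ F n = 1%N)).

End AbstractGroups.

Definition growth_le (g h : nat -> nat) :=
  exists2 M, (0 < M)%N &
    forall n, (0 < n)%N -> (g n <= M * h (M * n))%N.

Section Zariski.
Variables (G : affine_group) (k : fieldType).

(* s stands for the element \sum_i p_i.1 (x) p_i.2 of k (x)_Z cring G, the
   coordinate ring of the base change G_k. *)
Definition regular_fun (s : seq (k * cring G)) (x : points G k) : k :=
  \sum_(p <- s) p.1 * ev x p.2.

Definition zclosed (Z : set (points G k)) :=
  exists I : set (seq (k * cring G)),
    Z = [set x | forall s, I s -> regular_fun s x = 0].

Definition zirreducible (Z : set (points G k)) :=
  Z !=set0 /\ forall Y1 Y2, zclosed Y1 -> zclosed Y2 ->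
    Z `<=` Y1 `|` Y2 -> Z `<=` Y1 \/ Z `<=` Y2.

Definition zconnected (Z : set (points G k)) :=
  Z !=set0 /\ forall Y1 Y2, zclosed Y1 -> zclosed Y2 ->
    Z `<=` Y1 `|` Y2 -> Z `&` Y1 `&` Y2 = set0 -> Z `<=` Y1 \/ Z `<=` Y2.

Definition irreducible_chain (n : nat) :=
  exists Z : nat -> set (points G k),
    (forall i, (i <= n)%N -> zclosed (Z i) /\ zirreducible (Z i)) /\
    (forall i, (i < n)%N -> Z i `<` Z i.+1).

Definition zariski_dim (d : nat) :=
  irreducible_chain d /\ forall e, irreducible_chain e -> (e <= d)%N.

(* S is a closed subgroup isomorphic to G_m^n for some n: the coordinates chi
   and, in the last clause, their inverse are given by regular functions. *)
Definition is_torus (S : set (points G k)) :=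
  [/\ is_subgroup S, zclosed S
    & exists n (chi : 'I_n -> seq (k * cring G)),
      [/\ forall i x y, S x -> S y -> regular_fun (chi i) (x * y)%g
            = regular_fun (chi i) x * regular_fun (chi i) y,
          forall u : 'I_n -> k, (forall i, u i != 0) ->
            exists! x, S x /\ forall i, regular_fun (chi i) x = u i
        & forall a, exists s : seq (k * 'rV[int]_n), forall x, S x ->
            ev x a = \sum_(p <- s)
              p.1 * \prod_(i < n) regular_fun (chi i) x ^ p.2 0 i]].

Definition is_maximal_torus (S : set (points G k)) :=
  is_torus S /\ forall S', is_torus S' -> S `<=` S' -> S' = S.

Definition semisimple_points :=
  zconnected [set: points G k] /\
  forall N : set (points G k), is_subgroup N -> zclosed N -> zconnected N ->
    normal_in_all N -> solvable_set N -> N = [set 1%g].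

End Zariski.

(* cring G is a finitely generated ring, hence finitely presented since Z is
   noetherian, and G satisfies the infinitesimal lifting criterion. *)
Definition smooth (G : affine_group) :=
  (exists s : seq (cring G), forall S : {pred cring G},
     GRing.subring_closed S -> {subset s <= S} -> forall a, a \in S) /\
  (forall (R S : comNzRingType) (q : {rmorphism R -> S}),
     (forall b, exists a, q a = b) ->
     (forall a b, q a = 0 -> q b = 0 -> a * b = 0) ->
     forall y : points G S, exists x : points G R, push q x = y).

(* chi identifies T with the split torus G_m^r. *)
Definition split_torus (T : affine_group) (r : nat) (chi : 'I_r -> cring T) :=
  (forall (R : comNzRingType) i (x y : points T R),
     ev (x * y)%g (chi i) = ev x (chi i) * ev y (chi i)) /\
  (forall (R : comNzRingType) (u : 'I_r -> R),
     (forall i, exists v, u i * v = 1) ->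
     exists! x : points T R, forall i, ev x (chi i) = u i).

Definition closed_subgroup (T G : affine_group)
    (phi : {rmorphism cring G -> cring T}) :=
  (forall b, exists a, phi a = b) /\
  (forall (R : comNzRingType) (x y : points T R),
     pull phi (x * y)%g = (pull phi x * pull phi y)%g).

Section Roots.
Variables (T G : affine_group) (phi : {rmorphism cring G -> cring T}).
Variables (r : nat) (chi : 'I_r -> cring T) (k : fieldType).

Definition dual_numbers : comNzRingType := {poly %/ ('X^2 : {poly k})}.
Definition dual_const : {rmorphism k -> dual_numbers} := @qpolyC k 'X^2.

(* The Lie algebra of G_k is the kernel of G(k[e]) -> G(k): its elements are
   the points v with v a = 1(a) + X(a) e, and the adjoint action of t replaces
   X by the e-coefficient of t v t^-1.  A root is a non-zero character alpha
   of T having an eigenvector X <> 0 in the Lie algebra. *)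
Definition torus_root (alpha : 'rV[int]_r) :=
  alpha != 0 /\ exists v : points G dual_numbers,
    [/\ forall a, (ev v a)`_0 = ev (1%g : points G k) a,
        exists a, (ev v a)`_1 != 0
      & forall (t : points T k) a,
          let g := push dual_const (pull phi t) in
          (ev (g * v * g^-1)%g a)`_1 =
            (\prod_(i < r) ev t (chi i) ^ alpha 0 i) * (ev v a)`_1].

End Roots.

(* A root system Phi is irreducible if it is non-empty and is not the direct
   sum of two non-empty root systems.  If Phi lies in the union of U and V with
   U, V independent, then Phi is the direct sum of its intersections with U and
   V, which are automatically root systems in their spans. *)
Definition irreducible_roots (r : nat) (Phi : set 'rV[int]_r) :=
  Phi !=set0 /\
  forall U V : {vspace 'rV[rat]_r}, (U :&: V)%VS = 0%VS ->
    let inj (a : 'rV[int]_r) : 'rV[rat]_r := map_mx intr a in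
    (forall a, Phi a -> inj a \in U \/ inj a \in V) ->
    (forall a, Phi a -> inj a \in U) \/ (forall a, Phi a -> inj a \in V).

Definition chevalley_group (G : affine_group) :=
  [/\ smooth G,
      forall k : closedFieldType, semisimple_points G k
    & exists (T : affine_group) (phi : {rmorphism cring G -> cring T})
        (r : nat) (chi : 'I_r -> cring T),
      [/\ split_torus chi,
          closed_subgroup phi
        & forall k : closedFieldType,
            is_maximal_torus (range (@pull T G phi k)) /\
            irreducible_roots (torus_root phi chi k)]].

Section NumberFields.
Variables (K : fieldExtType rat) (C : comNzRingType).
Variable iota : {rmorphism K -> C}.

Definition ring_of_integers : set K := [set a | integralOver (intr : int -> K) a].

Definition localized_integers (f : K) : set K :=
  [set b | exists a n, ring_of_integers a /\ b = a / f ^+ n].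

(* The image of G(O_K[1/f]) in G(C). *)
Definition integral_points (G : affine_group) (f : K) : set (points G C) :=
  [set x | forall a, exists2 b, localized_integers f b & ev x a = iota b].

End NumberFields.

(* Main.v *)
From HB Require Import structures.
Require Import Defs.
From mathcomp Require Import all_boot all_order all_algebra all_fingroup all_field.
From mathcomp Require Import mpoly zify ring lra.
From mathcomp Require boolp exp.
Set Implicit Arguments.
Unset Strict Implicit.
Unset Printing Implicit Defensive.
Import Order.TTheory GRing.Theory Num.Theory.
Local Open Scope ring_scope.

(** Let [H] be the subgroup of the elements of [Gamma] that are integral over
    O_K[1/f]. An element outside of [H] is detected by the action of [Gamma] on
    its finitely many cosets by [H], so let [g <> 1] be an element of [H] of word
    length at most [n]. The claim is that there is a prime [p = O(n)] such that a
    reduction modulo [p] gives a homomorphism from [Gamma] to a group, with [O(p ^ d)]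
    elements in its image, that does not kill [g].

    Write K = Q(th), with [h] the minimal polynomial of an integral generator [th].
    By Schreier's lemma [g] is a product of [O(n)] elements of a finite subset of
    [H]. The coordinate functions of [G] have finite Hankel rank because of the
    comultiplication, hence a coordinate of a product is a product of matrices
    ([recognizable]); it follows that some coordinate of [g], minus that of [1], is
    [u(th) / N ^ k] with [k = O(n)], where [u] is an integral polynomial such that
    the norm of [u(th)] is nonzero and at most exponential in [n] ([height_points]).
    A root [r] of [h] modulo [p] defines the reduction th |-> r of Z[th] to the prime
    field, and this detects [g] as soon as [u(r) != 0].

    Such a [p = O(n)] exists ([good_prime]): otherwise every small prime modulo
    which [h] has a root divides the norm of [u(th)], so the sum of [log p] over
    these primes is [O(n)]; but up to [x] it is at least a constant times [x]
    ([split_theta_lower]). The latter is proved by a method of Chebyshev: sum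
    [log |N(x)|] over the elements [x] of Z[th] in a box of side [2 ^ l]. For growing
    [l], the average grows like [(deg h) * l]. On the other hand the sum is
    determined, up to a bounded average, by the numbers of pairs of an [x] in the
    box and a root [r] modulo [p] with [x(r) = 0]. For a small [p], this number
    scales like the volume of the box, so that the average contribution of the
    small primes does not grow with [l]; the large primes must provide the rest, and
    each of them contributes little.

    Elements of [Gamma] outside of [H] have coordinates in a finitely generated
    extension of Z[th]. The reduction is extended to them with values in an
    algebraic closure of the prime field: by Noether normalization the extension is
    integral over a polynomial ring after inverting one element, the variables are
    sent to [0], and homomorphisms extend along integral elements ([extend_all],
    [specialization]).

    Finally the image of [H] has [O(p ^ d)] elements: by Noether normalization over
    the integers, the coordinates on [G(C)] are integral over [e] algebraically
    independent functions, up to a denominator, and such a point is determined up to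
    finitely many choices by [e] elements of the prime field ([count_points]). One has
    [e <= d], because over the coordinate subspaces of the affine space of
    dimension [e] there is a strictly increasing chain of irreducible closed
    subsets of [G(C)] ([exists_irreducible_chain]). *)


(** * The norm of an integral polynomial at a root *)

Lemma absz_sum (I : Type) (r : seq I) (P : pred I) (F : I -> int) :
  (absz (\sum_(i <- r | P i) F i)%R <= \sum_(i <- r | P i) `|F i|)%N.
Proof. by elim/big_rec2: _ => // i m x _; lia. Qed.

Lemma absz_prod (I : Type) (r : seq I) (P : pred I) (F : I -> int) :
  absz (\prod_(i <- r | P i) F i)%R = (\prod_(i <- r | P i) `|F i|)%N.
Proof. by elim/big_rec2: _ => // i m x _ <-; rewrite abszM. Qed.

(** Submultiplicative, hence at most exponential in the length of a product, and a
    bound for the determinant. *)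
Definition entry_sum n (A : 'M[int]_n) : nat := \sum_i \sum_j `|A i j|%N.

Lemma entry_sumM n (A B : 'M[int]_n) :
  (entry_sum (A *m B) <= entry_sum A * entry_sum B)%N.
Proof.
rewrite /entry_sum.
apply: (@leq_trans (\sum_i \sum_j \sum_k `|A i k| * `|B k j|)).
  apply: leq_sum => i _; apply: leq_sum => j _; rewrite mxE.
  by apply: leq_trans (absz_sum _ _ _) _; apply: leq_sum => k _; rewrite abszM.
rewrite big_distrl /=; apply: leq_sum => i _.
rewrite exchange_big big_distrl /=; apply: leq_sum => k _.
rewrite -big_distrr leq_mul2l; apply/orP; right.
by rewrite [leqRHS](bigD1 k) //= leq_addr.
Qed.

Lemma entry_sumD n (A B : 'M[int]_n) :
  (entry_sum (A + B) <= entry_sum A + entry_sum B)%N.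
Proof.
rewrite -big_split; apply: leq_sum => i _; rewrite -big_split; apply: leq_sum => j _ /=.
by rewrite mxE; move: (A i j) (B i j) => x y; lia.
Qed.

Lemma entry_sumZ n (c : int) (A : 'M[int]_n) :
  entry_sum (c *: A) = (`|c| * entry_sum A)%N.
Proof.
rewrite /entry_sum big_distrr; apply: eq_bigr => i _; rewrite big_distrr.
by apply: eq_bigr => j _ /=; rewrite mxE abszM.
Qed.

Lemma entry_le_sum n (A : 'M[int]_n) i j : (`|A i j| <= entry_sum A)%N.
Proof. by rewrite /entry_sum (bigD1 i) //= (bigD1 j) //= -addnA leq_addr. Qed.

Lemma absz_det_le n (A : 'M[int]_n) L :
  (forall i j, `|A i j| <= L)%N -> (`|\det A| <= n`! * L ^ n)%N.
Proof.
move=> leA; apply: leq_trans (absz_sum _ _ _) _.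
have -> : (n`! * L ^ n = \sum_(s : 'S_n) L ^ n)%N.
  by rewrite sum_nat_const cardE -cardT card_Sn.
apply: leq_sum => s _; rewrite abszM abszX abszN exp1n mul1n absz_prod.
rewrite -[n in (L ^ n)%N](card_ord n) -prod_nat_const.
exact: leq_prod.
Qed.

Section Companion.
Variables (d : nat) (h : {poly int}).
Hypotheses (hmon : h \is monic) (hsz : size h = d.+2).

(** The companion matrix of [h], that is, the multiplication by a root of [h] on the
    span of its powers. Working with matrices rather than in a number field gives
    the norm and its reductions modulo all primes at once. *)
Definition comp_mx : 'M[int]_d.+1 :=
  \matrix_(i, j) if i == d :> nat then - h`_j else (i.+1 == j :> nat)%:R.

Definition mult_mx (u : {poly int}) : 'M[int]_d.+1 := horner_mx comp_mx u.

Definition nrm (u : {poly int}) : int := \det (mult_mx u).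

Definition powers (S : comNzRingType) (z : S) : 'cV[S]_d.+1 := \col_i z ^+ i.

Definition is_root (S : comNzRingType) (z : S) := (map_poly intr h).[z] = 0.

(** The vector of the powers of a root is an eigenvector, over every ring that
    contains a root. All comparisons of norms with values at roots come from it. *)
Lemma comp_mx_powers (S : comNzRingType) (z : S) : is_root z ->
  map_mx intr comp_mx *m powers z = z *: powers z.
Proof.
rewrite /is_root horner_coef size_map_poly_id0; last first.
  by rewrite (monicP hmon) rmorph1 oner_eq0.
rewrite hsz big_ord_recr /= coef_map /= -[h`_d.+1]/(h`_d.+2.-1) -hsz -lead_coefE.
rewrite (monicP hmon) rmorph1 mul1r => hz.
apply/matrixP => i j; rewrite !mxE.
have [id|id] := eqVneq (i : nat) d.
  rewrite -exprS id; apply/eqP; rewrite eq_sym -subr_eq0; apply/eqP.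
  rewrite -[RHS]hz addrC -sumrN; congr (_ + _); apply: eq_bigr => k _.
  by rewrite !mxE id eqxx rmorphN mulNr opprK coef_map.
have lti : (i.+1 < d.+1)%N by have := ltn_ord i; lia.
rewrite (bigD1 (Ordinal lti)) //= big1 ?addr0.
  by rewrite !mxE (negPf id) eqxx mul1r exprS.
move=> k nk; rewrite !mxE (negPf id).
have -> : (i.+1 == k :> nat) = false by apply: contraNF nk => /eqP ki; apply/eqP/val_inj; rewrite /= ki.
by rewrite mul0r.
Qed.

Lemma mult_mxM u v : mult_mx (u * v) = mult_mx u *m mult_mx v.
Proof. exact: rmorphM. Qed.

Lemma mult_mx_powers (S : comNzRingType) (z : S) u : is_root z ->
  map_mx intr (mult_mx u) *m powers z = (map_poly intr u).[z] *: powers z.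
Proof.
move=> hz; elim/poly_ind: u => [|u c IH].
  by rewrite /mult_mx !rmorph0 horner0 scale0r mul0mx.
rewrite /mult_mx rmorphD rmorphM /= horner_mx_X horner_mx_C map_mxD map_mxM.
rewrite mulmxDl -mulmxA comp_mx_powers // -scalemxAr IH scalerA rmorphD rmorphM /=.
rewrite map_polyX map_polyC hornerMXaddC scalerDl mulrC; congr (_ + _).
by rewrite map_scalar_mx mul_scalar_mx.
Qed.

Lemma mult_mx_rVpoly (a : 'rV[int]_d.+1) :
  mult_mx (rVpoly a) = \sum_i a 0 i *: comp_mx ^+ i.
Proof.
rewrite {1}[a]row_sum_delta !linear_sum /mult_mx rmorph_sum; apply: eq_bigr => i _ /=.
by rewrite linearZ /= rVpoly_delta linearZ /= rmorphXn /= horner_mx_X.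
Qed.

(** Bounds the effect of multiplication by an element in terms of its coordinates. *)
Definition comp_size : nat := (\sum_(i < d.+1) entry_sum (comp_mx ^+ i)).+1.

Lemma entry_sum_mult_mx (a : 'rV[int]_d.+1) L :
  (forall i, `|a 0%R i| <= L)%N -> (entry_sum (mult_mx (rVpoly a)) <= L * comp_size)%N.
Proof.
move=> leL; rewrite mult_mx_rVpoly mulnS big_distrr /=.
apply: leq_trans (leq_addl _ _).
elim/big_rec2: _ => [|i m A _ IH].
  by rewrite /entry_sum big1 // => i _; rewrite big1 // => j _; rewrite mxE.
apply: leq_trans (entry_sumD _ _) _; rewrite leq_add // entry_sumZ.
exact: leq_mul.
Qed.

Definition nrm_const : nat := (d.+1)`! * comp_size ^ d.+1.

Lemma nrm_le (a : 'rV[int]_d.+1) L : (forall i, `|a 0%R i| <= L)%N ->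
  (`|nrm (rVpoly a)| <= nrm_const * L ^ d.+1)%N.
Proof.
move=> leL; rewrite /nrm_const -mulnA -expnMn [(comp_size * L)%N]mulnC; apply: absz_det_le => i j.
by apply: leq_trans (entry_le_sum _ _ _) (entry_sum_mult_mx leL).
Qed.

Lemma nrmM u v : nrm (u * v) = nrm u * nrm v.
Proof. by rewrite /nrm mult_mxM det_mulmx. Qed.

(** The linear form x |-> x(z), where the row [a] lists the coordinates of [x] on the
    powers of the generator. *)
Definition vev (S : comNzRingType) (z : S) (a : 'rV[int]_d.+1) : S :=
  \sum_i (a 0 i)%:~R * z ^+ i.

Lemma vevE (S : comNzRingType) (z : S) a : vev z a = (map_poly intr (rVpoly a)).[z].
Proof.
rewrite (horner_coef_wide z (n := d.+1)); last first.
  exact: leq_trans (size_poly _ _) (size_poly _ _).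
by apply: eq_bigr => i _; rewrite coef_map coef_rVpoly_ord.
Qed.

Lemma vev_powers (S : comNzRingType) (z : S) a :
  (map_mx intr a *m powers z) 0 0 = vev z a.
Proof. by rewrite mxE; apply: eq_bigr => i _; rewrite !mxE. Qed.

Lemma vevM (S : comNzRingType) (z : S) (a : 'rV[int]_d.+1) u : is_root z ->
  vev z (a *m mult_mx u) = vev z a * (map_poly intr u).[z].
Proof.
move=> hz; rewrite -vev_powers map_mxM -mulmxA mult_mx_powers // -scalemxAr mxE.
by rewrite vev_powers mulrC.
Qed.

Lemma vevD (S : comNzRingType) (z : S) a b : vev z (a + b) = vev z a + vev z b.
Proof.
by rewrite -big_split; apply: eq_bigr => i _; rewrite mxE rmorphD mulrDl.
Qed.

Lemma vevN (S : comNzRingType) (z : S) a : vev z (- a) = - vev z a.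
Proof.
by rewrite -sumrN; apply: eq_bigr => i _; rewrite mxE rmorphN mulNr.
Qed.

End Companion.

Lemma Fp_intr_eq0 p (x : int) : prime p -> ((x%:~R : 'F_p) == 0) = (p %| x)%Z.
Proof. by move=> pp; rewrite (dvdz_pcharf (pchar_Fp pp)). Qed.

Lemma prod_ge_const (p : nat) r n :
  \prod_(i < n) (if (r <= i)%N then p%:Z else 1) = (p ^ (n - r))%N%:Z.
Proof.
elim: n => [|n IH]; first by rewrite big_ord0.
rewrite big_ord_recr IH /=; case: leqP => rn; last by rewrite mulr1; congr (Posz (p ^ _)); lia.
by rewrite subSn // expnS PoszM mulrC.
Qed.

(** Over the field with [p] elements, row operations make all but [\rank] many rows
    vanish; lifted to the integers, they make these rows divisible by [p] and keep
    the determinant up to a factor that is prime to [p]. *)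
Lemma dvd_det_corank p n (M : 'M[int]_n) : prime p ->
  (p ^ (n - \rank (map_mx intr M : 'M['F_p]_n)) %| `|\det M|)%N.
Proof.
move=> pp; set Mp := map_mx _ M; set r := \rank Mp.
pose Ub := invmx (col_ebase Mp); pose U : 'M[int]_n := map_mx (fun x : 'F_p => (x : nat)%:Z) Ub.
have UE : map_mx intr U = Ub.
  apply/matrixP => i j; rewrite !mxE; exact: (natr_Zp (Ub i j)).
have Ub_unit : Ub \in unitmx by rewrite unitmx_inv col_ebase_unit.
have UM : Ub *m Mp = pid_mx r *m row_ebase Mp.
  by rewrite -{1}[Mp]mulmx_ebase -mulmxA mulKmx ?col_ebase_unit.
have pU : coprime p `|\det U|%N.
  rewrite prime_coprime // -[p]/`|p%:Z|%N -dvdzE -(Fp_intr_eq0 _ pp) -det_map_mx UE.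
  by rewrite -unitfE -unitmxE.
have dvdUM (i j : 'I_n) : (r <= i)%N -> (p %| (U *m M) i j)%Z.
  move=> ri; rewrite -(Fp_intr_eq0 _ pp).
  have -> : ((U *m M) i j)%:~R = (Ub *m Mp) i j by rewrite -UE -map_mxM !mxE.
  rewrite UM mxE big1 // => k _; rewrite mxE ltnNge ri andbF mul0r //.
pose B : 'M[int]_n := \matrix_(i, j) if (r <= i)%N then ((U *m M) i j %/ p)%Z else (U *m M) i j.
pose w : 'rV[int]_n := \row_i if (r <= i)%N then p%:Z else 1.
have UMB : U *m M = diag_mx w *m B.
  apply/matrixP => i j; rewrite mul_diag_mx [RHS]mxE [w _ _]mxE [B _ _]mxE.
  by case: ifP => ri; rewrite ?mul1r // mulrC divzK // dvdUM.
have dw : \det (diag_mx w) = (p ^ (n - r))%N%:Z.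
  by rewrite det_diag; under eq_bigr do rewrite mxE; exact: prod_ge_const.
have : (p ^ (n - r) %| `|\det U| * `|\det M|)%N.
  by rewrite -abszM -det_mulmx UMB det_mulmx dw abszM dvdn_mulr.
by rewrite Gauss_dvdr // coprimeXl.
Qed.

Section Roots.
Variables (d : nat) (h : {poly int}).
Hypotheses (hmon : h \is monic) (hsz : size h = d.+2).

Local Notation is_root := (is_root h).
Local Notation mult_mx := (mult_mx d h).
Local Notation nrm := (nrm d h).
Local Notation powers := (powers d).

Lemma mul_powers_col (S : comNzRingType) m (M : 'M[S]_d.+1) (P : 'M_(d.+1, m)) z i j :
  (forall k, P k j = z ^+ k) -> (M *m P) i j = (M *m powers z) i 0.
Proof. by move=> hP; rewrite !mxE; apply: eq_bigr => k _; rewrite hP mxE. Qed.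

(** An eigenvector of eigenvalue [0], with first entry [1], makes the determinant
    vanish, over any ring. *)
Lemma nrm_root (S : comNzRingType) (z : S) u : is_root z ->
  (map_poly intr u).[z] = 0 -> (nrm u)%:~R = 0 :> S.
Proof.
move=> hz uz; pose M : 'M[S]_d.+1 := map_mx intr (mult_mx u).
have : \adj M *m (M *m powers z) = 0 by rewrite mult_mx_powers // uz scale0r mulmx0.
rewrite mulmxA mul_adj_mx mul_scalar_mx det_map_mx.
by move/matrixP => /(_ 0 0); rewrite !mxE expr0 mulr1.
Qed.

Section CharZero.
Variables (L : fieldType) (th : L).
Hypothesis hth : is_root th.
Hypothesis (indep : forall a : 'rV[int]_d.+1, vev th a = 0 -> a = 0).

(** If the matrix of multiplication by [u(th)] is singular, some nonzero [v] has
    [v(th) u(th) = 0]. *)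
Lemma nrm_neq0 u : (map_poly intr u).[th] != 0 -> nrm u != 0.
Proof.
move=> uth; apply/negP => /det0P [v nzv vu]; move/negP: nzv; apply; apply/eqP.
apply: indep; apply: (mulIf uth); rewrite mul0r -(vevM hmon hsz) // vu.
by rewrite /vev big1 // => i _; rewrite mxE mul0r.
Qed.

Lemma nrm_row_neq0 (a : 'rV[int]_d.+1) : a != 0 -> nrm (rVpoly a) != 0.
Proof.
move=> nza; apply: nrm_neq0; rewrite -vevE.
by apply: contra nza => /eqP/indep ->.
Qed.

(** The discriminant of [h], up to sign. *)
Definition disc := nrm h^`().

Lemma disc_neq0 : disc != 0.
Proof.
apply: nrm_neq0; apply/eqP => hh.
have sz : (size h^`() <= d.+1)%N by rewrite -ltnS -hsz lt_size_deriv // -size_poly_gt0 hsz.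
have : poly_rV h^`() = 0 :> 'rV_d.+1 by apply: indep; rewrite vevE poly_rV_K.
move/(congr1 rVpoly); rewrite poly_rV_K // linear0 => /polyP /(_ d).
rewrite coef_deriv coef0 -[h`_d.+1]/(h`_d.+2.-1) -hsz -lead_coefE (monicP hmon).
by move=> /eqP; rewrite -mulr_natl mulr1 natz.
Qed.

(** This makes th |-> z a well-defined homomorphism on Z[th]: a polynomial vanishing
    at [th] is a multiple of [h]. *)
Lemma eq0_of_root u : (map_poly intr u).[th] = 0 ->
  forall (S : comNzRingType) (z : S), is_root z -> (map_poly intr u).[z] = 0.
Proof.
move=> uth S z hz.
have := Pdiv.RingMonic.rdivp_eq hmon u; set q := Pdiv.Ring.rdivp _ _; set r := Pdiv.Ring.rmodp _ _ => uE.
have szr : (size r <= d.+1)%N.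
  rewrite -ltnS -hsz; exact: Pdiv.Ring.ltn_rmodpN0 (monic_neq0 hmon).
suff r0 : r = 0 by rewrite uE r0 addr0 rmorphM hornerM hz mulr0.
rewrite -[r](poly_rV_K szr); suff -> : poly_rV r = 0 :> 'rV_d.+1 by rewrite linear0.
apply: indep; rewrite vevE poly_rV_K //.
by move: uth; rewrite uE rmorphD rmorphM hornerD hornerM hth mulr0 add0r.
Qed.
End CharZero.

Section ModP.
Variables (p : nat) (Om : closedFieldType).
Hypotheses (pp : prime p) (charOm : p \in [pchar Om]).
Hypothesis pdisc : ~~ (p %| disc)%Z.

Lemma intr_eq0_mod (x : int) : (x%:~R == 0 :> Om) = (p %| x)%Z.
Proof. by rewrite (dvdz_pcharf charOm). Qed.

(** A double root would be a common root of [h] and its derivative, and then [p]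
    would divide the discriminant. *)
Lemma roots_mod : exists z : 'I_d.+1 -> Om, [/\ injective z,
  map_poly intr h = \prod_i ('X - (z i)%:P) & forall i, is_root (z i)].
Proof.
have [s] := closed_field_poly_normal (map_poly intr h : {poly Om}).
have mh : map_poly intr h \is @monic Om by exact: monic_map.
rewrite (monicP mh) scale1r => hE.
have us : uniq s.
  rewrite -separable_prod_XsubC -hE unlock; apply/Pdiv.ClosedField.coprimepP => x rx.
  rewrite deriv_map; apply: contra pdisc => /eqP h'x.
  by rewrite -intr_eq0_mod (nrm_root (z := x)) //; apply/eqP; exact: rx.
have ss : size s = d.+1.
  apply/eqP; rewrite -eqSS -(size_prod_XsubC s id) -hE size_map_poly_id0 ?hsz //.
  by rewrite (monicP hmon) rmorph1 oner_eq0.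
exists (fun i => tnth (Tuple (introT eqP ss)) i); split.
- exact/tuple_uniqP.
- by rewrite hE -(big_tuple _ _ (Tuple (introT eqP ss)) xpredT (fun x => 'X - x%:P)).
- move=> i; apply/eqP; rewrite -[_ == 0]/(root _ _) hE root_prod_XsubC; exact: mem_tnth.
Qed.

Variable z : 'I_d.+1 -> Om.
Hypotheses (zinj : injective z) (hz : forall i, is_root (z i)).

(** The Vandermonde matrix of the distinct roots diagonalizes the multiplication. *)
Lemma char_poly_mult_mx u :
  map_poly intr (char_poly (mult_mx u)) =
    \prod_i ('X - ((map_poly intr u).[z i])%:P) :> {poly Om}.
Proof.
rewrite map_char_poly; set M := map_mx _ _.
pose w : 'rV[Om]_d.+1 := \row_i (map_poly intr u).[z i].
pose P : 'M[Om]_d.+1 := Vandermonde d.+1 (\row_i z i).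
have MP : M *m P = P *m diag_mx w.
  apply/matrixP => i j; rewrite (@mul_powers_col _ _ _ _ (z j)) => [|k]; last by rewrite !mxE.
  by rewrite (mult_mx_powers hmon hsz) // mul_mx_diag !mxE mulrC.
have Pn0 : \det P != 0.
  rewrite det_Vandermonde; apply/prodf_neq0 => i _; apply/prodf_neq0 => j ij.
  by rewrite !mxE subr_eq0; apply/eqP => /zinj ji; rewrite ji ltnn in ij.
have -> : \prod_i ('X - ((map_poly intr u).[z i])%:P) = char_poly (diag_mx w).
  rewrite char_poly_trig ?diag_mx_is_trig //; apply: eq_bigr => i _.
  by rewrite !mxE eqxx mulr1n.
have Pn0' : \det (map_mx polyC P) != 0 by rewrite det_map_mx polyC_eq0.
apply: (mulIf Pn0'); rewrite /char_poly -det_mulmx mulrC -det_mulmx; congr (\det _).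
rewrite /char_poly_mx mulmxBl mulmxBr -!map_mxM MP; congr (_ - _).
by rewrite mul_scalar_mx mul_mx_scalar.
Qed.

Lemma nrm_mod u : (nrm u)%:~R = \prod_i (map_poly intr u).[z i].
Proof.
have : (map_poly intr (char_poly (mult_mx u))).[0] = \prod_i (- (map_poly intr u).[z i]).
  by rewrite char_poly_mult_mx horner_prod; apply: eq_bigr => i _; rewrite hornerXsubC sub0r.
rewrite horner_coef0 coef_map char_poly_det /= rmorphM rmorph_sign prodrN card_ord.
by move/(congr1 (fun y => (-1) ^+ d.+1 * y)); rewrite !mulrA -!exprMn mulrNN mulr1 expr1n !mul1r.
Qed.
End ModP.

(** Distinct roots at which [u] vanishes give independent vectors in the kernel of
    the multiplication by [u] modulo [p], so [dvd_det_corank] applies. *)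
Lemma dvd_nrm_roots p (F : fieldType) (phi : {rmorphism 'F_p -> F}) (s : seq F) u :
  prime p -> uniq s ->
  (forall r, r \in s -> is_root r /\ (map_poly intr u).[r] = 0) ->
  (p ^ size s %| `|nrm u|)%N.
Proof.
move=> pp us hs.
have szs : (size s <= d.+1)%N.
  rewrite -ltnS -hsz -(size_map_poly_id0 (f := intr : int -> F) (p := h)); last first.
    by rewrite (monicP hmon) rmorph1 oner_eq0.
  apply: max_poly_roots => //; last by apply/allP => r /hs [/eqP].
  by rewrite monic_neq0 // monic_map.
pose t := \row_(i < size s) s`_i.
pose W : 'M[F]_(d.+1, size s) := Vandermonde d.+1 t.
pose M : 'M[F]_d.+1 := map_mx intr (mult_mx u).
have MW : M *m W = 0.
  apply/matrixP => i j; rewrite (@mul_powers_col _ _ _ _ s`_j) => [|k]; last by rewrite !mxE.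
  have [] := hs s`_j; first exact: mem_nth.
  by move=> r0 u0; rewrite (mult_mx_powers hmon hsz) // u0 scale0r !mxE.
have rW : (size s <= \rank W)%N.
  have rkW : \rank (rowsub (widen_ord szs) W) = size s.
    apply/eqP; rewrite -/(row_free _) row_free_unit unitmxE unitfE.
    have -> : rowsub (widen_ord szs) W = Vandermonde (size s) t.
      by apply/matrixP => i j; rewrite !mxE.
    rewrite det_Vandermonde; apply/prodf_neq0 => i _; apply/prodf_neq0 => j ij.
    by rewrite !mxE subr_eq0 nth_uniq //; case: eqP ij => // ->; rewrite ltnn.
  by rewrite -[leqLHS]rkW rowsubE mxrankM_maxr.
have rMW := mulmx0_rank_max MW.
have rM : \rank M = \rank (map_mx intr (mult_mx u) : 'M['F_p]_d.+1).
  rewrite -(mxrank_map phi) -map_mx_comp; congr (\rank _).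
  by apply/matrixP => i j; rewrite !mxE /= rmorph_int.
apply: dvdn_trans (dvd_det_corank (mult_mx u) pp).
by apply: dvdn_exp2l; rewrite -rM; lia.
Qed.

End Roots.

(** * Counting lattice points at which a polynomial vanishes modulo p *)

Section Boxes.
Variable d : nat.

(** Elements of Z[th] with coordinates in an interval, over which averages are taken. *)
Definition box (L : nat) := {ffun 'I_d.+1 -> 'I_L}.
Definition box_row L (x : box L) : 'rV[int]_d.+1 := \row_i (x i : nat)%:Z.

Lemma card_box L : #|{: box L}| = (L ^ d.+1)%N.
Proof. by rewrite card_ffun !card_ord. Qed.

Lemma box_row_inj L : injective (@box_row L).
Proof.
by move=> x y /rowP xy; apply/ffunP => i; apply/val_inj; move: (xy i); rewrite !mxE => -[].
Qed.

Lemma box_row_abs L (x : box L) i : (`|box_row x 0%R i| <= L)%N.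
Proof. by rewrite mxE ltnW // ltn_ord. Qed.

Lemma to_box L (v : 'rV[int]_d.+1) : (forall i, 0 <= v 0 i < L%:Z) ->
  exists x : box L, box_row x = v.
Proof.
move=> hv; have lt i : (`|v 0%R i| < L)%N by have := hv i; lia.
exists [ffun i => Ordinal (lt i)]; apply/rowP => i; rewrite mxE ffunE /=.
by have := hv i; lia.
Qed.

(** The translates of [A] by the [q] vectors [f k] are disjoint, since they take
    distinct values at [z], and they lie in a slightly larger box. *)
Lemma pack_upper (S : comNzRingType) (z : S) L w q (f : 'I_q -> 'rV[int]_d.+1)
    (A : {set box L}) :
  (forall k i, `|f k 0%R i| <= w)%N -> injective (fun k => vev z (f k)) ->
  (forall x, x \in A -> vev z (box_row x) = 0) ->
  (#|A| * q <= (L + 2 * w) ^ d.+1)%N.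
Proof.
move=> fw finj hA.
have sum_box (u : box L * 'I_q) :
    exists y : box (L + 2 * w), box_row y = box_row u.1 + f u.2 + const_mx w%:Z.
  by apply: to_box => i; rewrite !mxE; move: (fw u.2 i) (ltn_ord (u.1 i)); move: (f u.2 _ i) (nat_of_ord _) => a b; lia.
have [g gE] := fin_all_exists sum_box.
rewrite -[X in (_ * X <= _)%N]card_ord -[#|'I_q|]cardsT -cardsX -card_box -[leqRHS]cardsT.
rewrite -(card_in_imset (f := g)); first exact: subset_leq_card (subsetT _).
move=> [x k] [y l] /setXP[/= hx _] /setXP[/= hy _] gxy.
have := congr1 (@box_row _) gxy; rewrite !gE /= => /addIr exy.
have kl : k = l.
  by apply: finj => /=; have := congr1 (vev z) exy; rewrite !vevD !hA // !add0r.
by move: exy; rewrite kl => /addIr /box_row_inj ->.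
Qed.

(** Every vector of a slightly smaller box is congruent to some [f k], hence lies in
    one of the [q] translates of the zeros at [z] in the box. *)
Lemma pack_lower (S : comNzRingType) (z : S) L w q (f : 'I_q -> 'rV[int]_d.+1) :
  (2 * w <= L)%N -> (forall k i, `|f k 0%R i| <= w)%N ->
  (forall v : 'rV[int]_d.+1, exists k, vev z (f k) = vev z v) ->
  ((L - 2 * w) ^ d.+1 <= q * #|[set x : box L | vev z (box_row x) == 0%R]|)%N.
Proof.
move=> wL fw fsurj; set A := [set x | _].
have split_box (y : box (L - 2 * w)) : exists u : 'I_q * box L,
    u.2 \in A /\ box_row y = box_row u.2 + f u.1 - const_mx w%:Z.
  have [k fk] := fsurj (box_row y + const_mx w%:Z).
  have [|x xE] := @to_box L (box_row y + const_mx w%:Z - f k).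
    by move=> i; rewrite !mxE; move: (fw k i) (ltn_ord (y i)); move: (f k _ i) (nat_of_ord _) => a b; lia.
  exists (k, x); rewrite /= inE xE vevD vevN fk subrr eqxx; split => //.
  by rewrite subrK addrK.
have [g gE] := fin_all_exists split_box.
rewrite -card_box -[leqLHS]cardsT -[X in (_ <= X * _)%N]card_ord -[#|'I_q|]cardsT -cardsX.
rewrite -(card_in_imset (f := g)).
  apply/subset_leq_card/subsetP => u /imsetP[y _ ->].
  by rewrite !inE /=; have [+ _] := gE y; rewrite inE.
move=> y y' _ _ gyy; apply: box_row_inj.
by have [_ ->] := gE y; have [_ ->] := gE y'; rewrite gyy.
Qed.

End Boxes.

Section Reduction.
Variables (d : nat) (h : {poly int}).
Hypotheses (hmon : h \is monic) (hsz : size h = d.+2).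

(** Division with remainder by [al]: subtract the multiple of [al] given by the
    integral part of the quotient, whose coordinates are rational. *)
Lemma reduce_mod (al v : 'rV[int]_d.+1) L :
  nrm d h (rVpoly al) != 0 -> (forall i, `|al 0%R i| <= L)%N ->
  exists v' : 'rV[int]_d.+1, (forall i, `|v' 0%R i| <= L * comp_size d h)%N /\
    forall (S : comNzRingType) (z : S), is_root h z -> vev z al = 0 -> vev z v' = vev z v.
Proof.
move=> nz leL; set M := mult_mx d h (rVpoly al); set de := \det M.
have {}nz : de != 0 by [].
pose y := v *m \adj M; pose q : 'rV[int]_d.+1 := \row_i (y 0%R i %/ de)%Z.
pose r : 'rV[int]_d.+1 := \row_i (y 0%R i %% de)%Z.
have yE : y = de *: q + r.
  by apply/rowP => i; rewrite !mxE mulrC -divz_eq.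
pose v' := v - q *m M.
have v'E : de *: v' = r *m M.
  have : y *m M = de *: v by rewrite -mulmxA mul_adj_mx mul_mx_scalar.
  by rewrite yE mulmxDl scalerBr -scalemxAl => <-; rewrite addrC addKr.
exists v'; split => [i|S z hz al0]; last first.
  by rewrite vevD vevN (vevM hmon hsz) // -vevE al0 mulr0 subr0.
apply: leq_trans (@entry_sum_mult_mx d h al L leL).
have de0 : (0 < `|de|)%N by rewrite absz_gt0.
rewrite -(leq_pmul2l de0) -abszM.
have -> : de * v' 0 i = (r *m M) 0 i by rewrite -v'E [RHS]mxE.
rewrite mxE; apply: leq_trans (absz_sum _ _ _) _.
rewrite /entry_sum big_distrr /=; apply: leq_sum => k _; rewrite abszM leq_mul //.
  have := ltz_mod (y 0 k) nz; have := modz_ge0 (y 0 k) nz; rewrite [r 0 k]mxE; lia.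
by rewrite (bigD1 i) //= leq_addr.
Qed.

Lemma vev_const (S : comNzRingType) (z : S) k :
  vev z (delta_mx 0 0 *+ k : 'rV[int]_d.+1) = k%:R.
Proof.
rewrite -scaler_nat /vev (bigD1 ord0) //= big1 ?addr0 => [|i ni].
  by rewrite expr0 mulr1 !mxE mulr1 rmorph_nat.
by rewrite !mxE (negPf ni) andbF mulr0 mul0r.
Qed.

(** If [A] contains some [x], representatives of the classes can be reduced modulo
    [x], which makes them as small as the box. *)
Lemma crude_count (S : comNzRingType) (z : S) L q (f : 'I_q -> 'rV[int]_d.+1)
    (A : {set box d L}) :
  is_root h z -> injective (fun k => vev z (f k)) ->
  (forall x, x \in A -> vev z (box_row x) = 0 /\ nrm d h (rVpoly (box_row x)) != 0) ->
  (#|A| * q <= (L + 2 * (L * comp_size d h)) ^ d.+1)%N.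
Proof.
move=> hz finj hA; have [->|[x xA]] := set_0Vmem A; first by rewrite cards0.
have [x0 nx] := hA x xA.
have red k := reduce_mod (f k) nx (box_row_abs x).
have [g gE] := fin_all_exists red.
apply: (@pack_upper _ _ z _ _ _ g); first by move=> k i; have [] := gE k.
  move=> k l /=; have [_ ->//] := gE k; have [_ ->//] := gE l; exact: finj.
by move=> y /hA [].
Qed.

(** The pigeonhole principle, as in Thue's lemma: a box with more than [p] elements
    has two that agree at [r]; this gives a vector of size [p ^ (1 / D)], where [D]
    is the degree. *)
Lemma small_vector p (r : 'F_p) T : prime p -> (p < T.+1 ^ d.+1)%N ->
  exists al : 'rV[int]_d.+1, [/\ al != 0, vev r al = 0 & forall i, (`|al 0%R i| <= T)%N].
Proof.
move=> pp pT.
have : ~ injective (fun x : box d T.+1 => vev r (box_row x)).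
  by move=> /leq_card; rewrite card_box card_Fp // leqNgt pT.
move/injectiveP/injectivePn => [x [y nxy exy]].
exists (box_row x - box_row y); split.
- by rewrite subr_eq0; apply: contra nxy => /eqP/box_row_inj ->.
- by rewrite vevD vevN exy subrr.
- move=> i; rewrite !mxE.
  have dist_le (a b : nat) : (a < T.+1)%N -> (b < T.+1)%N -> (`|a%:Z - b%:Z| <= T)%N by lia.
  exact: (dist_le _ _ (ltn_ord (x i)) (ltn_ord (y i))).
Qed.

Hypothesis nrm_row : forall a : 'rV[int]_d.+1, a != 0 -> nrm d h (rVpoly a) != 0.

(** The residue classes modulo a prime of degree one have representatives of size
    [p ^ (1 / D)], obtained by reduction modulo [small_vector]. *)
Lemma small_reps p (r : 'F_p) T : prime p -> is_root h r -> (p < T.+1 ^ d.+1)%N ->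
  exists f : 'I_p -> 'rV[int]_d.+1, [/\ forall k i, (`|f k 0%R i| <= T * comp_size d h)%N,
    injective (fun k => vev r (f k)) & forall v : 'rV[int]_d.+1, exists k, vev r (f k) = vev r v].
Proof.
move=> pp hr pT; have [al [nal al0 leT]] := small_vector r pp pT.
have red (k : 'I_p) := reduce_mod (delta_mx 0 0 *+ k) (nrm_row nal) leT.
have [f fE] := fin_all_exists red.
have vevf k : vev r (f k) = (k : nat)%:R.
  by have [_ ->//] := fE k; exact: vev_const.
exists f; split; first by move=> k i; have [] := fE k.
  move=> k l /=; rewrite !vevf => /(congr1 val); rewrite /= !val_Fp_nat //.
  by rewrite !modn_small // => /val_inj.
move=> v; have lt : (vev r v < p)%N by rewrite -[ltnRHS](Fp_cast pp) ltn_ord.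
by exists (Ordinal lt); rewrite vevf /= natr_Zp.
Qed.

(** The number of nonzero elements of the box in the prime ideal attached to [r]. *)
Definition root_count p (r : 'F_p) L :=
  #|[set x : box d L | (vev r (box_row x) == 0) && (box_row x != 0)]|.

Lemma root_count_upper p (r : 'F_p) T L : prime p -> is_root h r -> (p < T.+1 ^ d.+1)%N ->
  (root_count r L * p <= (L + 2 * (T * comp_size d h)) ^ d.+1)%N.
Proof.
move=> pp hr pT; have [f [f1 f2 _]] := small_reps pp hr pT.
by apply: pack_upper f1 f2 _ => x; rewrite inE => /andP[/eqP].
Qed.

(** The successor on the right-hand side accounts for the zero vector. *)
Lemma root_count_lower p (r : 'F_p) T L : prime p -> is_root h r -> (p < T.+1 ^ d.+1)%N ->
  (2 * (T * comp_size d h) <= L)%N ->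
  ((L - 2 * (T * comp_size d h)) ^ d.+1 <= p * (root_count r L).+1)%N.
Proof.
move=> pp hr pT leL; have [f [f1 _ f3]] := small_reps pp hr pT.
apply: leq_trans (pack_lower leL f1 f3) _; rewrite leq_mul2l; apply/orP; right.
set A := [set x | _].
have [x0 /andP[x0A /eqP x00]|none] := pickP [pred x : box d L | (x \in A) && (box_row x == 0)].
  rewrite (cardsD1 x0) x0A add1n ltnS; apply/subset_leq_card/subsetP => x.
  rewrite !inE => /andP[nx ->]; apply: contra nx => /eqP xz.
  by apply/eqP/box_row_inj; rewrite xz.
apply: leqW; apply/subset_leq_card/subsetP => x xA.
by move: (none x) xA; rewrite /= !inE => + xA; rewrite xA /= => ->.
Qed.

Lemma root_count_crude p (r : 'F_p) L : prime p -> is_root h r ->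
  (root_count r L * p <= (L + 2 * (L * comp_size d h)) ^ d.+1)%N.
Proof.
move=> pp hr; apply: (@crude_count _ r L p (fun k : 'I_p => delta_mx 0 0 *+ k)) => //.
  by move=> k l /=; rewrite !vev_const => /(congr1 val); rewrite /= !val_Fp_nat // !modn_small // => /val_inj.
by move=> x; rewrite inE => /andP[/eqP ? /nrm_row].
Qed.

End Reduction.

(** * Norms divisible by the square of a prime *)

Lemma taylor2 (S : comNzRingType) (u : {poly S}) (x e : S) :
  exists c, u.[x + e] = u.[x] + e * u^`().[x] + e ^+ 2 * c.
Proof.
elim/poly_ind: u => [|u a [c IH]].
  by exists 0; rewrite deriv0 !horner0 !mulr0 !addr0.
exists (c * (x + e) + u^`().[x]); rewrite derivD derivM derivX derivC.
rewrite !hornerE IH; ring.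
Qed.

Lemma Zp_intr_eq0 m (x : int) : (1 < m)%N -> ((x%:~R : 'Z_m) == 0) = (m %| x)%Z.
Proof.
move=> m1.
have nat0 n : ((n%:R : 'Z_m) == 0) = (m %| n)%N.
  by rewrite -val_eqE /= val_Zp_nat.
by case: x => n; rewrite ?NegzE ?rmorphN ?oppr_eq0 ?dvdzE ?abszN -?pmulrn nat0.
Qed.

Lemma horner_rmorph (S S' : comNzRingType) (f : {rmorphism S -> S'}) (v : {poly int}) x :
  (map_poly intr v).[f x] = f (map_poly intr v).[x].
Proof.
rewrite -horner_map; congr (_.[_]).
by rewrite -map_poly_comp; apply: eq_map_poly => k; rewrite /= rmorph_int.
Qed.

Lemma vev_rmorph d (S S' : comNzRingType) (f : {rmorphism S -> S'}) x (a : 'rV[int]_d.+1) :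
  vev (f x) a = f (vev x a).
Proof. by rewrite !vevE horner_rmorph. Qed.

Lemma char_poly_horner (S : comNzRingType) n (M : 'M[S]_n) y : (char_poly M).[y] = \det (y%:M - M).
Proof.
rewrite /char_poly -[LHS]/(horner_eval y _) -det_map_mx; congr (\det _).
apply/matrixP => i j; rewrite /char_poly_mx !mxE /= /horner_eval.
by rewrite hornerD hornerN hornerC hornerMn hornerX.
Qed.

Section SquareDivisors.
Variables (d : nat) (h : {poly int}).
Hypotheses (hmon : h \is monic) (hsz : size h = d.+2).
Variables (p : nat) (Om : closedFieldType) (phi : {rmorphism 'F_p -> Om}).
Hypotheses (pp : prime p) (pdisc : ~~ (p %| disc d h)%Z).
Variable z : 'I_d.+1 -> Om.
Hypotheses (zinj : injective z) (hz : forall i, is_root h (z i)).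
Hypothesis hE : map_poly intr h = \prod_i ('X - (z i)%:P).

Let charOm : p \in [pchar Om].
Proof. by rewrite (fmorph_pchar phi) pchar_Fp. Qed.

Let om0 (x : int) : (x%:~R == 0 :> Om) = (p %| x)%Z.
Proof. exact: (intr_eq0_mod charOm). Qed.

Let horner_intr (S : comNzRingType) (u : {poly int}) (x : int) :
  (map_poly intr u).[x%:~R] = (u.[x])%:~R :> S.
Proof. by rewrite horner_map. Qed.

Lemma root_of_root (y : Om) : is_root h y -> exists i, y = z i.
Proof.
rewrite /is_root hE => /eqP; rewrite horner_prod => /prodf_eq0 [i _].
by rewrite hornerXsubC subr_eq0 => /eqP ->; exists i.
Qed.

Lemma deriv_root_neq0 (y : Om) : is_root h y -> (map_poly intr h^`()).[y] != 0.
Proof.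
move=> hy; apply: contra pdisc => /eqP h'y.
by rewrite -om0 (nrm_root hmon hsz hy).
Qed.

(** The Frobenius permutes the roots of [h] at which [u] vanishes. If there is only
    one, it is fixed, hence lies in the prime field. *)
Lemma single_zero_Fp (u : {poly int}) i0 : (map_poly intr u).[z i0] = 0 ->
  (forall i, (map_poly intr u).[z i] = 0 -> i = i0) ->
  exists r : int, r%:~R = z i0.
Proof.
move=> u0 uniq0.
have frob (v : {poly int}) (y : Om) : (map_poly intr v).[y ^+ p] = (map_poly intr v).[y] ^+ p.
  by rewrite -!(pFrobenius_autE charOm) horner_rmorph.
have [i zi] : exists i, z i0 ^+ p = z i.
  by apply: root_of_root; rewrite /is_root frob hz expr0n -[p]prednK ?prime_gt0.
have ii0 : i = i0 by apply: uniq0; rewrite -zi frob u0 expr0n -[p]prednK ?prime_gt0.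
have : root (map_poly phi ('X^#|'F_p| - 'X)) (z i0).
  by rewrite rmorphB /= map_polyXn map_polyX rootE !hornerE card_Fp // zi ii0 subrr.
rewrite finField_genPoly rmorph_prod rootE horner_prod => /prodf_eq0 [r _].
rewrite rmorphB /= map_polyX map_polyC hornerXsubC subr_eq0 => /eqP zr.
have rE : (r : nat)%:R = r :> 'F_p := natr_Zp r.
exists (r : nat)%:Z; rewrite zr; transitivity (phi ((r : nat)%:R : 'F_p)); last by rewrite rE.
by rewrite rmorph_nat.
Qed.

(** If [u] vanishes at a single root of [h], then [0] is a simple root of the
    characteristic polynomial of [u] modulo [p]. *)
Lemma char_poly_simple (u : {poly int}) i0 : (map_poly intr u).[z i0] = 0 ->
  (forall i, (map_poly intr u).[z i] = 0 -> i = i0) ->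
  ~~ (p %| (char_poly (mult_mx d h u))^`().[0])%Z.
Proof.
move=> u0 uniq0; rewrite -om0 horner_coef0 -coef_map -horner_coef0.
rewrite -deriv_map (char_poly_mult_mx hmon hsz zinj hz) (bigD1 i0) //= u0 subr0.
rewrite derivM derivX mul1r !hornerE /= horner_prod; apply/prodf_neq0 => i ni.
rewrite hornerXsubC sub0r oppr_eq0; apply: contra ni => /eqP/uniq0 ->.
by rewrite eqxx.
Qed.

(** The value [u(r)] is an eigenvalue of the multiplication by [u] modulo [m], for the
    eigenvector of the powers of [r]. *)
Lemma char_poly_root (m : nat) (u : {poly int}) (r : int) : (1 < m)%N -> (m %| h.[r])%Z ->
  (m %| (char_poly (mult_mx d h u)).[u.[r]])%Z.
Proof.
move=> m1 hr; rewrite -(Zp_intr_eq0 _ m1).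
have rr : is_root h (r%:~R : 'Z_m).
  by apply/eqP; rewrite horner_intr Zp_intr_eq0.
pose M : 'M['Z_m]_d.+1 := map_mx intr (mult_mx d h u).
rewrite -horner_intr map_char_poly -/M -horner_intr.
set y := (map_poly intr u).[_].
rewrite char_poly_horner; have : \adj (y%:M - M) *m ((y%:M - M) *m powers d (r%:~R : 'Z_m)) = 0.
  by rewrite mulmxBl (mult_mx_powers hmon hsz) // mul_scalar_mx subrr mulmx0.
rewrite mulmxA mul_adj_mx mul_scalar_mx.
by move/matrixP => /(_ 0 0); rewrite !mxE expr0 mulr1 => ->.
Qed.

Lemma hensel (r : int) : (p %| h.[r])%Z ->
  exists r' : int, r'%:~R = r%:~R :> Om /\ ((p ^ 2)%N %| h.[r'])%Z.
Proof.
move=> hr.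
have rr : is_root h (r%:~R : Om) by apply/eqP; rewrite horner_intr om0.
have := deriv_root_neq0 rr; rewrite horner_intr om0 => ph'.
have /coprimezP [[a b] /= ab] : coprimez (h^`()).[r] p.
  by rewrite coprimezE coprime_sym prime_coprime // -[p]/`|p%:Z|%N -dvdzE.
have /dvdzP [q hq] := hr.
have [c cE] := taylor2 h r (- (q * a * p%:Z)).
exists (r - q * a * p%:Z); split.
  rewrite rmorphB /= (_ : (q * a * p%:Z)%:~R = 0) ?subr0 //.
  by apply/eqP; rewrite om0 dvdz_mull.
rewrite cE hq; apply/dvdzP; exists (q * b + (q * a) ^+ 2 * c).
have -> : (p ^ 2)%N%:Z = p%:Z ^+ 2 by rewrite -natz natrX natz.
have -> : q * p%:Z = q * p%:Z * (a * h^`().[r] + b * p%:Z) by rewrite ab mulr1.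
ring.
Qed.

Lemma hensel_uniq (r r' : int) : r%:~R = r'%:~R :> Om ->
  ((p ^ 2)%N %| h.[r])%Z -> ((p ^ 2)%N %| h.[r'])%Z -> ((p ^ 2)%N %| r' - r)%Z.
Proof.
move=> err hr hr'.
have pe : (p %| r' - r)%Z by rewrite -om0 rmorphB /= err subrr.
have p2 : (p ^ 2)%N%:Z = p%:Z ^+ 2 by rewrite -natz natrX natz.
have [c] := taylor2 h r (r' - r); rewrite addrC subrK => cE.
have p2h : ((p ^ 2)%N %| (r' - r) * h^`().[r])%Z.
  have -> : (r' - r) * h^`().[r] = h.[r'] - h.[r] - (r' - r) ^+ 2 * c by rewrite cE; ring.
  by rewrite !rpredB // dvdz_mulr // p2 dvdz_exp2r.
rewrite -(Gauss_dvdzl _ (p := h^`().[r])) //.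
rewrite p2 coprimezXl // coprimezE prime_coprime // -[p]/`|p%:Z|%N -dvdzE -om0 -horner_intr.
apply: deriv_root_neq0; apply/eqP; rewrite horner_intr om0.
by apply: dvdz_trans hr; rewrite p2 dvdz_exp.
Qed.

(** A norm divisible by [p ^ 2] comes from two roots of [h] modulo [p] or from one root
    modulo [p ^ 2]. Indeed, if [u] vanishes at a single root modulo [p], lift the root to
    [r] modulo [p ^ 2]; then [u(r)] is a zero modulo [p ^ 2] of the characteristic
    polynomial [P] of [u], and since [P(0)] is the norm up to sign and [P'(0)] is prime
    to [p], [p ^ 2] divides [u(r)]. *)
Lemma square_divisor_cases (u : {poly int}) : ((p ^ 2)%N %| nrm d h u)%Z ->
  (exists i j, [/\ i != j, (map_poly intr u).[z i] = 0 & (map_poly intr u).[z j] = 0]) \/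
  (exists i (r : int), [/\ r%:~R = z i, ((p ^ 2)%N %| h.[r])%Z & ((p ^ 2)%N %| u.[r])%Z]).
Proof.
move=> p2u.
have p2 : (p ^ 2)%N%:Z = p%:Z ^+ 2 by rewrite -natz natrX natz.
have pu : (p %| nrm d h u)%Z by apply: dvdz_trans p2u; rewrite p2 dvdz_exp.
have : (nrm d h u)%:~R == 0 :> Om by rewrite om0.
rewrite (nrm_mod hmon hsz zinj hz) => /prodf_eq0 [i0 _ /eqP u0].
have [/existsP[j /andP[ji /eqP uj]]|none] :=
    boolP [exists j, (j != i0) && ((map_poly intr u).[z j] == 0)].
  by left; exists j, i0.
have uniq0 j : (map_poly intr u).[z j] = 0 -> j = i0.
  move=> uj; apply/eqP; apply: contraNT none => ji.
  by apply/existsP; exists j; rewrite ji uj eqxx.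
right; have [r0 r0E] := single_zero_Fp u0 uniq0.
have [|r [rE hr]] := @hensel r0.
  by rewrite -om0 -horner_intr r0E hz.
exists i0, r; split => //; first by rewrite rE.
have pr : (p %| u.[r])%Z by rewrite -om0 -horner_intr rE r0E u0.
have p21 : (1 < p ^ 2)%N by rewrite -[1%N](exp1n 2) ltn_exp2r // prime_gt1.
have := char_poly_root u p21 hr.
have [c] := taylor2 (char_poly (mult_mx d h u)) 0 u.[r]; rewrite add0r => ->.
have dvd0 : ((p ^ 2)%N %| (char_poly (mult_mx d h u)).[0])%Z.
  by rewrite horner_coef0 char_poly_det dvdz_mull.
have dvd2 : ((p ^ 2)%N %| u.[r] ^+ 2 * c)%Z by rewrite dvdz_mulr // p2 dvdz_exp2r.
rewrite rpredDr // rpredDl // => dvd1.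
rewrite -(Gauss_dvdzl _ (p := (char_poly (mult_mx d h u))^`().[0])) //.
rewrite p2 coprimezXl // coprimezE prime_coprime // -[p]/`|p%:Z|%N -dvdzE.
exact: char_poly_simple u0 uniq0.
Qed.

Hypothesis nrm_row : forall a : 'rV[int]_d.+1, a != 0 -> nrm d h (rVpoly a) != 0.

Let bound L := ((L + 2 * (L * comp_size d h)) ^ d.+1)%N.

(** Vanishing at both roots is vanishing at one point of the ring [Om * Om], where
    the [p ^ 2] elements [a + b th] take distinct values. *)
Lemma count_two_roots L (i j : 'I_d.+1) (A : {set box d L}) : i != j ->
  (forall x, x \in A -> [/\ vev (z i) (box_row x) = 0, vev (z j) (box_row x) = 0 &
     box_row x != 0]) ->
  (#|A| * p ^ 2 <= bound L)%N.
Proof.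
move=> nij hA.
have d0 : (1 < d.+1)%N.
  by have := ltn_ord i; have := ltn_ord j; have : (i != j :> nat) by []; lia.
pose one := Ordinal d0.
pose f (k : 'I_p * 'I_p) : 'rV[int]_d.+1 := delta_mx 0 0 *+ k.1 + delta_mx 0 one *+ k.2.
have vevf (y : Om) k : vev y (f k) = k.1%:R + k.2%:R * y.
  rewrite vevD vev_const; congr (_ + _).
  rewrite -scaler_nat /vev (bigD1 one) //= big1 ?addr0 => [|l nl].
    by rewrite expr1 !mxE mulr1 rmorph_nat.
  by rewrite !mxE (negPf nl) andbF mulr0 mul0r.
pose S := (Om * Om)%type; pose zz : S := (z i, z j).
have vev_pair (a : 'rV[int]_d.+1) : vev zz a = (vev (z i) a, vev (z j) a).
  rewrite [LHS]surjective_pairing; congr pair.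
    by rewrite -(vev_rmorph (@fst Om Om : {rmorphism S -> Om})).
  by rewrite -(vev_rmorph (@snd Om Om : {rmorphism S -> Om})).
have rzz : is_root h zz.
  rewrite /is_root [LHS]surjective_pairing.
  rewrite -(horner_rmorph (@fst Om Om : {rmorphism S -> Om})).
  by rewrite -(horner_rmorph (@snd Om Om : {rmorphism S -> Om})) /= !hz.
have natinj (a b : 'I_p) : (a : nat)%:R = (b : nat)%:R :> Om -> a = b.
  move=> /eqP; rewrite -subr_eq0 -[_%:R]/((a%:Z)%:~R) -[X in _ - X]/((b%:Z)%:~R) -rmorphB om0.
  move=> /dvdzP [q qE]; apply/val_inj => /=; have := ltn_ord a; have := ltn_ord b.
  have [q0|[q0|q0]] : q = 0 \/ (q >= 1) \/ (q <= -1) by lia.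
  - by move: qE; rewrite q0 mul0r; lia.
  - nia.
  - nia.
have pE : (p ^ 2)%N = #|{: 'I_p * 'I_p}| by rewrite card_prod !card_ord.
rewrite pE; apply: (@crude_count _ _ hmon hsz S zz L _ (fun k => f (enum_val k))) => //.
- move=> k l /=; rewrite !vev_pair !vevf; move: (enum_val k) (@enum_val_inj _ _ k l).
  move: (enum_val l) => -[b1 b2] [a1 a2] /= inj [e1 e2]; apply: inj.
  have e : (a2%:R - b2%:R) * (z i - z j) = 0 :> Om.
    transitivity ((a1%:R + a2%:R * z i) - (b1%:R + b2%:R * z i) -
      ((a1%:R + a2%:R * z j) - (b1%:R + b2%:R * z j))); first by ring.
    by rewrite e1 e2 !subrr.
  have nz : z i - z j != 0 by rewrite subr_eq0; apply: contra nij => /eqP/zinj ->.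
  move/eqP: e; rewrite mulf_eq0 (negPf nz) orbF subr_eq0 => /eqP/natinj ab2.
  by move: e1; rewrite ab2 => /addIr/natinj ->.
- move=> x /hA [h1 h2 nx]; split; last exact: nrm_row.
  by rewrite vev_pair h1 h2.
Qed.

Lemma count_hensel L (r : int) (A : {set box d L}) : ((p ^ 2)%N %| h.[r])%Z ->
  (forall x, x \in A -> ((p ^ 2)%N %| (rVpoly (box_row x)).[r])%Z /\ box_row x != 0) ->
  (#|A| * p ^ 2 <= bound L)%N.
Proof.
move=> hr hA.
have p21 : (1 < p ^ 2)%N by rewrite -[1%N](exp1n 2) ltn_exp2r // prime_gt1.
have rr : is_root h (r%:~R : 'Z_(p ^ 2)) by apply/eqP; rewrite horner_intr Zp_intr_eq0.
apply: (@crude_count _ _ hmon hsz _ (r%:~R : 'Z_(p ^ 2)) L _ (fun k : 'I_(p ^ 2) => delta_mx 0 0 *+ k)) => //.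
  move=> k l /=; rewrite !vev_const => /(congr1 val); rewrite /= !val_Zp_nat //.
  by rewrite !modn_small // => /val_inj.
move=> x /hA [px nx]; split; last exact: nrm_row.
by apply/eqP; rewrite vevE horner_intr Zp_intr_eq0.
Qed.

(** The elements of norm divisible by [p ^ 2] have density [O(1 / p ^ 2)], so these
    primes contribute a bounded amount to the average of [log |N(x)|]. *)
Lemma count_square L :
  (#|[set x : box d L | (box_row x != 0%R) && ((p ^ 2)%N %| nrm d h (rVpoly (box_row x)))%Z]|
     * p ^ 2 <= (d.+1 * d.+1 + d.+1) * bound L)%N.
Proof.
set A := [set x | _].
pose A1 (ij : 'I_d.+1 * 'I_d.+1) : {set box d L} :=
  if ij.1 != ij.2 then [set x | [&& vev (z ij.1) (box_row x) == 0,
     vev (z ij.2) (box_row x) == 0 & box_row x != 0%R]] else set0.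
pose ok (i : 'I_d.+1) (r : int) := r%:~R = z i /\ ((p ^ 2)%N %| h.[r])%Z.
have pick i : exists B : {set box d L}, (#|B| * p ^ 2 <= bound L)%N /\
    forall x r, ok i r -> box_row x != 0 -> ((p ^ 2)%N %| (rVpoly (box_row x)).[r])%Z -> x \in B.
  have [[r [rz hr]]|none] := boolp.pselect (exists r, ok i r); last first.
    by exists set0; rewrite cards0; split => // x r okr; case: none; exists r.
  exists [set x | (box_row x != 0%R) && ((p ^ 2)%N %| (rVpoly (box_row x)).[r])%Z]; split.
    by apply: (count_hensel hr) => x; rewrite inE => /andP[].
  move=> x r' [rz' hr'] nx pr'; rewrite inE nx /=.
  have rr' : r'%:~R = r%:~R :> Om by rewrite rz rz'.
  have dv := hensel_uniq rr' hr' hr.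
  have [c] := taylor2 (rVpoly (box_row x)) r' (r - r'); rewrite addrC subrK => ->.
  by rewrite -addrA rpredD // rpredD // ?expr2 -?mulrA dvdz_mulr.
have [B hB] := fin_all_exists pick.
have sub : A \subset (\bigcup_ij A1 ij) :|: (\bigcup_i B i).
  apply/subsetP => x; rewrite inE => /andP[nx /square_divisor_cases].
  case=> [[i [j [nij ui uj]]]|[i [r [rz hr pr]]]]; apply/setUP; [left|right].
    apply/bigcupP; exists (i, j) => //; rewrite /A1 /= nij inE nx !vevE ui uj !eqxx //.
  apply/bigcupP; exists i => //.
  by have [_ /(_ x r)] := hB i; apply.
have le1 : (#|\bigcup_ij A1 ij| * p ^ 2 <= d.+1 * d.+1 * bound L)%N.
  apply: (@leq_trans ((\sum_ij #|A1 ij|) * p ^ 2)).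
    rewrite leq_mul2r; apply/orP; right.
    by elim/big_rec2: _ => [|ij m C _ IH]; rewrite ?cards0 // (leq_trans (leq_card_setU _ _)) // leq_add2l.
  have -> : (d.+1 * d.+1 * bound L = \sum_(ij : 'I_d.+1 * 'I_d.+1) bound L)%N.
    by rewrite sum_nat_const card_prod !card_ord.
  rewrite big_distrl /=; apply: leq_sum => -[i j] _; rewrite /A1 /=.
  case: ifP => nij; last by rewrite cards0.
  by apply: (count_two_roots nij) => x; rewrite inE => /and3P[/eqP ? /eqP].
have le2 : (#|\bigcup_i B i| * p ^ 2 <= d.+1 * bound L)%N.
  apply: (@leq_trans ((\sum_i #|B i|) * p ^ 2)).
    rewrite leq_mul2r; apply/orP; right.
    by elim/big_rec2: _ => [|ij m C _ IH]; rewrite ?cards0 // (leq_trans (leq_card_setU _ _)) // leq_add2l.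
  have -> : (d.+1 * bound L = \sum_(i : 'I_d.+1) bound L)%N by rewrite sum_nat_const card_ord.
  by rewrite big_distrl /=; apply: leq_sum => i _; have [] := hB i.
rewrite mulnDl; apply: leq_trans (leq_add le1 le2).
rewrite -mulnDl leq_mul2r; apply/orP; right.
exact: leq_trans (subset_leq_card sub) (leq_card_setU _ _).
Qed.

End SquareDivisors.

(** * Small values and divisible values of a monic polynomial *)

Lemma card_ord_neq n (l : 'I_n.+1) : #|[pred k | k != l]| = n.
Proof.
transitivity #|predC1 l|; first by apply: eq_card => k; rewrite !inE.
by rewrite cardC1 card_ord.
Qed.

(** The leading coefficient in Lagrange's interpolation formula. It shows that
    the values of a monic polynomial at [n + 1] spread-out integers cannot all be
    small, neither for the absolute value nor for the [p]-adic one. *)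
Lemma interpolation_monic n (g : {poly int}) (x : 'I_n.+1 -> int) :
  g \is monic -> size g = n.+1 -> injective x ->
  \sum_l (g.[x l])%:~R / (\prod_(k | k != l) (x l - x k))%:~R = 1 :> rat.
Proof.
move=> gm gs xinj; pose y l : rat := (x l)%:~R.
have yinj : injective y by move=> k l /eqP; rewrite eqr_int => /eqP /xinj.
pose w l : rat := \prod_(k | k != l) (y l - y k).
have wE l : (\prod_(k | k != l) (x l - x k))%:~R = w l.
  by rewrite rmorph_prod; apply: eq_bigr => k _; rewrite rmorphB.
have w0 l : w l != 0.
  apply/prodf_neq0 => k nk; rewrite subr_eq0; apply: contra nk => /eqP/yinj ->.
  exact: eqxx.
pose q l : {poly rat} := \prod_(k | k != l) ('X - (y k)%:P).
have qs l : size (q l) = n.+1.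
  rewrite /q -big_filter size_prod_XsubC; congr _.+1.
  by rewrite -[RHS](card_ord_neq l) cardE /enum_mem size_filter.
have qm l : q l \is monic by apply: monic_prod => k _; exact: monicXsubC.
pose P := map_poly intr g - \sum_l ((g.[x l])%:~R / w l) *: q l.
have P0 : P = 0.
  apply/eqP; apply: contraT => nP.
  have := max_poly_roots nP (rs := [seq y l | l <- enum 'I_n.+1]).
  rewrite size_map size_enum_ord map_inj_uniq ?enum_uniq // => /(_ _ isT) H.
  have : (n.+1 < size P)%N.
    apply: H; apply/allP => _ /mapP[l _ ->]; rewrite /P rootE !hornerE horner_map horner_sum.
    rewrite (bigD1 l) //= big1 ?addr0 => [|k nk].
      rewrite hornerZ horner_prod; under [in X in _ * X]eq_bigr do rewrite hornerXsubC.
      by rewrite divfK ?w0 // subrr.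
    rewrite hornerZ horner_prod (bigD1 l) ?(eq_sym l) //= hornerXsubC subrr.
    by rewrite mul0r mulr0.
  rewrite ltnNge => /negP[]; rewrite /P.
  apply: leq_trans (size_polyD _ _) _; rewrite size_polyN geq_max.
  rewrite (leq_trans (size_poly _ _)) ?gs //=.
  apply: leq_trans (size_sum _ _ _) _; apply/bigmax_leqP => l _.
  by apply: leq_trans (size_scale_leq _ _) _; rewrite qs.
have /polyP/(_ n) := P0; rewrite coefB coef_map coef_sum coef0 /=.
have -> : g`_n = 1 by rewrite -(monicP gm) lead_coefE gs.
move/eqP; rewrite subr_eq0 rmorph1 => /eqP E; rewrite [RHS]E.
apply: eq_bigr => l _; rewrite coefZ wE.
by have /monicP := qm l; rewrite lead_coefE qs => ->; rewrite mulr1.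
Qed.

Lemma size_by_class (T U : eqType) (f : T -> U) (s : seq T) :
  size s = (\sum_(c <- undup (map f s)) count (fun a => f a == c) s)%N.
Proof.
rewrite -(size_map f) -sum1_size -big_undup_iterop_count; apply: eq_bigr => c _.
by rewrite Monoid.iteropE iter_addn addn0 mul1n count_map.
Qed.

Section OneVariable.
Variables (n : nat) (g : {poly int}).
Hypotheses (gm : g \is monic) (gs : size g = n.+1).

Lemma sorted_gap (s : seq nat) i j : sorted ltn s -> (i <= j < size s)%N ->
  (nth 0 s i + (j - i) <= nth 0 s j)%N.
Proof.
move=> ss /andP[ij js]; elim: j ij js => [|j IH] ij js.
  by move: ij; rewrite leqn0 => /eqP ->; rewrite addn0.
have [->|nij] := eqVneq i j.+1; first by rewrite subnn addn0.
have lij : (i <= j)%N by lia.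
have := IH lij (ltnW js).
have := sorted_ltn_nth ltn_trans 0%N ss; move=> /(_ j j.+1); rewrite !inE (ltnW js) js.
move=> /(_ isT isT (ltnSn j)); lia.
Qed.

(** Otherwise [n + 1] of these integers are at mutual distance at least [w], and the
    sum in [interpolation_monic] is less than [1]. *)
Lemma count_small_values w L : (0 < w)%N ->
  (count (fun a : nat => (n.+1 * `|g.[a%:Z]| < w ^ n)%N) (iota 0 L) <= n * w)%N.
Proof.
move=> w0; set P := fun a => _; rewrite -size_filter leqNgt; apply/negP => lt.
set s := filter P (iota 0 L) in lt.
have ss : sorted ltn s by apply: sorted_filter (iota_ltn_sorted _ _); exact: ltn_trans.
pose x (l : 'I_n.+1) : int := (nth 0 s (l * w))%:Z.
have lw (l : 'I_n.+1) : (l * w < size s)%N.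
  by apply: leq_ltn_trans lt; rewrite leq_mul2r -ltnS ltn_ord orbT.
have gap0 (k l : 'I_n.+1) : (k < l)%N -> (w <= `|x l - x k|)%N.
  move=> kl; have kwl : (k * w <= l * w)%N by rewrite leq_mul2r ltnW ?orbT.
  have absge (a b c : nat) : (b + c <= a)%N -> (c <= `|a%:Z - b%:Z|)%N by lia.
  have := @sorted_gap s (k * w) (l * w) ss; rewrite kwl lw => /(_ isT)/absge.
  by apply: leq_trans; rewrite -mulnBl leq_pmull // subn_gt0.
have gap (k l : 'I_n.+1) : k != l -> (w <= `|x l - x k|)%N.
  case: (ltngtP k l) => [/gap0 //|/gap0 + _|/val_inj ->]; last by rewrite eqxx.
  by rewrite distnC.
have xinj : injective x.
  move=> k l xkl; apply/eqP; apply: contraT => /gap; rewrite xkl subrr /=; lia.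
have := interpolation_monic gm gs xinj.
have small l : `|(g.[x l])%:~R / (\prod_(k | k != l) (x l - x k))%:~R| < (n.+1%:R)^-1 :> rat.
  rewrite normrM normfV -!intr_norm -!abszE.
  have wge : (w ^ n <= absz (\prod_(k | k != l) (x l - x k))%R)%N.
    rewrite absz_prod.
    have -> : (w ^ n = \prod_(k < n.+1 | k != l) w)%N.
      by rewrite prod_nat_const (card_ord_neq l).
    by apply: leq_prod => k nk; apply: gap.
  set W := absz _ in wge *.
  have W0 : (0 < W)%N by apply: leq_trans wge; rewrite expn_gt0 w0.
  have Px : P (nth 0%N s (l * w)) by have := mem_nth 0%N (lw l); rewrite mem_filter => /andP[].
  rewrite ltr_pdivrMr ?ltr0n // mulrC ltr_pdivlMr ?ltr0n //.
  rewrite -!pmulrn -natrM ltr_nat mulnC.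
  exact: leq_trans Px wge.
move=> /(congr1 Num.norm); rewrite normr1 => E.
have := ler_norm_sum (index_enum 'I_n.+1) (fun l => (g.[x l])%:~R / (\prod_(k | k != l) (x l - x k))%:~R : rat) xpredT.
rewrite E; apply/negP; rewrite -ltNge.
have E1 : 1 = \sum_(l < n.+1) (n.+1%:R)^-1 :> rat.
  by rewrite sumr_const card_ord -[RHS]mulr_natr mulVf // pnatr_eq0.
rewrite [ltRHS]E1; apply: ltr_sum => [|l _]; last exact: small.
by apply/hasP; exists ord0; rewrite ?mem_index_enum.
Qed.

Lemma count_residue (m c L : nat) : (0 < m)%N ->
  (count (fun a => (a %% m)%N == c) (iota 0 L) <= L %/ m + 1)%N.
Proof.
move=> m0; rewrite -size_filter.
have [lt|ge] := ltnP c m; last first.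
  rewrite (@eq_in_filter _ _ pred0) ?filter_pred0 // => a _.
  by apply/eqP => E; move: (ltn_pmod a m0); rewrite /= E ltnNge ge.
rewrite -[leqRHS](size_iota 0) -(size_map (fun a => (a %/ m)%N)).
apply: uniq_leq_size.
  rewrite map_inj_in_uniq ?filter_uniq ?iota_uniq // => a b.
  rewrite !mem_filter => /andP[/eqP ac _] /andP[/eqP bc _] ab.
  by rewrite (divn_eq a m) (divn_eq b m) ac bc ab.
move=> y /mapP[a + ->]; rewrite mem_filter !mem_iota => /andP[_ /andP[_ aL]].
by rewrite /= addn1 ltnS leq_div2r // ltnW.
Qed.

(** The [p]-adic analogue of [count_small_values]: if the integers meet more than [n]
    classes modulo [p ^ i], then all the terms in [interpolation_monic] have a
    numerator divisible by [p]. *)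
Lemma count_prime_power p i j L : prime p -> (0 < i)%N -> (n * i.-1 < j)%N ->
  (count (fun a : nat => (p ^ j %| `|g.[a%:Z]|)%N) (iota 0 L) <= n * (L %/ p ^ i + 1))%N.
Proof.
move=> pp i0 ij; set P := fun a => _; set s := filter P (iota 0 L).
have pi0 : (0 < p ^ i)%N by rewrite expn_gt0 prime_gt0.
pose cl := undup [seq (a %% p ^ i)%N | a <- s].
have cl_le : (size cl <= n)%N.
  rewrite leqNgt; apply/negP => lt.
  have rep (l : 'I_n.+1) : exists a, a \in s /\ (a %% p ^ i)%N = nth 0%N cl l.
    have : nth 0%N cl l \in cl by apply: mem_nth; apply: leq_trans lt; rewrite ltnS -ltnS ltn_ord.
    by rewrite mem_undup => /mapP[a sa ->]; exists a.
  have [a aP] := fin_all_exists rep.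
  pose x l : int := (a l)%:Z.
  have ndv (k l : 'I_n.+1) : k != l -> ~~ (p ^ i %| `|x l - x k|)%N.
    move=> nkl; apply/negP => dv.
    have : (a l = a k %[mod p ^ i])%N.
      apply/eqP; case: (leqP (a k) (a l)) => le; last rewrite eq_sym.
        by rewrite eqn_mod_dvd //; move: dv; rewrite /x; congr (_ %| _)%N; lia.
      by rewrite eqn_mod_dvd ?(ltnW le) //; move: dv; rewrite /x; congr (_ %| _)%N; lia.
    have [_ ->] := aP l; have [_ ->] := aP k => /eqP; rewrite nth_uniq ?undup_uniq //.
    - by rewrite eq_sym => /eqP/val_inj/eqP; rewrite (negPf nkl).
    - by apply: leq_trans lt; rewrite ltnS -ltnS ltn_ord.
    - by apply: leq_trans lt; rewrite ltnS -ltnS ltn_ord.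
  have xinj : injective x.
    by move=> k l xkl; apply/eqP; apply: contraT => /ndv; rewrite xkl subrr dvdn0.
  have := interpolation_monic gm gs xinj.
  pose tiny (y : rat) := exists c m : int, ~~ (p %| m)%Z /\ y * m%:~R = (p%:Z * c)%:~R.
  have tinyD y y' : tiny y -> tiny y' -> tiny (y + y').
    move=> [c [m [pm ym]]] [c' [m' [pm' ym']]]; exists (c * m' + c' * m), (m * m'); split.
      by rewrite dvdzE abszM Euclid_dvdM // negb_or -!dvdzE pm.
    rewrite mulrDr !rmorphM !rmorphD !rmorphM /= mulrDl.
    have -> : y * (m%:~R * m'%:~R) = (y * m%:~R) * m'%:~R by ring.
    have -> : y' * (m%:~R * m'%:~R) = (y' * m'%:~R) * m%:~R by ring.
    by rewrite ym ym' !rmorphM /=; ring.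
  have tiny0 : tiny 0.
    exists 0, 1; rewrite mulr0 mul0r; split => //.
    by rewrite dvdzE dvdn1; have := prime_gt1 pp; case: (p) => [|[]].
  have tiny_sum : tiny (\sum_l (g.[x l])%:~R / (\prod_(k | k != l) (x l - x k))%:~R).
    elim/big_ind: _ => // l _; set w := \prod_(_ | _) _.
    have w0 : (0 < `|w|)%N.
      rewrite absz_gt0; apply/prodf_neq0 => k nk; apply: contraNneq (ndv _ _ nk) => ->.
      by rewrite dvdn0.
    have lw : (logn p `|w| <= n * i.-1)%N.
      have -> : (n * i.-1 = \sum_(k < n.+1 | k != l) i.-1)%N.
        by rewrite sum_nat_const (card_ord_neq l).
      rewrite /w absz_prod.
      suff : (0 < \prod_(k | k != l) `|(x l - x k)%R|)%N /\ (logn p (\prod_(k | k != l) `|(x l - x k)%R|) <= \sum_(k < n.+1 | k != l) i.-1)%N by case.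
      elim/big_ind2: _ => [|u1 v1 u2 v2 [a1 b1] [a2 b2]|k nk]; first by rewrite logn1.
        by rewrite muln_gt0 a1 a2 lognM // leq_add.
      have nd := ndv _ _ nk; have nz : (0 < `|x l - x k|)%N.
        by rewrite lt0n; apply: contra nd => /eqP ->; rewrite dvdn0.
      split => //; rewrite -ltnS prednK // ltnNge; apply: contra nd.
      by rewrite -pfactor_dvdn.
    have [m pm wE] := pfactor_coprime pp w0.
    have [sa _] := aP l; move: sa; rewrite mem_filter => /andP[/dvdnP[c cE] _].
    have sj : ((logn p `|w|).+1 + (j - (logn p `|w|).+1) = j)%N by rewrite subnKC //; lia.
    exists (Num.sg g.[x l] * Num.sg w * (c * p ^ (j - (logn p `|w|).+1))%N%:Z), m%:Z; split.
      by rewrite dvdzE /= -prime_coprime.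
    have wr : w%:~R != 0 :> rat by rewrite intr_eq0 -absz_gt0.
    apply: (mulIf wr); rewrite mulrAC divfK // -!rmorphM /=; congr (_%:~R).
    have gE : g.[x l] = Num.sg g.[x l] * (c * p ^ j)%N%:Z by rewrite -cE abszE -numEsg.
    have wE' : w = Num.sg w * (m * p ^ logn p `|w|)%N%:Z by rewrite -wE abszE -numEsg.
    rewrite {1}gE [X in _ = _ * X]wE' -[in LHS]sj expnD expnS.
    have sw : Num.sg w * Num.sg w = 1 by rewrite -expr2 sqr_sg -absz_gt0 w0.
    have rid (e b c' q r m' p' : int) : b * b = 1 ->
        e * (c' * (p' * q * r)) * m' = p' * (e * b * (c' * r)) * (b * (m' * q)).
      move=> bb; transitivity (p' * (e * (b * b) * (c' * r)) * (m' * q)); last by ring.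
      by rewrite bb; ring.
    by rewrite !PoszM; exact: rid.
  move=> E; move: tiny_sum; rewrite E => -[c [m [pm]]]; rewrite mul1r => /eqP.
  by rewrite eqr_int => /eqP mE; move: pm; rewrite mE dvdz_mulr.
rewrite -size_filter -/s.
rewrite (size_by_class (fun a => a %% p ^ i)%N).
apply: (@leq_trans (\sum_(c <- cl) (L %/ p ^ i + 1))).
  apply: leq_sum => c _; apply: leq_trans (count_residue c L pi0).
  by rewrite /s count_filter; apply: sub_count => a /= /andP[].
by rewrite big_const_seq count_predT iter_addn addn0 mulnC leq_mul2r cl_le orbT.
Qed.

End OneVariable.

(** * Chebyshev's upper bound *)

Lemma prime_dvd_fact p n : prime p -> (p %| n`!)%N = (p <= n)%N.
Proof.
move=> pp; apply/idP/idP => [|pn]; last by rewrite dvdn_fact // prime_gt0.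
elim: n => [|n IH]; first by rewrite dvdn1 => /eqP p1; rewrite p1 in pp.
rewrite factS Euclid_dvdM // => /orP[/dvdn_leq -> //|/IH/leqW //].
Qed.

Lemma bin_le_exp n k : ('C(n, k) <= 2 ^ n)%N.
Proof.
have [kn|nk] := leqP k n; last by rewrite bin_small.
rewrite -[2%N]/(1 + 1)%N expnDn.
have kn' : (k < n.+1)%N by [].
by rewrite (bigD1 (Ordinal kn')) //= !exp1n !muln1 leq_addr.
Qed.

Section Log.
Variables (RR : realFieldType) (lg : nat -> RR).
Hypothesis lgM : forall m n, (0 < m)%N -> (0 < n)%N -> lg (m * n)%N = lg m + lg n.
Hypothesis lg_le : forall m n, (0 < m <= n)%N -> lg m <= lg n.
Hypothesis lg2 : lg 2 = 1.

Lemma lg1 : lg 1 = 0.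
Proof. by have := @lgM 1 1 isT isT; rewrite muln1; lra. Qed.

Lemma lg_ge0 n : (0 < n)%N -> 0 <= lg n.
Proof. by move=> n0; rewrite -lg1 lg_le. Qed.

Lemma lgX m k : (0 < m)%N -> lg (m ^ k)%N = k%:R * lg m.
Proof.
move=> m0; elim: k => [|k IH]; first by rewrite expn0 lg1 mul0r.
by rewrite expnS lgM ?expn_gt0 ?m0 // IH -natr1 mulrDl mul1r addrC.
Qed.

Lemma lg_exp2 k : lg (2 ^ k)%N = k%:R.
Proof. by rewrite lgX // lg2 mulr1. Qed.

Lemma lg_prod (I : Type) (r : seq I) (P : pred I) (F : I -> nat) :
  (forall i, P i -> 0 < F i)%N ->
  lg (\prod_(i <- r | P i) F i)%N = \sum_(i <- r | P i) lg (F i).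
Proof.
move=> F0; suff [] : (0 < \prod_(i <- r | P i) F i)%N /\
    lg (\prod_(i <- r | P i) F i)%N = \sum_(i <- r | P i) lg (F i) by [].
elim/big_rec2: _ => [|i x y Pi [y0 IH]]; first by rewrite lg1.
by rewrite muln_gt0 y0 F0 // lgM ?F0 // IH.
Qed.

(** The range is an arbitrary bound [P > n], which lets the factorizations of
    several integers be summed over the same primes. *)
Lemma lg_sum_primes n P : (0 < n < P)%N ->
  lg n = \sum_(0 <= p < P | prime p) (logn p n)%:R * lg p.
Proof.
case: P => [|P]; first by rewrite andbF.
move=> /andP[n0 nP]; rewrite -{1}(partnT n0) (@widen_partn P) // lg_prod.
  rewrite big_mkcond [RHS]big_mkcond; apply: eq_bigr => p _ /=.
  case: ifP => pp; first by rewrite lgX // prime_gt0.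
  by rewrite lognE pp expn0 lg1.
move=> p _; case: (boolP (prime p)) => pp; first by rewrite expn_gt0 prime_gt0.
by rewrite lognE (negPf pp).
Qed.

Definition log_primes (m n : nat) : RR := \sum_(m <= p < n | prime p) lg p.

Lemma theta_ge0 m n : 0 <= log_primes m n.
Proof. by apply: sumr_ge0 => p pp; apply/lg_ge0/prime_gt0. Qed.

(** The primes between [m] and [2 m] divide the central binomial coefficient, which is
    at most [2 ^ (2 m)]. *)
Lemma theta_double m : log_primes m.+1 (2 * m).+1 <= (2 * m)%:R.
Proof.
have [->|m0] := posnP m; first by rewrite /log_primes big_geq.
set c := 'C(2 * m, m).
have mm : (m <= 2 * m)%N by lia.
have c0 : (0 < c)%N by rewrite bin_gt0.
have dv p : prime p -> (m < p <= 2 * m)%N -> (0 < logn p c)%N.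
  move=> pp /andP[mp pm]; rewrite -(pfactor_dvdn 1 pp c0) expn1.
  have := prime_dvd_fact (2 * m) pp; rewrite pm -(bin_fact mm) -/c.
  rewrite !Euclid_dvdM // !prime_dvd_fact //; have -> : (2 * m - m = m)%N by lia.
  by rewrite leqNgt mp /= !orbF.
apply: (@le_trans _ _ (lg c)); last first.
  by rewrite -lg_exp2 lg_le // c0 bin_le_exp.
rewrite (@lg_sum_primes c (maxn c (2 * m)).+1) ?c0 ?ltnS ?leq_maxl //.
rewrite (big_cat_nat (n := (2 * m).+1)) ?ltnS ?leq_maxr //=.
rewrite (big_cat_nat (n := m.+1)) //= -addrA addrC -addrA.
rewrite ler_wpDr //.
  by apply: addr_ge0; apply: sumr_ge0 => p pp; apply: mulr_ge0; rewrite ?ler0n ?lg_ge0 ?prime_gt0.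
rewrite /log_primes big_seq_cond [leRHS]big_seq_cond; apply: ler_sum => p.
rewrite mem_index_iota ltnS => /andP[mp pp]; rewrite ler_peMl ?lg_ge0 ?prime_gt0 //.
by rewrite ler1n dv.
Qed.

Lemma theta_cat m n k : (m <= n <= k)%N -> log_primes m k = log_primes m n + log_primes n k.
Proof. by move=> /andP[mn nk]; rewrite /log_primes (big_cat_nat (n := n)). Qed.

Lemma theta_le m n m' n' : (m' <= m)%N -> (n <= n')%N -> log_primes m n <= log_primes m' n'.
Proof.
move=> mm nn; have [nm|mn] := leqP n m; first by rewrite {1}/log_primes big_geq // theta_ge0.
rewrite (@theta_cat m' m n') ?mm ?(leq_trans (ltnW mn)) // ler_wpDl ?theta_ge0 //.
by rewrite (@theta_cat m n n') ?nn ?(ltnW mn) // ler_wpDr ?theta_ge0.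
Qed.

Lemma theta_exp2 k : log_primes 0 (2 ^ k).+1 <= 2 * (2 ^ k)%:R.
Proof.
elim: k => [|k IH].
  rewrite expn0 /log_primes big_seq_cond big1 => [|[|[|p]]]; rewrite ?andbF ?mem_index_iota //.
  by apply: mulr_ge0; exact: ler0n.
rewrite (@theta_cat 0 (2 ^ k).+1); last by rewrite leq0n ltnS leq_exp2l ?leqnSn.
have := theta_double (2 ^ k); rewrite -expnS => H.
have -> : ((2 ^ k.+1)%:R : RR) = 2 * (2 ^ k)%:R by rewrite expnS natrM.
by move: H; rewrite expnS natrM; lra.
Qed.

(** In each dyadic block, [1 / p ^ 2] is compared with its largest value and the sum
    of [lg p] with Chebyshev's bound. *)
Lemma sum_lg_div_sqr k : \sum_(0 <= p < 2 ^ k | prime p) lg p / (p ^ 2)%:R <= 8.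
Proof.
suff : \sum_(0 <= p < 2 ^ k | prime p) lg p / (p ^ 2)%:R <= 8 - 8 / (2 ^ k)%:R.
  have k0 : (0 : RR) <= 8 / (2 ^ k)%:R by rewrite divr_ge0 ?ler0n.
  by move=> le8; apply: le_trans le8 _; rewrite gerBl.
elim: k => [|k IH].
  by rewrite expn0 big_mkcond big_nat1 /= divr1 subrr.
rewrite (big_cat_nat (n := (2 ^ k)%N)) ?leq_exp2l //=.
have b0 : (0 : RR) < (2 ^ k)%:R by rewrite ltr0n expn_gt0.
have blk : \sum_(2 ^ k <= p < 2 ^ k.+1 | prime p) lg p / (p ^ 2)%:R <= 4 / (2 ^ k)%:R.
  apply: (@le_trans _ _ (log_primes 0 (2 ^ k.+1).+1 / (2 ^ k)%:R ^+ 2)).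
    apply: (@le_trans _ _ (log_primes (2 ^ k) (2 ^ k.+1) / (2 ^ k)%:R ^+ 2)).
      rewrite /log_primes big_distrl /= big_seq_cond [leRHS]big_seq_cond; apply: ler_sum => p.
      rewrite mem_index_iota => /andP[/andP[kp _] pp].
      rewrite ler_wpM2l ?lg_ge0 ?prime_gt0 // lef_pV2 ?posrE ?exprn_gt0 ?ltr0n ?expn_gt0 ?prime_gt0 //.
      by rewrite -natrX ler_nat leq_exp2r.
    by rewrite ler_wpM2r ?invr_ge0 ?exprn_ge0 ?ler0n // theta_le.
  have := theta_exp2 k.+1; rewrite [X in _ <= 2 * X%:R]expnS natrM => H.
  by rewrite ler_pdivrMr ?exprn_gt0 // expr2 mulrA divfK ?gt_eqF //; lra.
have -> : (8 : RR) / (2 ^ k.+1)%:R = 4 / (2 ^ k)%:R.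
  rewrite expnS natrM; field; lra.
have E : (8 : RR) / (2 ^ k)%:R = 4 / (2 ^ k)%:R + 4 / (2 ^ k)%:R by field; lra.
rewrite E in IH.
by lra.
Qed.

End Log.

(** * The factorization of the norms in a box *)

Section Pointwise.
Variables (d : nat) (h : {poly int}).
Hypotheses (hmon : h \is monic) (hsz : size h = d.+2).
Hypothesis nrm_row : forall a : 'rV[int]_d.+1, a != 0 -> nrm d h (rVpoly a) != 0.

Local Notation D := d.+1.

Definition box_nrm L (x : box d L) : nat := `|nrm d h (rVpoly (box_row x))|%N.

Lemma box_nrm_gt0 L (x : box d L) : box_row x != 0 -> (0 < box_nrm x)%N.
Proof. by move=> /nrm_row; rewrite -absz_gt0. Qed.

Lemma closure_Fp p : prime p -> exists (Om : closedFieldType) (phi : {rmorphism 'F_p -> Om}), True.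
Proof. by move=> pp; have [K [f _]] := countable_algebraic_closure 'F_p; exists K, f. Qed.

Definition roots p : {set 'F_p} := [set r | (map_poly intr h).[r] == 0].

Lemma card_roots p : prime p -> (#|roots p| <= D)%N.
Proof.
move=> pp; rewrite -ltnS -hsz -(size_map_poly_id0 (f := intr : int -> 'F_p) (p := h)); last first.
  by rewrite (monicP hmon) rmorph1 oner_eq0.
rewrite cardE; apply: max_poly_roots; rewrite ?enum_uniq //.
  by rewrite monic_neq0 // monic_map.
by apply/allP => r; rewrite mem_enum inE.
Qed.

Definition zeros_at p (a : 'rV[int]_D) := [set r in roots p | vev r a == 0].

Lemma dvd_zeros p a : prime p -> (p ^ #|zeros_at p a| %| `|nrm d h (rVpoly a)|)%N.
Proof.
move=> pp; rewrite cardE.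
apply: (dvd_nrm_roots hmon hsz (idfun : {rmorphism 'F_p -> 'F_p}) pp (enum_uniq _)).
by move=> r; rewrite mem_enum !inE -vevE => /andP[/eqP ? /eqP].
Qed.

(** If [p] divides the norm exactly once, the element vanishes at a single root of
    [h] in an algebraic closure, and this root is then in the prime field. *)
Lemma zero_of_simple_divisor p a : prime p -> ~~ (p %| disc d h)%Z ->
  (p %| `|nrm d h (rVpoly a)|)%N -> ~~ (p ^ 2 %| `|nrm d h (rVpoly a)|)%N ->
  (0 < #|zeros_at p a|)%N.
Proof.
move=> pp pdisc pN p2N; have [Om [phi _]] := closure_Fp pp.
have charOm : p \in [pchar Om] by rewrite (fmorph_pchar phi) pchar_Fp.
have [z [zinj hE hz]] := roots_mod hmon hsz charOm pdisc.
have : (nrm d h (rVpoly a))%:~R == 0 :> Om by rewrite (intr_eq0_mod charOm) dvdzE.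
rewrite (nrm_mod hmon hsz zinj hz) => /prodf_eq0 [i0 _ /eqP u0].
have uniq0 i : (map_poly intr (rVpoly a)).[z i] = 0 -> i = i0.
  move=> ui; apply/eqP; apply: contraT => ni; case/negP: p2N.
  apply: (dvd_nrm_roots hmon hsz phi (s := [:: z i; z i0])) => //=.
    by rewrite inE andbT; apply: contra ni => /eqP/zinj ->.
  by move=> r; rewrite !inE => /orP[] /eqP ->.
have [r rz] := single_zero_Fp phi pp hz hE u0 uniq0.
have rE : phi (r%:~R) = z i0 by rewrite rmorph_int.
rewrite card_gt0; apply/set0Pn; exists r%:~R; rewrite !inE vevE.
rewrite -!(fmorph_eq0 phi) -!horner_rmorph rE u0 eqxx andbT.
by rewrite -[_.[_]]/(_.[_]) hz.
Qed.

(** The main term counts the roots of [h] in the prime field at which [a] vanishes.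
    The others bound the multiplicity when [p] divides the discriminant, when [p ^ 2]
    divides the norm, and when a high power of [p] divides it; the last is measured
    in steps of [D] because that is what [count_prime_power] controls. *)
Lemma logn_pointwise p (a : 'rV[int]_D) Q : prime p -> nrm d h (rVpoly a) != 0 ->
  let N := `|nrm d h (rVpoly a)|%N in
  (logn p N < Q)%N ->
  (logn p N <= ~~ (p %| disc d h)%Z * #|zeros_at p a|
     + 2 * D * ((p %| disc d h)%Z || (p ^ 2 %| N))
     + D * \sum_(2 <= q < Q) (p ^ (D * q).+1 %| N))%N.
Proof.
move=> pp nz N vQ; have N0 : (0 < N)%N by rewrite absz_gt0.
have tail : (logn p N <= 2 * D + D * \sum_(2 <= q < Q) (p ^ (D * q).+1 %| N))%N.
  have [//|lt] := leqP (logn p N) (2 * D); first by move=> ?; apply: leq_trans (leq_addr _ _).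
  set v := logn p N in vQ lt *; pose q1 := ((v.-1 %/ D).+1)%N.
  have q1E : (v <= D * q1)%N by rewrite /q1; have := divn_eq v.-1 D; have := ltn_pmod v.-1 (ltn0Sn d); lia.
  have q1lt : (D * q1.-1 < v)%N by rewrite /q1 /= mulnC; have := leq_trunc_div v.-1 D; lia.
  have q12 : (2 < q1)%N by rewrite /q1 ltnS leq_divRL // ; lia.
  have q1Q : (q1 <= Q)%N.
    by apply: leq_trans vQ; rewrite /q1 ltnS; apply: leq_trans (leq_div _ _) (leq_pred _).
  apply: leq_trans q1E _; rewrite [X in (X + _)%N]mulnC -mulnDr leq_mul2l; apply/orP; right.
  rewrite (big_cat_nat (n := q1)) ?(ltnW q12) //= addnA; apply: leq_trans _ (leq_addr _ _).
  rewrite big_nat_cond (eq_bigr (fun=> 1%N)) => [|q]; last first.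
    rewrite andbT => /andP[_ qq1]; rewrite pfactor_dvdn //; suff -> : ((D * q).+1 <= v)%N by [].
    by apply: leq_ltn_trans q1lt; rewrite leq_mul2l; lia.
  by rewrite -big_nat_cond sum_nat_const_nat muln1; lia.
have [pd|pd] := boolP (p %| disc d h)%Z; rewrite /= ?muln1 ?mul0n ?mul1n ?add0n //.
have [p2|p2] := boolP (p ^ 2 %| N)%N; rewrite /= ?muln1.
  by rewrite -addnA; apply: leq_trans tail (leq_addl _ _).
rewrite muln0 addn0; apply: leq_trans _ (leq_addr _ _).
have : (logn p N < 2)%N by rewrite ltnNge -pfactor_dvdn.
case E : (logn p N) => [|[|//]] // _; apply: zero_of_simple_divisor => //.
by rewrite -[p]expn1 pfactor_dvdn // E.
Qed.

Lemma fiber_count L (A : {set box d L}) c :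
  (forall x0 : box d L, #|[set x in A | [forall i : 'I_d, x (lift ord0 i) == x0 (lift ord0 i)]]| <= c)%N ->
  (#|A| <= c * L ^ d)%N.
Proof.
move=> hc; pose f (x : box d L) : {ffun 'I_d -> 'I_L} := [ffun i => x (lift ord0 i)].
rewrite -sum1_card (partition_big f xpredT) //=.
have -> : (c * L ^ d = \sum_(b : {ffun 'I_d -> 'I_L}) c)%N.
  by rewrite sum_nat_const card_ffun !card_ord mulnC.
apply: leq_sum => b _; rewrite sum1_card.
have [x0 /andP[x0A /eqP fx0]|none] := pickP [pred x | (x \in A) && (f x == b)]; last first.
  by rewrite (eq_card (B := pred0)) ?card0.
apply: leq_trans (hc x0); apply/subset_leq_card/subsetP => x.
rewrite !inE => /andP[-> /eqP fx] /=; apply/forallP => i.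
by have := congr1 (fun g : {ffun _ -> _} => g i) (etrans fx (esym fx0)); rewrite !ffunE => ->.
Qed.

(** When all coordinates but the first are fixed, the norm is a monic polynomial
    of degree [D] in the first one, namely a characteristic polynomial. *)
Lemma box_count (cond : pred nat) c L :
  (forall g : {poly int}, g \is monic -> size g = D.+1 ->
     (count (fun a : nat => cond `|g.[a%:Z]|%N) (iota 0 L) <= c)%N) ->
  (#|[set x : box d L | cond (box_nrm x)]| <= c * L ^ d)%N.
Proof.
move=> hc; apply: fiber_count => x0; set A := [set x in _ | _].
pose M := mult_mx d h (rVpoly (box_row x0 - (x0 ord0 : nat)%:Z *: delta_mx 0 0)).
pose g := char_poly (- M).
have gE x : x \in A -> `|g.[(x ord0 : nat)%:Z]|%N = box_nrm x.
  rewrite !inE => /andP[_ /forallP xx0]; rewrite /g char_poly_horner opprK /box_nrm /nrm.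
  congr (absz (\det _)).
  have -> : box_row x = (x ord0 : nat)%:Z *: delta_mx 0 0 + (box_row x0 - (x0 ord0 : nat)%:Z *: delta_mx 0 0).
    apply/rowP => i; rewrite !mxE; case: (unliftP ord0 i) => [j ->|->].
      by rewrite (eqP (xx0 j)) /= !mulr0 subr0 add0r.
    by rewrite eqxx !mulr1 subrr addr0.
  rewrite linearD /= /mult_mx rmorphD /=; congr (_ + _).
  by rewrite linearZ /= rVpoly_delta expr0 linearZ /= rmorph1 scalemx1.
have gm : g \is monic by exact: char_poly_monic.
have gs : size g = D.+1 by exact: size_char_poly.
apply: leq_trans (hc g gm gs); rewrite -size_filter cardE -(size_map (fun x : box d L => (x ord0 : nat))).
apply: uniq_leq_size.
  rewrite map_inj_in_uniq ?enum_uniq // => x y; rewrite !mem_enum !inE.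
  move=> /andP[_ /forallP ex] /andP[_ /forallP ey] exy; apply/ffunP => i.
  case: (unliftP ord0 i) => [j ->|->]; last exact: val_inj.
  by rewrite (eqP (ex j)) (eqP (ey j)).
move=> y /mapP[x + ->]; rewrite mem_enum => xA; rewrite mem_filter mem_iota add0n ltn_ord andbT.
by rewrite (gE _ xA) andbT; move: xA; rewrite !inE => /andP[].
Qed.

Lemma box_count_small w L : (0 < w)%N ->
  (#|[set x : box d L | D.+1 * box_nrm x < w ^ D]| <= D * w * L ^ d)%N.
Proof.
by move=> w0; apply: (@box_count (fun N => D.+1 * N < w ^ D)%N) => g gm gs; exact: count_small_values.
Qed.

Lemma box_count_prime_power p q L : prime p ->
  (#|[set x : box d L | p ^ (D * q).+1 %| box_nrm x]| <= D * (L %/ p ^ q.+1 + 1) * L ^ d)%N.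
Proof.
move=> pp; apply: (@box_count (fun N => p ^ (D * q).+1 %| N)%N) => g gm gs.
exact: count_prime_power.
Qed.

End Pointwise.

(** * A small prime at which a given element does not vanish *)

Lemma expn_sub_le x y n : (y <= x)%N -> (x ^ n.+1 <= y ^ n.+1 + n.+1 * (x - y) * x ^ n)%N.
Proof.
move=> yx; elim: n => [|n IH]; first by rewrite !expn1 expn0 mul1n muln1; lia.
have yn : (y ^ n.+1 <= x ^ n.+1)%N by rewrite leq_exp2r.
have -> : (x ^ n.+2 = (x - y) * x ^ n.+1 + y * x ^ n.+1)%N by rewrite -mulnDl subnK.
have -> : (n.+2 * (x - y) * x ^ n.+1 = (x - y) * x ^ n.+1 + n.+1 * (x - y) * x ^ n.+1)%N by lia.
have H : (y * x ^ n.+1 <= y * (y ^ n.+1 + n.+1 * (x - y) * x ^ n))%N by rewrite leq_mul2l IH orbT.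
have H2 : (y * (n.+1 * (x - y) * x ^ n) <= n.+1 * (x - y) * x ^ n.+1)%N.
  by rewrite mulnCA leq_mul2l expnS leq_mul2r yx !orbT.
rewrite mulnDr -expnS in H; lia.
Qed.

Lemma le_half_exp l : (l.+1 <= 2 * 2 ^ (l %/ 2))%N.
Proof.
have := divn_eq l 2; have := ltn_pmod l (isT : (0 < 2)%N); have := ltn_expl (l %/ 2) (isT : (1 < 2)%N).
lia.
Qed.

Lemma sum_divn_pow p n x : (1 < p)%N -> (\sum_(1 <= q < n.+1) x %/ p ^ q <= x)%N.
Proof.
move=> p1; elim: n x => [|n IH] x; first by rewrite big_geq.
rewrite big_nat_recl //= expn1.
apply: (@leq_trans (x %/ p + x %/ p)).
  rewrite leq_add2l; apply: leq_trans (IH (x %/ p)%N).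
  by apply: leq_sum => q _; rewrite expnS divnMA.
rewrite addnn -mul2n; apply: leq_trans (leq_trunc_div x p).
by rewrite mulnC leq_mul2l p1 orbT.
Qed.

Lemma sub_shift_le t t' w : (w <= t)%N -> (t' + 2 * w - (t' - 2 * t) <= 4 * t)%N.
Proof. lia. Qed.

Section GoodPrimes.
Variables (d : nat) (h : {poly int}).
Hypotheses (hmon : h \is monic) (hsz : size h = d.+2).
Hypothesis nrm_row : forall a : 'rV[int]_d.+1, a != 0 -> nrm d h (rVpoly a) != 0.
Hypothesis disc0 : disc d h != 0.
Variables (RR : realFieldType) (lg : nat -> RR).
Hypothesis lgM : forall m n, (0 < m)%N -> (0 < n)%N -> lg (m * n)%N = lg m + lg n.
Hypothesis lg_le : forall m n, (0 < m <= n)%N -> lg m <= lg n.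
Hypothesis lg2 : lg 2 = 1.

Local Notation D := d.+1.
Local Notation cs := (comp_size d h).
Local Notation theta := (log_primes lg).
Local Notation bnrm := (box_nrm h).

Let lg0 n : (0 < n)%N -> 0 <= lg n. Proof. exact: lg_ge0. Qed.
Let lgp0 p : prime p -> 0 <= lg p. Proof. by move=> /prime_gt0; exact: lg0. Qed.

Lemma lg_le_nat n : (0 < n)%N -> lg n <= n%:R.
Proof.
by move=> n0; rewrite -(lg_exp2 lgM lg2) lg_le // n0 ltnW // ltn_expl.
Qed.

Definition cN := nrm_const d h.
Definition nrm_exp l := (cN + D * l)%N.

Lemma bnrm_le l (x : box d (2 ^ l)) : (bnrm x <= 2 ^ nrm_exp l)%N.
Proof.
apply: leq_trans (@nrm_le d h _ _ (box_row_abs x)) _.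
by rewrite /nrm_exp expnD [(D * l)%N]mulnC expnM leq_mul2r ltnW ?orbT // ltn_expl.
Qed.

(** The quantity that is estimated in two ways: through the size of the norms and
    through their prime factors. *)
Definition log_norm_sum l : RR := \sum_(x : box d (2 ^ l) | box_row x != 0) lg (bnrm x).

(** For an unramified [p], the exponent of [p] in the product of the norms over the
    box, up to the error terms of [log_norm_sum_le_primes]. *)
Definition zero_count p l : nat := \sum_(x : box d (2 ^ l) | box_row x != 0%R) #|zeros_at h p (box_row x)|.

Lemma zero_countE p l : zero_count p l = \sum_(r in roots h p) root_count d r (2 ^ l).
Proof.
rewrite /zero_count /root_count (eq_bigr (fun x => \sum_(r in roots h p) (vev r (box_row x) == 0%R : nat))); last first.
  by move=> x _; rewrite -sum1_card big_mkcond [RHS]big_mkcond; apply: eq_bigr => r _; rewrite !inE; case: eqP => //= _; case: (_ == _).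
rewrite exchange_big; apply: eq_bigr => r _ /=.
rewrite -sum1_card big_mkcond [RHS]big_mkcond; apply: eq_bigr => x _; rewrite inE.
by case: (box_row x != 0%R); rewrite ?andbF ?andbT //; case: eqP.
Qed.

Lemma log_norm_sum_upper l : log_norm_sum l <= (2 ^ (D * l))%:R * (nrm_exp l)%:R.
Proof.
apply: (@le_trans _ _ (\sum_(x : box d (2 ^ l)) (nrm_exp l)%:R)); last first.
  by rewrite sumr_const card_box -expnM mulnC -[leLHS]mulr_natl.
rewrite [leRHS](bigID (fun x : box d (2 ^ l) => box_row x != 0)) /=.
rewrite ler_wpDr ?sumr_ge0 // /log_norm_sum; apply: ler_sum => x nx.
by rewrite -(lg_exp2 lgM lg2) lg_le // bnrm_le box_nrm_gt0.
Qed.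

Definition C_lower := (D + D.+1 + 2 * D * D)%N.

(** The norm is less than the largest possible value by a factor [2 ^ (D j)] only
    for a proportion [O(2 ^ - j)] of the box, by [box_count_small]. *)
Lemma log_norm_sum_lower l : (2 ^ (D * l))%:R * ((D * l)%:R - C_lower%:R) <= log_norm_sum l.
Proof.
(* Count the [i] for which the norm is small rather than compute the logarithm: it
   is at least [D] times the largest [i] for which the norm is not small. *)
pose small (x : box d (2 ^ l)) i := (D.+1 * bnrm x < (2 ^ i) ^ D)%N.
have pw (x : box d (2 ^ l)) : box_row x != 0 ->
    (D * l)%:R - (D * \sum_(1 <= i < l.+1) small x i)%:R - D.+1%:R <= lg (bnrm x).
  move=> nx; have N0 : (0 < bnrm x)%N by rewrite box_nrm_gt0.
  have ex0 : exists i, (i <= l)%N && ~~ small x i.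
    by exists 0%N; rewrite /small exp1n -leqNgt muln_gt0.
  have [t /andP[power_count tn] tmax] := ex_maxnP ex0 (fun i H => proj1 (andP H)).
  have cnt : (l - t <= \sum_(1 <= i < l.+1) small x i)%N.
    rewrite (big_cat_nat (n := t.+1)) //=; apply: leq_trans (leq_addl _ _).
    rewrite big_nat_cond (eq_bigr (fun=> 1%N)) => [|i]; last first.
      rewrite andbT => /andP[ti il]; case: (boolP (small x i)) => // ns.
      by have := tmax i; rewrite -ltnS il ns => /(_ isT); rewrite leqNgt ti.
    by rewrite -big_nat_cond sum_nat_const_nat muln1 subSS.
  have lt : (D * t)%:R <= D.+1%:R + lg (bnrm x).
    have : lg (2 ^ (D * t))%N <= lg (D.+1 * bnrm x)%N.
      by rewrite lg_le // expn_gt0 /= mulnC expnM leqNgt.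
    rewrite (lg_exp2 lgM lg2) lgM // => /le_trans; apply; rewrite lerD2r.
    exact: lg_le_nat.
  have : ((D * l)%:R : RR) <= (D * t)%:R + (D * \sum_(1 <= i < l.+1) small x i)%:R.
    by rewrite -natrD ler_nat -mulnDr leq_mul2l; lia.
  by lra.
set M := (2 ^ (D * l))%N.
have cardM : #|{: box d (2 ^ l)}| = M by rewrite card_box -expnM mulnC.
have l_M : (l <= M)%N.
  by apply: leq_trans (ltnW (ltn_expl l (isT : (1 < 2)%N))) _; rewrite leq_exp2l // leq_pmull.
pose P := [pred x : box d (2 ^ l) | box_row x != 0].
have Pge : (M <= #|P|.+1)%N.
  rewrite -cardM -(cardC P) -[leqRHS]addn1 leq_add2l.
  rewrite -[leqRHS](card1 ([ffun => Ordinal (expn_gt0 2 l)] : box d (2 ^ l))).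
  apply/subset_leq_card/subsetP => x; rewrite !inE negbK => /eqP x0.
  apply/eqP/ffunP => i; rewrite ffunE; apply/val_inj => /=.
  by have /rowP/(_ i) := x0; rewrite !mxE => -[].
have Ple : (#|P| <= M)%N by rewrite -cardM max_card.
have cntsum : (\sum_(x : box d (2 ^ l) | P x) \sum_(1 <= i < l.+1) small x i <= 2 * D * M)%N.
  rewrite exchange_big /=.
  apply: (@leq_trans (\sum_(1 <= i < l.+1) D * 2 ^ i * (2 ^ l) ^ d)).
    apply: leq_sum => i _; apply: leq_trans (@box_count_small d h (2 ^ i) (2 ^ l) _); last by rewrite expn_gt0.
    rewrite -[leqRHS]sum1_card [leqRHS]big_mkcond [leqLHS]big_mkcond; apply: leq_sum => x _.
    by rewrite inE /small; case: ifP => _; case: (_ < _)%N.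
  rewrite -big_distrl -big_distrr /=.
  have -> : (2 * D * M = D * (2 ^ l.+1) * (2 ^ l) ^ d)%N.
    have -> : (M = 2 ^ l * (2 ^ l) ^ d)%N by rewrite -expnS -expnM mulnC.
    by rewrite expnS; ring.
  rewrite leq_mul2r leq_mul2l; apply/orP; right; apply/orP; right.
  elim: (l) => [|k IH]; first by rewrite big_geq.
  by rewrite big_nat_recr //= [leqRHS]expnS mul2n -addnn leq_add2r.
apply: (@le_trans _ _ (\sum_(x | P x) ((D * l)%:R - (D * \sum_(1 <= i < l.+1) small x i)%:R - D.+1%:R))); last first.
  by apply: ler_sum => x; apply: pw.
have -> : \sum_(x | P x) ((D * l)%:R - (D * \sum_(1 <= i < l.+1) small x i)%:R - D.+1%:R) =
    (D * l)%:R * #|P|%:R - (D * \sum_(x | P x) \sum_(1 <= i < l.+1) small x i)%:R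
      - D.+1%:R * #|P|%:R :> RR.
  by rewrite !sumrB !sumr_const -natr_sum -big_distrr /= !mulr_natr.
have H1 : ((D * \sum_(x | P x) \sum_(1 <= i < l.+1) small x i)%:R : RR) <= (D * (2 * D * M))%:R.
  by rewrite ler_nat leq_mul2l cntsum orbT.
have H2 : ((D * l * M)%:R : RR) <= (D * l * #|P| + D * M)%:R.
  rewrite ler_nat; apply: (@leq_trans (D * l * #|P| + D * l)); first by rewrite -mulnSr leq_mul2l Pge orbT.
  by rewrite leq_add2l leq_mul2l l_M orbT.
have H3 : ((D.+1 * #|P|)%:R : RR) <= (D.+1 * M)%:R by rewrite ler_nat leq_mul2l Ple orbT.
move: H1 H2 H3; rewrite /C_lower !natrM !natrD !natrM; set m := M%:R; set q := #|_|%:R.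
set X := (\sum_(_ | _) _)%:R => H1 H2 H3; lra.
Qed.

Definition ramified (p : nat) := (p %| disc d h)%Z.

Lemma sum_le_theta P n (c : pred nat) : (forall p, prime p -> c p -> p <= n)%N ->
  \sum_(0 <= p < P | prime p && c p) lg p <= theta 0 n.+1.
Proof.
move=> cn; apply: (@le_trans _ _ (\sum_(0 <= p < maxn P n.+1 | prime p && c p) lg p)).
  rewrite [leRHS](big_cat_nat (n := P)) ?leq_maxl //= ler_wpDr // sumr_ge0 // => p /andP[pp _].
  exact: lgp0.
rewrite [leLHS](big_cat_nat (n := n.+1)) ?leq_maxr //= [X in _ + X]big_nat_cond.
rewrite [X in _ + X]big1 => [|p /andP[/andP[np _] /andP[pp cp]]]; last first.
  by move: (cn p pp cp); rewrite leqNgt np.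
rewrite addr0 /log_primes big_mkcond [leRHS]big_mkcond /=; apply: ler_sum => p _.
by case: (boolP (prime p)) => //= pp; case: ifP => // _; exact: lgp0.
Qed.

(** The distinct roots at which [x] vanishes are as many factors [p] of its norm. *)
Lemma log_norm_sum_ge_primes Y l :
  \sum_(0 <= p < Y | prime p && ~~ ramified p) lg p * (zero_count p l)%:R <= log_norm_sum l.
Proof.
rewrite /log_norm_sum /zero_count (eq_bigr (fun p => \sum_(x : box d (2 ^ l) | box_row x != 0) lg p * #|zeros_at h p (box_row x)|%:R)); last first.
  by move=> p _; rewrite natr_sum big_distrr.
rewrite exchange_big /=; apply: ler_sum => x nx.
have N0 : (0 < bnrm x)%N by apply: box_nrm_gt0.
rewrite (@lg_sum_primes _ _ lgM (bnrm x) (maxn Y (bnrm x).+1)) ?N0 ?leq_maxr //.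
rewrite [leRHS](big_cat_nat (n := Y)) ?leq_maxl //= ler_wpDr //.
  by apply: sumr_ge0 => p pp; rewrite mulr_ge0 ?lgp0.
rewrite big_mkcond [leRHS]big_mkcond /=; apply: ler_sum => p _.
case: (boolP (prime p)) => //= pp; case: ifP => _; last by rewrite mulr_ge0 ?lgp0.
rewrite mulrC ler_wpM2r ?lgp0 // ler_nat -pfactor_dvdn //.
exact: dvd_zeros.
Qed.

Definition square_count p l := (\sum_(x : box d (2 ^ l) | box_row x != 0%R) (ramified p || (p ^ 2 %| bnrm x)))%N.
Definition power_count p l Q := (\sum_(x : box d (2 ^ l) | box_row x != 0%R)
  \sum_(2 <= q < Q) (p ^ (D * q).+1 %| bnrm x))%N.
Definition C_square := ((D * D + D) * (1 + 2 * cs) ^ D)%N.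

Lemma square_count_ramified p l : (square_count p l <= 2 ^ (D * l))%N.
Proof.
have -> : (2 ^ (D * l) = \sum_(x : box d (2 ^ l)) 1)%N by rewrite sum1_card card_box -expnM mulnC.
rewrite /square_count big_mkcond; apply: leq_sum => x _.
by case: ifP => // _; case: (_ || _).
Qed.

Lemma square_count_unramified p l : prime p -> ~~ ramified p -> (square_count p l * p ^ 2 <= C_square * 2 ^ (D * l))%N.
Proof.
move=> pp gp; have [Om [phi _]] := closure_Fp pp.
have charOm : p \in [pchar Om] by rewrite (fmorph_pchar phi) pchar_Fp.
have [z [zinj hE hz]] := roots_mod hmon hsz charOm gp.
have := count_square hmon hsz phi pp gp zinj hz hE nrm_row (2 ^ l).
have -> : (C_square * 2 ^ (D * l) = (D * D + D) * (2 ^ l + 2 * (2 ^ l * cs)) ^ D)%N.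
  by rewrite /C_square [(D * l)%N]mulnC expnM -mulnA -expnMn; congr (_ * _ ^ _)%N; ring.
apply: leq_trans; rewrite leq_mul2r; apply/orP; right.
rewrite -[leqRHS]sum1_card [leqRHS]big_mkcond /square_count [leqLHS]big_mkcond; apply: leq_sum => x _.
by rewrite inE (negPf gp) /= dvdzE; case: (box_row x != 0%R) => //=; case: (_ %| _)%N.
Qed.

(** If [p > 2 ^ tail_exp l], no norm in the box is divisible by [p ^ (2 D + 1)]. *)
Definition tail_exp l := ((nrm_exp l) %/ (2 * D).+1).+1.

(** The first term is summable over the primes; the second is present only for the
    primes up to about [2 ^ (l / 2)] and comes from the rounding in
    [box_count_prime_power]. *)
Lemma power_count_le p l Q : prime p ->
  (power_count p l Q <= D * ((2 ^ l) %/ p ^ 2) * (2 ^ l) ^ d + (p <= 2 ^ tail_exp l) * (D * (2 ^ l) ^ d * Q))%N.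
Proof.
move=> pp; rewrite /power_count exchange_big /=.
have tail q : (2 <= q)%N -> (\sum_(x : box d (2 ^ l) | box_row x != 0%R) (p ^ (D * q).+1 %| bnrm x)
    <= D * (2 ^ l %/ p ^ q.+1 + (p <= 2 ^ tail_exp l)) * (2 ^ l) ^ d)%N.
  move=> q2; have [pk|pk] := leqP p (2 ^ tail_exp l).
    apply: leq_trans (@box_count_prime_power d h p q (2 ^ l) pp).
    rewrite -[leqRHS]sum1_card [leqRHS]big_mkcond [leqLHS]big_mkcond; apply: leq_sum => x _.
    by rewrite inE; case: ifP => _; case: (_ %| _)%N.
  rewrite big1 // => x nx; apply/eqP; rewrite eqb0; apply: contraL pk => dv.
  rewrite -leqNgt leqNgt; apply/negP => pk.
  have : (p ^ (D * q).+1 <= 2 ^ nrm_exp l)%N.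
    by apply: leq_trans (dvdn_leq _ dv) (bnrm_le _); exact: box_nrm_gt0.
  rewrite leqNgt => /negP[]; apply: (@leq_trans ((2 ^ tail_exp l).+1 ^ (2 * D).+1)); last first.
    apply: (@leq_trans (p ^ (2 * D).+1)); first by rewrite leq_exp2r.
    by rewrite leq_exp2l ?prime_gt1 // ltnS mulnC leq_mul2l q2 orbT.
  apply: (@leq_trans ((2 ^ tail_exp l).+1 * (2 ^ tail_exp l) ^ (2 * D))); last first.
    by rewrite expnS leq_mul2l leq_exp2r ?leqnSn ?orbT.
  rewrite mulSn -add1n; apply: leq_add; first by rewrite !expn_gt0.
  rewrite -expnS -expnM.
  rewrite leq_exp2l // /tail_exp mulSn.
  have := divn_eq (nrm_exp l) (2 * D).+1; have := ltn_pmod (nrm_exp l) (ltn0Sn (2 * D)); lia.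
apply: (@leq_trans (\sum_(2 <= q < Q) D * (2 ^ l %/ p ^ q.+1 + (p <= 2 ^ tail_exp l)) * (2 ^ l) ^ d)).
  by rewrite big_nat_cond [leqRHS]big_nat_cond; apply: leq_sum => q /andP[/andP[q2 _] _]; apply: tail.
rewrite -big_distrl -big_distrr big_split /= sum_nat_const_nat mulnDr mulnDl leq_add //; last first.
  set b := nat_of_bool _; set c := (Q - 2)%N.
  have -> : (D * (c * b) * (2 ^ l) ^ d = b * (D * (2 ^ l) ^ d * c))%N by ring.
  by rewrite !leq_mul2l leq_subr !orbT.
rewrite leq_mul2r leq_mul2l; apply/orP; right; apply/orP; right.
case: Q => [|[|Q]]; [by rewrite big_geq | by rewrite big_geq |].
rewrite big_add1 /=; apply: leq_trans (sum_divn_pow Q _ (prime_gt1 pp)).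
apply: leq_sum => q _; rewrite -divnMA -expnD; apply: leq_div2l; rewrite ?expn_gt0 ?prime_gt0 //.
Qed.

Definition C_upper := (2 * D * (2 * 2 ^ `|disc d h| + 8 * C_square)
  + D * (8 * D + D * 2 * ((cN + 1 + D) * 2 ^ (cN + 2))))%N.

(** The exponent [tail_exp l] is about [l / 2], so the number [nrm_exp l] of powers to
    consider, times the bound for the primes concerned, is at most of order [2 ^ l]. *)
Lemma tail_exp_bound l : ((nrm_exp l).+1 * 2 ^ tail_exp l <= (cN + 1 + D) * 2 ^ (cN + 2) * 2 ^ l)%N.
Proof.
have kl : (tail_exp l <= cN + l %/ 2 + 1)%N.
  rewrite /tail_exp addn1 ltnS -ltnS ltn_divLR // /nrm_exp.
  have := divn_eq l 2; have := ltn_pmod l (isT : (0 < 2)%N); nia.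
have exl : ((nrm_exp l).+1 <= (cN + 1 + D) * l.+1)%N by rewrite /nrm_exp; nia.
have h2 := le_half_exp l.
have lE : (2 ^ (l %/ 2) * 2 ^ (l %/ 2) <= 2 ^ l)%N.
  by rewrite -expnD leq_exp2l // addnn -muln2 leq_trunc_div.
apply: (@leq_trans ((cN + 1 + D) * (2 * 2 ^ (l %/ 2)) * 2 ^ (cN + l %/ 2 + 1))).
  apply: leq_mul; last by rewrite leq_exp2l.
  by apply: leq_trans exl _; rewrite leq_mul2l h2 orbT.
rewrite !expnD expn1; set y := (2 ^ (l %/ 2))%N in lE *.
have idn (a e : nat) : (a * (2 * y) * (e * y * 2) = a * (e * 4) * (y * y))%N by ring.
rewrite idn.
by rewrite leq_mul2l lE orbT.
Qed.

(** Sum [logn_pointwise] over the box. The error is a bounded multiple of the number of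
    elements: for primes dividing the discriminant there are finitely many, and for
    the others the series of [lg p / p ^ 2] converges. *)
Lemma log_norm_sum_le_primes l :
  log_norm_sum l <= \sum_(0 <= p < (2 ^ nrm_exp l).+1 | prime p && ~~ ramified p) lg p * (zero_count p l)%:R
     + C_upper%:R * (2 ^ (D * l))%:R.
Proof.
set P := (2 ^ nrm_exp l).+1; set M := (2 ^ (D * l))%N; pose Q := (nrm_exp l).+1.
have pw (x : box d (2 ^ l)) : box_row x != 0 ->
  lg (bnrm x) <= \sum_(0 <= p < P | prime p) lg p *
    (~~ ramified p * #|zeros_at h p (box_row x)| + 2 * D * (ramified p || (p ^ 2 %| bnrm x)%N)
      + D * \sum_(2 <= q < Q) (p ^ (D * q).+1 %| bnrm x))%:R.
  move=> nx; have N0 : (0 < bnrm x)%N by exact: box_nrm_gt0.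
  rewrite (@lg_sum_primes _ _ lgM (bnrm x) P) ?N0 ?ltnS ?bnrm_le //.
  apply: ler_sum => p pp; rewrite mulrC ler_wpM2l ?lgp0 // ler_nat.
  apply: logn_pointwise => //; first exact: nrm_row.
  rewrite /Q ltnS -(@leq_exp2l 2) //; apply: leq_trans (@bnrm_le l x).
  apply: (@leq_trans (p ^ logn p (bnrm x))); first by case: (logn p _) => [|e]; rewrite ?expn0 // leq_exp2r ?prime_gt1.
  by rewrite dvdn_leq // pfactor_dvdnn.
apply: (@le_trans _ _ (\sum_(0 <= p < P | prime p) lg p *
    (~~ ramified p * zero_count p l + 2 * D * square_count p l + D * power_count p l Q)%:R)).
  apply: le_trans (ler_sum _ pw) _; rewrite exchange_big /=; apply: ler_sum => p pp.
  rewrite -big_distrr /= ler_wpM2l ?lgp0 // -natr_sum ler_nat.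
  by rewrite !big_split /= -!big_distrr.
have split_p : \sum_(0 <= p < P | prime p) lg p * (~~ ramified p * zero_count p l + 2 * D * square_count p l + D * power_count p l Q)%:R
  = \sum_(0 <= p < P | prime p && ~~ ramified p) lg p * (zero_count p l)%:R
    + ((2 * D)%:R * (\sum_(0 <= p < P | prime p) lg p * (square_count p l)%:R)
       + D%:R * (\sum_(0 <= p < P | prime p) lg p * (power_count p l Q)%:R)).
  have natE p : (~~ ramified p * zero_count p l + 2 * D * square_count p l + D * power_count p l Q)%:R =
      (~~ ramified p)%:R * (zero_count p l)%:R + (2 * D)%N%:R * (square_count p l)%:R + D%:R * (power_count p l Q)%:R :> RR.
    rewrite (natrD _ (~~ ramified p * zero_count p l + 2 * D * square_count p l)%N) (natrD _ (~~ ramified p * zero_count p l)%N).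
    by rewrite (natrM _ (~~ ramified p)) (natrM _ (2 * D)%N) (natrM _ D (power_count p l Q)).
  under eq_bigr do rewrite natE.
  move: (2 * D)%N%:R D%:R => a b; rewrite !big_distrr -big_split /= [in RHS]big_mkcondr -big_split /=.
  apply: eq_bigr => p _; case: (ramified p); rewrite /= ?mulr1n ?mulr0n; ring.
rewrite split_p lerD2l.
have PP : (P <= 2 ^ (nrm_exp l).+1)%N.
  by rewrite /P expnS mul2n -addnn -addn1 leq_add2l expn_gt0.
have sqr_sum : \sum_(0 <= p < P | prime p) lg p / (p ^ 2)%:R <= 8.
  apply: le_trans (sum_lg_div_sqr lgM lg_le lg2 (nrm_exp l).+1).
  rewrite [leRHS](big_cat_nat (n := P)) //= ler_wpDr // sumr_ge0 // => p pp.
  by rewrite divr_ge0 ?lgp0.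
have ME : (M = 2 ^ l * (2 ^ l) ^ d)%N by rewrite /M mulnC expnM expnS.
have M0 : (0 : RR) <= M%:R by exact: ler0n.
have sq_sum : \sum_(0 <= p < P | prime p) lg p * (square_count p l)%:R <= (2 * 2 ^ `|disc d h|%N + 8 * C_square)%:R * M%:R.
  rewrite (bigID ramified) /= natrD mulrDl; apply: lerD.
    apply: (@le_trans _ _ (theta 0 (2 ^ `|disc d h|).+1 * M%:R)).
      apply: (@le_trans _ _ ((\sum_(0 <= p < P | prime p && ramified p) lg p) * M%:R)).
        rewrite big_distrl /=; apply: ler_sum => p /andP[pp _].
        by rewrite ler_wpM2l ?lgp0 // ler_nat square_count_ramified.
      rewrite ler_wpM2r //; apply: sum_le_theta => p pp; rewrite /ramified dvdzE => /dvdn_leq.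
      rewrite absz_gt0 disc0 => /(_ isT) /leq_trans; apply; apply: ltnW; exact: ltn_expl.
    by rewrite ler_wpM2r // natrM (theta_exp2 lgM lg_le lg2).
  apply: (@le_trans _ _ (\sum_(0 <= p < P | prime p) (lg p / (p ^ 2)%:R) * (C_square%:R * M%:R))).
    rewrite big_mkcondr /=; apply: ler_sum => p pp; have p0 := prime_gt0 pp.
    case: ifP => gp; last by rewrite !mulr_ge0 ?invr_ge0 ?lgp0.
    rewrite -mulrA ler_wpM2l ?lgp0 // mulrC ler_pdivlMr ?ltr0n ?expn_gt0 ?p0 //.
    by rewrite -!natrM ler_nat square_count_unramified.
  by rewrite -big_distrl /= mulrA natrM [8%:R * _]mulrC -!mulrA [leLHS]mulrC -!mulrA ler_wpM2l // [X in _ <= X]mulrC ler_wpM2l.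
have tl_sum : \sum_(0 <= p < P | prime p) lg p * (power_count p l Q)%:R <=
    (8 * D + D * 2 * ((cN + 1 + D) * 2 ^ (cN + 2)))%:R * M%:R.
  apply: (@le_trans _ _ (\sum_(0 <= p < P | prime p) (lg p / (p ^ 2)%:R) * (D%:R * M%:R)
      + \sum_(0 <= p < P | prime p && (p <= 2 ^ tail_exp l)%N) lg p * (D * (2 ^ l) ^ d * Q)%:R)).
    rewrite [X in _ + X]big_mkcondr -big_split /=; apply: ler_sum => p pp; have p0 := prime_gt0 pp.
    have := power_count_le l Q pp; rewrite -(ler_nat RR) natrD => tlp.
    apply: (@le_trans _ _ (lg p * ((D * (2 ^ l %/ p ^ 2) * (2 ^ l) ^ d)%:R + ((p <= 2 ^ tail_exp l) * (D * (2 ^ l) ^ d * Q))%:R))).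
      by rewrite ler_wpM2l ?lgp0.
    rewrite mulrDr; apply: lerD; last by case: ifP; rewrite ?mul1n ?mul0n ?mulr0.
    rewrite -mulrA ler_wpM2l ?lgp0 // mulrC ler_pdivlMr ?ltr0n ?expn_gt0 ?p0 //.
    rewrite -!natrM ler_nat ME.
    have := leq_trunc_div (2 ^ l) (p ^ 2); set a := (_ %/ _)%N; set b := (2 ^ l)%N => ab.
    have -> : (D * a * b ^ d * p ^ 2 = D * (a * p ^ 2) * b ^ d)%N by ring.
    by rewrite [leqRHS]mulnA leq_mul2r leq_mul2l ab !orbT.
  rewrite natrD mulrDl; apply: lerD.
    by rewrite -big_distrl /= natrM -mulrA ler_wpM2r // mulr_ge0.
  rewrite -big_distrl /=.
  apply: (@le_trans _ _ (theta 0 (2 ^ tail_exp l).+1 * (D * (2 ^ l) ^ d * Q)%:R)).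
    by rewrite ler_wpM2r //; apply: sum_le_theta => p _.
  apply: (@le_trans _ _ ((2 * 2 ^ tail_exp l)%:R * (D * (2 ^ l) ^ d * Q)%:R)).
    by rewrite ler_wpM2r // natrM (theta_exp2 lgM lg_le lg2).
  rewrite -!natrM ler_nat ME; have := tail_exp_bound l.
  rewrite -/Q; set a := (2 ^ tail_exp l)%N; set b := (2 ^ l)%N; set c := ((cN + 1 + D) * _)%N => ab.
  have -> : (2 * a * (D * b ^ d * Q) = D * 2 * b ^ d * (Q * a))%N by ring.
  have -> : (D * 2 * c * (b * b ^ d) = D * 2 * b ^ d * (c * b))%N by ring.
  by rewrite leq_mul2l ab orbT.
rewrite /C_upper natrD mulrDl !(natrM _ _ (_ + _)) -!mulrA; apply: lerD; rewrite ler_wpM2l //.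
Qed.


Definition C_scale := (1 + D * 2 ^ D.+2 * cs)%N.

(** For [p] of order [2 ^ (D i)] the ideal has a fundamental domain of diameter
    [O(2 ^ i)], so the numbers of its elements in two boxes compare as the volumes of
    the boxes, up to a boundary term. *)
Lemma root_count_scale p (r : 'F_p) b s i : prime p -> is_root h r ->
  (2 ^ (D * i) <= p < 2 ^ (D * i.+1))%N -> (i <= b)%N -> (2 * (2 ^ i.+1 * cs) <= 2 ^ b)%N ->
  (root_count d r (2 ^ (b + s)) <=
     (2 ^ s) ^ D * (root_count d r (2 ^ b) + C_scale * (2 ^ (b - i)) ^ d))%N.
Proof.
move=> pp hr /andP[ip pi] ib wb; have p0 := prime_gt0 pp.
have pT : (p < (2 ^ i.+1).+1 ^ D)%N.
  apply: (leq_trans pi); rewrite mulnC expnM leq_exp2r //.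
have := @root_count_upper _ _ hmon hsz nrm_row p r (2 ^ i.+1) (2 ^ (b + s)) pp hr pT.
have := @root_count_lower _ _ hmon hsz nrm_row p r (2 ^ i.+1) (2 ^ b) pp hr pT wb.
set w := (2 ^ i.+1 * cs)%N in wb *; set B := (2 ^ b)%N in wb *; set m := (2 ^ s)%N.
set RB := root_count _ _ _; set RL := root_count _ _ _ => lowB upL.
have m0 : (0 < m)%N by rewrite expn_gt0.
have LE : (2 ^ (b + s) = m * B)%N by rewrite expnD mulnC.
rewrite LE in upL.
pose x := (m * B + 2 * w)%N; pose y := (m * (B - 2 * w))%N.
have yx : (y <= x)%N by rewrite /y /x mulnBr; lia.
have := expn_sub_le d yx => xy.
have wmw : (w <= m * w)%N by rewrite leq_pmull.
have BmB : (B <= m * B)%N by rewrite leq_pmull.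
have xy4 : (x - y <= 4 * m * w)%N.
  by rewrite /x /y mulnBr mulnCA -mulnA; exact: sub_shift_le.
have x2 : (x <= 2 * (m * B))%N by rewrite /x [leqRHS]mul2n -addnn leq_add2l (leq_trans wb BmB).
have yD : (y ^ D <= m ^ D * (p * RB.+1))%N by rewrite /y expnMn leq_mul2l lowB orbT.
have tE : (D * (x - y) * x ^ d <= p * (m ^ D * (D * 2 ^ D.+2 * cs * (2 ^ (b - i)) ^ d)))%N.
  apply: (@leq_trans (D * (4 * m * w) * (2 * (m * B)) ^ d)).
    by rewrite leq_mul ?leq_mul2l ?xy4 ?orbT //; case: (d) => // d'; rewrite leq_exp2r.
  apply: (@leq_trans (2 ^ (D * i) * (m ^ D * (D * 2 ^ D.+2 * cs * (2 ^ (b - i)) ^ d)))); last by rewrite leq_mul2r ip orbT.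
  have BE : (B = 2 ^ i * 2 ^ (b - i))%N by rewrite -expnD subnKC.
  rewrite BE /w !expnMn !expnS [(D * i)%N]mulnC expnM expnS.
  move: (2 ^ i)%N (2 ^ (b - i))%N => a c.
  set a1 := (a ^ d)%N; set c1 := (c ^ d)%N; set t := (2 ^ d)%N; set m1 := (m ^ d)%N; set e := cs.
  move: a1 c1 t m1 e D => a1 c1 t m1 e D'; apply: eq_leq; ring.
rewrite -(leq_pmul2l p0) mulnC; apply: leq_trans upL _; apply: leq_trans xy _.
apply: leq_trans (leq_add yD tE) _.
rewrite /C_scale; have c1 : (1 <= (2 ^ (b - i)) ^ d)%N by rewrite !expn_gt0.
have -> : (m ^ D * (p * RB.+1) + p * (m ^ D * (D * 2 ^ D.+2 * cs * (2 ^ (b - i)) ^ d)) =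
  p * (m ^ D * (RB + (1 + D * 2 ^ D.+2 * cs * (2 ^ (b - i)) ^ d))))%N.
  by move: (m ^ D)%N (D * _ * _ * _)%N => f g; rewrite -addn1; ring.
rewrite leq_mul2l leq_mul2l leq_add2l mulnDl mul1n leq_add2r c1 !orbT //.
Qed.

Lemma zero_count_scale p b s i : prime p ->
  (2 ^ (D * i) <= p < 2 ^ (D * i.+1))%N -> (i <= b)%N -> (2 * (2 ^ i.+1 * cs) <= 2 ^ b)%N ->
  (zero_count p (b + s) <= (2 ^ s) ^ D * (zero_count p b + D * C_scale * (2 ^ (b - i)) ^ d))%N.
Proof.
move=> pp ip ib wb; rewrite !zero_countE.
apply: (@leq_trans (\sum_(r in roots h p) (2 ^ s) ^ D *
    (root_count d r (2 ^ b) + C_scale * (2 ^ (b - i)) ^ d))).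
  by apply: leq_sum => r; rewrite inE => /eqP hr; apply: root_count_scale.
rewrite -big_distrr leq_mul2l big_split /= leq_add2l sum_nat_const -mulnA leq_mul2r.
by rewrite card_roots // !orbT.
Qed.

Definition C_scale_sum := (2 * 2 ^ D * D * C_scale)%N.

(** The boundary terms of the primes between [2 ^ (D i)] and [2 ^ (D (i + 1))] add up, by
    Chebyshev's bound, to a geometric progression in [i]. *)
Lemma sum_scale b s k : (k <= b)%N -> (2 * (2 ^ k * cs) <= 2 ^ b)%N ->
  \sum_(0 <= p < 2 ^ (D * k) | prime p && ~~ ramified p) lg p * (zero_count p (b + s))%:R <=
  ((2 ^ s) ^ D)%:R * (\sum_(0 <= p < 2 ^ (D * k) | prime p && ~~ ramified p) lg p * (zero_count p b)%:R
     + (C_scale_sum * (2 ^ b) ^ d * 2 ^ k)%:R).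
Proof.
elim: k => [|k IH] kb wb.
  have e0 (F : nat -> RR) : \sum_(0 <= p < 1 | prime p && ~~ ramified p) F p = 0.
    by rewrite big_mkcond big_nat1.
  by rewrite muln0 expn0 !e0 add0r mulr_ge0.
have kb' := ltnW kb.
have wb' : (2 * (2 ^ k * cs) <= 2 ^ b)%N.
  by apply: leq_trans wb; rewrite leq_mul2l leq_mul2r leq_exp2l ?leqnSn ?orbT.
have cut : (2 ^ (D * k) <= 2 ^ (D * k.+1))%N by rewrite leq_exp2l // leq_mul2l leqnSn orbT.
rewrite [leLHS](big_cat_nat (n := (2 ^ (D * k))%N)) //= [X in _ * (X + _)](big_cat_nat (n := (2 ^ (D * k))%N)) //=.
set m := ((2 ^ s) ^ D)%N.
have blk : \sum_(2 ^ (D * k) <= p < 2 ^ (D * k.+1) | prime p && ~~ ramified p) lg p * (zero_count p (b + s))%:R <=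
  m%:R * (\sum_(2 ^ (D * k) <= p < 2 ^ (D * k.+1) | prime p && ~~ ramified p) lg p * (zero_count p b)%:R
    + (C_scale_sum * (2 ^ b) ^ d * 2 ^ k)%:R).
  apply: (@le_trans _ _ (m%:R * (\sum_(2 ^ (D * k) <= p < 2 ^ (D * k.+1) | prime p && ~~ ramified p) lg p * (zero_count p b)%:R
     + theta 0 (2 ^ (D * k.+1)).+1 * (D * C_scale * (2 ^ (b - k)) ^ d)%:R))).
    apply: (@le_trans _ _ (m%:R * (\sum_(2 ^ (D * k) <= p < 2 ^ (D * k.+1) | prime p && ~~ ramified p) lg p * (zero_count p b)%:R
     + (\sum_(2 ^ (D * k) <= p < 2 ^ (D * k.+1) | prime p && ~~ ramified p) lg p) * (D * C_scale * (2 ^ (b - k)) ^ d)%:R))).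
      rewrite [X in _ + X]big_distrl -big_split big_distrr /= big_nat_cond [leRHS]big_nat_cond.
      apply: ler_sum => p /andP[kp /andP[pp _]].
      rewrite -mulrDr mulrCA ler_wpM2l ?lgp0 // -natrD -natrM ler_nat.
      exact: zero_count_scale.
    rewrite ler_wpM2l ?lerD2l ?ler_wpM2r //.
    apply: (@le_trans _ _ (theta (2 ^ (D * k)) (2 ^ (D * k.+1)))).
      by rewrite /log_primes big_mkcondr /=; apply: ler_sum => p pp; case: ifP => // _; exact: lgp0.
    by apply: theta_le.
  rewrite ler_wpM2l ?lerD2l //.
  apply: (@le_trans _ _ (2 * (2 ^ (D * k.+1))%:R * (D * C_scale * (2 ^ (b - k)) ^ d)%:R)).
    by rewrite ler_wpM2r // (theta_exp2 lgM lg_le lg2).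
  rewrite -!natrM ler_nat.
  have -> : (2 ^ b = 2 ^ k * 2 ^ (b - k))%N by rewrite -expnD subnKC.
  rewrite /C_scale_sum mulnS expnD [(D * k)%N]mulnC expnM [((2 ^ k) ^ D)%N]expnS expnMn.
  move: C_scale (2 ^ D)%N (2 ^ k)%N (2 ^ (b - k))%N => e t a c.
  move: (a ^ d)%N (c ^ d)%N D => a1 c1 D'; apply: eq_leq; ring.
apply: le_trans (lerD (IH kb' wb') blk) _.
rewrite -mulrDr ler_wpM2l //.
have -> : ((C_scale_sum * (2 ^ b) ^ d * 2 ^ k.+1)%:R : RR) = (C_scale_sum * (2 ^ b) ^ d * 2 ^ k)%:R + (C_scale_sum * (2 ^ b) ^ d * 2 ^ k)%:R.
  by rewrite -natrD; congr _%:R; rewrite expnS; ring.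
by rewrite addrACA lexx.
Qed.

Definition C_crude := ((1 + 2 * cs) ^ D)%N.

(** Chebyshev's function for the unramified primes modulo which [h] has a root. *)
Definition split_theta P := \sum_(0 <= p < P | prime p && (~~ ramified p && (roots h p != set0))) lg p.

(** At each root modulo [p], a proportion at most [O(1 / p)] of the box vanishes. *)
Lemma sum_large l k P :
  \sum_(2 ^ (D * k) <= p < P | prime p && ~~ ramified p) lg p * (zero_count p l)%:R * (2 ^ (D * k))%:R
  <= (D * C_crude)%:R * (2 ^ (D * l))%:R * split_theta P.
Proof.
have [kP|Pk] := leqP (2 ^ (D * k)) P; last first.
  rewrite big_geq ?(ltnW Pk) // !mulr_ge0 // sumr_ge0 // => p /andP[pp _]; exact: lgp0.
rewrite /split_theta [X in _ * X](big_cat_nat (n := (2 ^ (D * k))%N)) //= mulrDr ler_wpDl //.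
  by rewrite !mulr_ge0 // sumr_ge0 // => p /andP[pp _]; exact: lgp0.
rewrite big_distrr /= [leRHS]big_mkcond [leLHS]big_mkcond /= big_nat_cond [leRHS]big_nat_cond.
apply: ler_sum => p /andP[/andP[kp _] _].
case: (boolP (prime p)) => //= pp; case: (boolP (ramified p)) => //= _.
case: (boolP (roots h p == set0)) => /= [/eqP rt|rt].
  by rewrite zero_countE rt big_set0 mulr0 mul0r.
rewrite mulrC mulrCA [leRHS]mulrC ler_wpM2l ?lgp0 // -!natrM ler_nat.
apply: (@leq_trans (p * zero_count p l)); first by rewrite leq_mul2r kp orbT.
rewrite zero_countE big_distrr /=.
apply: (@leq_trans (\sum_(r in roots h p) C_crude * 2 ^ (D * l))).
  apply: leq_sum => r; rewrite inE => /eqP hr; rewrite mulnC.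
  apply: leq_trans (root_count_crude hmon hsz nrm_row (2 ^ l) pp hr) _.
  by rewrite /C_crude [(D * l)%N]mulnC expnM -expnMn leq_exp2r //; apply: eq_leq; ring.
by rewrite sum_nat_const -mulnA leq_mul2r card_roots ?orbT.
Qed.

(** The large box is [2 ^ shift] times longer than the one that bounds the
    contribution of the small primes; the gain [D * shift] exceeds all bounded terms. *)
Definition shift := (C_lower + cN + C_scale_sum + C_upper).+1.
(** So that [2 * (2 ^ k * cs) <= 2 ^ (base + k)], as [root_count_scale] requires. *)
Definition base := (2 * cs)%N.

(** Compare the boxes of sides [2 ^ b] and [2 ^ l], where [l = b + shift]. By [sum_scale],
    the primes below [2 ^ (D k)] contribute to the average over the large box no more
    than to the average over the small one, up to a constant, hence at most
    [D b + O(1)]. As the average over the large box is at least [D l - O(1)], the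
    larger primes contribute at least [1], and [sum_large] converts this into a
    lower bound for [split_theta]. *)
Lemma split_theta_lower k :
  (2 ^ (D * k))%:R <= (D * C_crude)%:R * split_theta (2 ^ (cN + D * (base + shift)) * 2 ^ (D * k)).+1.
Proof.
pose b := (base + k)%N; pose l := (b + shift)%N.
have PE : (2 ^ (cN + D * (base + shift)) * 2 ^ (D * k) = 2 ^ nrm_exp l)%N.
  by rewrite -expnD /nrm_exp /l /b; congr (_ ^ _)%N; ring.
rewrite PE; set P := (2 ^ nrm_exp l).+1.
have kb : (k <= b)%N by rewrite leq_addl.
have wb : (2 * (2 ^ k * cs) <= 2 ^ b)%N.
  rewrite /b expnD mulnCA mulnC leq_mul2r -/base; apply/orP; right; apply: ltnW; exact: ltn_expl.
have YP : (2 ^ (D * k) <= P)%N.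
  by apply: leqW; rewrite leq_exp2l // /nrm_exp /l /b; nia.
set M := (2 ^ (D * l))%N; set Y := (2 ^ (D * k))%N.
have M0 : (0 : RR) < M%:R by rewrite ltr0n expn_gt0.
have Y0 : (0 : RR) < Y%:R by rewrite ltr0n expn_gt0.
have ME : M = ((2 ^ shift) ^ D * 2 ^ (D * b))%N.
  by rewrite /M -expnM -expnD; congr (_ ^ _)%N; rewrite /l; ring.
have lo := log_norm_sum_lower l.
have up := log_norm_sum_le_primes l.
rewrite [X in _ <= X + _](big_cat_nat (n := Y)) //= -/P -/M in up.
have sc := sum_scale shift kb wb; rewrite -/l -/Y in sc.
have la := sum_large l k P; rewrite -big_distrl /= -/Y -/M in la.
have sb := le_trans (log_norm_sum_ge_primes Y b) (log_norm_sum_upper b).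
set A1 := \sum_(0 <= p < Y | _) _ in up sc.
set A2 := \sum_(Y <= p < P | _) _ in up la.
set A3 := \sum_(0 <= p < Y | _) _ in sb sc.
set T := split_theta P in la *; set E := (D * C_crude)%:R in la *.
have sc' : A1 <= M%:R * ((nrm_exp b)%:R + C_scale_sum%:R).
  apply: le_trans sc _; rewrite {1}ME (natrM _ ((2 ^ shift) ^ D)%N (2 ^ (D * b))%N) -mulrA ler_wpM2l // mulrDr; apply: lerD => //.
  rewrite -natrM ler_nat -mulnA mulnC leq_mul2r; apply/orP; right.
  by rewrite [(D * b)%N]mulnC expnM expnS mulnC leq_mul2r leq_exp2l // kb orbT.
rewrite -/M in lo.
have main : Y%:R * (M%:R * ((D * l)%:R - C_lower%:R - (nrm_exp b)%:R - C_scale_sum%:R - C_upper%:R)) <= E * M%:R * T.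
  apply: le_trans la; rewrite mulrC; apply: ler_wpM2r; first exact: ltW.
  have H := le_trans lo up; clear -H sc'; move: (M%:R) C_upper%:R (D * l)%N%:R C_lower%:R (nrm_exp b)%:R C_scale_sum%:R H sc' => *; lra.
rewrite -(ler_pM2l M0) mulrCA [leRHS]mulrA [leLHS]mulrC; apply: le_trans main.
apply: ler_wpM2l; first exact: ltW.
rewrite ler_peMr //.
have : (C_lower + nrm_exp b + C_scale_sum + C_upper + 1 <= D * l)%N.
  rewrite /l mulnDr /nrm_exp; have : (shift <= D * shift)%N by rewrite leq_pmull.
  rewrite {1}/shift; move: (D * shift)%N (D * b)%N C_lower cN C_scale_sum C_upper; clear; lia.
rewrite -(ler_nat RR) (natrD _ _ 1) (natrD _ _ C_upper) (natrD _ _ C_scale_sum) (natrD _ C_lower).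
clear; move: C_lower%:R (nrm_exp b)%:R C_scale_sum%:R C_upper%:R (D * l)%N%:R => *; lra.
Qed.

(** If [u] vanished at all roots of [h] modulo all primes up to [C * n], then all
    those having a root would divide the norm of [u], whose logarithm is at most [n]. *)
Lemma good_prime : exists C : nat, forall n (u : {poly int}), (0 < n)%N ->
  nrm d h u != 0 -> (`|nrm d h u| <= 2 ^ n)%N ->
  exists p, [/\ prime p, (p <= C * n)%N &
    exists r : 'F_p, is_root h r /\ (map_poly intr u).[r] != 0].
Proof.
pose A := (2 ^ (cN + D * (base + shift)))%N; pose E := (D * C_crude)%N.
exists (A * 2 ^ D * E)%N => n u n0 nz un; apply: boolp.contrapT => no.
have E0 : (0 < E)%N by rewrite muln_gt0 expn_gt0 add1n.
have D2 : (1 < 2 ^ D)%N by rewrite -[1%N](expn0 2) ltn_exp2l.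
have En0 : (0 < E * n)%N by rewrite muln_gt0 E0.
have /andP[kl ku] := trunc_log_bounds D2 En0.
set k := trunc_log _ _ in kl ku.
have := split_theta_lower k.+1; rewrite -/A -/E; set P := (_ * _).+1 => low.
have PE : (P <= (A * 2 ^ D * E * n).+1)%N.
  rewrite /P ltnS -mulnA -mulnA leq_mul2l; apply/orP; right.
  by rewrite expnM expnS leq_mul2l kl orbT.
have N0 : (0 < `|nrm d h u|)%N by rewrite absz_gt0.
have ThN : split_theta P <= n%:R.
  apply: (@le_trans _ _ (lg `|nrm d h u|%N)); last first.
    by rewrite -(lg_exp2 lgM lg2) lg_le // N0.
  rewrite (@lg_sum_primes _ _ lgM _ (maxn P `|nrm d h u|.+1)) ?N0 ?leq_maxr //.
  rewrite [leRHS](big_cat_nat (n := P)) ?leq_maxl //= ler_wpDr //.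
    by apply: sumr_ge0 => p pp; rewrite mulr_ge0 ?lgp0.
  rewrite /split_theta big_mkcondr /= big_nat_cond [leRHS]big_nat_cond.
  apply: ler_sum => p /andP[/andP[_ pP] pp].
  case: ifP => [/andP[_ /set0Pn [r]]|_]; last by rewrite mulr_ge0 ?lgp0.
  rewrite inE => /eqP hr; rewrite ler_peMl ?lgp0 // ler1n -pfactor_dvdn // expn1.
  rewrite -[p]/`|p%:Z|%N -dvdzE -(Fp_intr_eq0 _ pp); apply/eqP.
  apply: (nrm_root hmon hsz hr); apply/eqP; apply/negPn/negP => ur.
  apply: no; exists p; split => //; first by rewrite -ltnS (leq_trans pP PE).
  by exists r.
have : ((2 ^ (D * k.+1))%:R : RR) <= (E * n)%:R.
  by apply: le_trans low _; rewrite natrM ler_wpM2l.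
by rewrite ler_nat leqNgt expnM ku.
Qed.

End GoodPrimes.

(** * Integral generators of number fields *)

Section PrimitiveElement.
Variable K : fieldExtType rat.

Lemma rat_field_intr_inj : injective (intr : int -> K).
Proof.
move=> a b; rewrite -!(rmorph_int (in_alg K)) => /fmorph_inj; exact: intr_inj.
Qed.

(** The minimal polynomial of a primitive element, made monic over the integers
    by a change of variable. *)
Lemma integral_generator : exists (d : nat) (h : {poly int}) (th : K),
  [/\ h \is monic /\ size h = d.+2, is_root h th,
      forall a : 'rV[int]_d.+1, vev th a = 0 -> a = 0 &
      forall x : K, exists u n, n != 0 /\ x * n%:~R = (map_poly intr u).[th]].
Proof.
have chK : [pchar K] =i pred0 by move=> p; rewrite pchar_lalg pchar_num.
have sep : separable 1 {:K}%AS by apply/separableP => y _; exact: pcharf0_separable.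
have gen := eq_adjoin_separable_generator sep (sub1v _).
set th0 := separable_generator _ _ in gen.
have /polyOver1P[p pE] := minPolyOver 1 th0.
have [d adE] : exists d, adjoin_degree 1 th0 = d.+1 by eexists.
have szp : size p = d.+2.
  by rewrite -adE -size_minPoly pE size_map_poly.
have pm : p \is monic by rewrite -(map_monic (in_alg K)) -pE monic_minPoly.
have [q [a a0 pq]] := rat_poly_scale p.
have mapZ (u : {poly int}) : map_poly (in_alg K) (map_poly intr u) = map_poly intr u.
  by rewrite -map_poly_comp; apply: eq_map_poly => c; exact: (rmorph_int (in_alg K)).
have coefQ (w : {poly rat}) i : (map_poly (in_alg K) w)`_i = in_alg K w`_i by exact: coef_map.
have coefZ' (u : {poly int}) i : (map_poly intr u : {poly K})`_i = (u`_i)%:~R by exact: coef_map.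
have aK : (a%:~R : K) != 0 by rewrite -(rmorph0 (intr : int -> K)) (inj_eq rat_field_intr_inj).
have scale_root (w : {poly rat}) (v : {poly int}) (c : int) : c != 0 -> w = c%:~R^-1 *: map_poly intr v ->
    (map_poly (in_alg K) w).[th0] * c%:~R = (map_poly intr v).[th0].
  move=> c0 ->; rewrite map_polyZ mapZ hornerZ fmorphV rmorph_int mulrAC mulVf ?mul1r //.
  by rewrite -(rmorph0 (intr : int -> K)) (inj_eq rat_field_intr_inj).
have q_root : (map_poly intr q).[th0] = 0 :> K.
  by rewrite -(scale_root _ _ _ a0 pq) -pE minPolyxx mul0r.
have szq : size q = d.+2.
  by rewrite -szp pq size_scale ?invr_eq0 ?intr_eq0 // size_map_inj_poly //; exact: intr_inj.
have qlead : q`_d.+1 = a.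
  have : p`_d.+1 = 1 by rewrite -[d.+1]/(d.+2.-1) -szp -lead_coefE (monicP pm).
  rewrite pq coefZ coef_map /= => /(congr1 ( *%R a%:~R)).
  by rewrite mulrA mulfV ?intr_eq0 // mul1r mulr1 => /intr_inj.
(* the minimal polynomial of [a%:~R * th0], where [a] is the leading coefficient of [q] *)
pose h : {poly int} := \poly_(i < d.+2) (if i == d.+1 then 1 else q`_i * a ^+ (d - i)).
have szh : size h = d.+2 by rewrite size_poly_eq // eqxx oner_neq0.
have hm : h \is monic by rewrite monicE lead_coefE szh coef_poly ltnSn /= eqxx.
pose th : K := a%:~R * th0.
exists d, h, th; split => //.
- rewrite /is_root (horner_coef_wide _ (n := d.+2)); last by rewrite -szh size_poly.
  have : a%:~R ^+ d * (map_poly intr q).[th0] = 0 :> K by rewrite q_root mulr0.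
  rewrite (horner_coef_wide _ (n := d.+2)); last by rewrite -szq size_poly.
  move=> q0; rewrite -[RHS]q0 big_distrr; apply: eq_bigr => i _; rewrite !coef_map /= coef_poly ltn_ord.
  rewrite /th exprMn; case: eqP => [id|ni].
    by rewrite id qlead rmorph1 mul1r exprSr -mulrA.
  have id : (i <= d)%N by have := ltn_ord i; lia.
  have -> : a%:~R ^+ d = a%:~R ^+ (d - i) * a%:~R ^+ i :> K by rewrite -exprD subnK.
  by rewrite rmorphM rmorphXn -!mulrA mulrCA; congr (_ * _); rewrite mulrCA.
- move=> c; rewrite vevE => c_root.
  pose w : {poly rat} := \poly_(i < d.+1) (((rVpoly c)`_i)%:~R * a%:~R ^+ i).
  have : root (map_poly (in_alg K) w) th0.
    apply/rootP; rewrite (horner_coef_wide _ (n := d.+1)); last first.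
      by rewrite size_map_poly size_poly.
    rewrite -[RHS]c_root (horner_coef_wide _ (n := d.+1)); last first.
      exact: leq_trans (size_poly _ _) (size_poly _ _).
    apply: eq_bigr => i _; rewrite coefQ coefZ' coef_poly ltn_ord.
    by rewrite rmorphM rmorphXn !rmorph_int /th exprMn mulrA.
  rewrite (@root_small_adjoin_poly _ _ 1%AS) ?adE ?size_map_poly ?size_poly //; last first.
    by apply/polyOver1P; exists w.
  rewrite map_poly_eq0 => /eqP w0; apply/rowP => i; rewrite mxE.
  have : w`_i = 0 by rewrite w0 coef0.
  rewrite coef_poly ltn_ord coef_rVpoly_ord => /eqP.
  by rewrite mulf_eq0 expf_eq0 !intr_eq0 (negPf a0) andbF orbF => /eqP.
- move=> x.
  have : x \in <<1; th0>>%VS by rewrite -gen memvf.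
  move=> /Fadjoin_polyP[w0 /polyOver1P[w ->] ->] {w0}.
  have [v [c c0 wv]] := rat_poly_scale w.
  exists (\poly_(i < size v) (v`_i * a ^+ (size v - i))), (c * a ^+ size v).
  rewrite mulf_neq0 ?expf_neq0 //; split => //.
  rewrite rmorphM mulrA (scale_root _ _ _ c0 wv) rmorphXn.
  rewrite (horner_coef_wide _ (n := size v)) ?size_poly // mulr_suml.
  rewrite (horner_coef_wide _ (n := size v)); last exact: leq_trans (size_poly _ _) (size_poly _ _).
  apply: eq_bigr => i _; rewrite !coefZ' coef_poly ltn_ord rmorphM rmorphXn /th exprMn.
  have -> : a%:~R ^+ size v = a%:~R ^+ (size v - i) * a%:~R ^+ i :> K.
    by rewrite -exprD subnK // ltnW.
  by rewrite -!mulrA; congr (_ * _); rewrite mulrC -mulrA.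
Qed.
End PrimitiveElement.

(** * Heights of words *)

Section Heights.
Variables (d : nat) (h : {poly int}) (K : fieldType) (th : K).
Hypothesis hspan : forall x : K, exists u n, n != 0 /\ x * n%:~R = (map_poly intr u).[th].

Local Notation E u := (entry_sum (mult_mx d h u)).

(** That is, [x = u(th) / N ^ k] with [u] of size at most [c]. Measuring [u] by the matrix
    of the multiplication by [u(th)] makes the size submultiplicative. *)
Definition has_height (N : int) (k c : nat) (x : K) :=
  exists2 u : {poly int}, (map_poly intr u).[th] = N%:~R ^+ k * x & (E u <= c)%N.

Section FixedDenominator.
Variable N : int.
Local Notation ht := (has_height N).

Lemma height_mul k1 k2 c1 c2 x y : ht k1 c1 x -> ht k2 c2 y -> ht (k1 + k2) (c1 * c2) (x * y).
Proof.
move=> [u ux cu] [v vy cv]; exists (u * v).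
  by rewrite rmorphM hornerM ux vy exprD; ring.
by rewrite mult_mxM (leq_trans (entry_sumM _ _)) ?leq_mul.
Qed.

Lemma height_add k c1 c2 x y : ht k c1 x -> ht k c2 y -> ht k (c1 + c2) (x + y).
Proof.
move=> [u ux cu] [v vy cv]; exists (u + v); first by rewrite rmorphD hornerD ux vy mulrDr.
by rewrite /mult_mx rmorphD (leq_trans (entry_sumD _ _)) ?leq_add.
Qed.

Lemma height_opp k c x : ht k c x -> ht k c (- x).
Proof.
move=> [u ux cu]; exists (- u); first by rewrite rmorphN hornerN ux mulrN.
by rewrite /mult_mx rmorphN -scaleN1r entry_sumZ mul1n.
Qed.

Lemma height_le k c1 c2 x : (c1 <= c2)%N -> ht k c1 x -> ht k c2 x.
Proof. by move=> le12 [u ux cu]; exists u => //; exact: leq_trans le12. Qed.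

Lemma height_0 k c : ht k c 0.
Proof.
exists 0; first by rewrite rmorph0 horner0 mulr0.
by rewrite /mult_mx rmorph0 /entry_sum big1 // => i _; rewrite big1 // => j _; rewrite mxE.
Qed.

Lemma height_sum k c n (F : 'I_n -> K) : (forall i, ht k c (F i)) -> ht k (n * c) (\sum_i F i).
Proof.
elim: n F => [|n IH] F hF; first by rewrite big_ord0; exact: height_0.
rewrite big_ord_recr /= mulSn addnC; apply: height_add => //.
by apply: IH => i; exact: hF.
Qed.

(** Each matrix multiplies the size by a constant. *)
Lemma height_word (T : eqType) k (A : T -> 'M[K]_k) (r : 'rV[K]_k) (v : 'cV[K]_k) c (w : seq T) :
  (forall j, ht 1 c (r 0 j)) -> (forall i, ht 1 c (v i 0)) ->
  (forall y, y \in w -> forall i j, ht 1 c (A y i j)) ->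
  ht (size w + 2) ((k.+1 * c) ^ (size w + 2)) ((r *m foldr (fun y => mulmx (A y)) v w) 0 0).
Proof.
move=> hr hv hA.
have : forall i, ht (size w).+1 ((k.+1 * c) ^ (size w).+1) (foldr (fun y => mulmx (A y)) v w i 0).
  elim: w hA => [_ i|y w IH hA i] /=.
    by apply: height_le (hv i); rewrite expn1 leq_pmull.
  rewrite mxE; apply: height_le (height_sum _) => [|j]; last first.
    rewrite -[(size w).+2]/(1 + (size w).+1)%N; apply: height_mul; first exact: (hA y (mem_head _ _)).
    by apply: IH => z zw; apply: hA; rewrite in_cons zw orbT.
  by rewrite [X in (_ <= X)%N]expnS mulnA leq_mul // leq_mul.
move=> hw; rewrite mxE addn2; apply: height_le (height_sum _) => [|j]; last first.
  by rewrite -[(size w).+2]/(1 + (size w).+1)%N; apply: height_mul; [exact: hr | exact: hw].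
by rewrite [X in (_ <= X)%N]expnS mulnA leq_mul // leq_mul.
Qed.
End FixedDenominator.

Lemma common_height (s : seq K) : exists (N : int) c, N != 0 /\ forall x, x \in s -> has_height N 1 c x.
Proof.
elim: s => [|x s [N [c [N0 hs]]]]; first by exists 1, 0%N.
have [u [n [n0 xn]]] := hspan x.
exists (N * n), (E (N%:P * u) + c * E n%:P)%N; split; first exact: mulf_neq0.
move=> y; rewrite in_cons => /orP[/eqP ->|/hs[v vy vc]].
  exists (N%:P * u); last exact: leq_addr.
  by rewrite rmorphM /= map_polyC hornerM hornerC -xn expr1 rmorphM /= -mulrA [x * _]mulrC.
exists (v * n%:P).
  by rewrite rmorphM /= map_polyC hornerM hornerC vy !expr1 rmorphM /=; ring.
rewrite mult_mxM (leq_trans (entry_sumM _ _)) // (leq_trans _ (leq_addl _ _)) //.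
exact: leq_mul.
Qed.

(** The norm of [u(th)] is at most exponential in the length of a word. *)
Lemma nrm_le_exp c : exists c', forall n (u : {poly int}), (0 < n)%N -> (E u <= c ^ n)%N ->
  (`|nrm d h u| <= 2 ^ (c' * n))%N.
Proof.
exists (d.+1`! + c * d.+1)%N => n u n0 uc.
apply: leq_trans (absz_det_le (L := c ^ n) _) _ => [i j|].
  exact: leq_trans (entry_le_sum _ _ _) uc.
rewrite mulnDl expnD leq_mul //.
  apply: leq_trans (ltnW (ltn_expl _ (isT : 1 < 2)%N)) _.
  by rewrite leq_exp2l // leq_pmulr.
rewrite -expnM -mulnA [(d.+1 * n)%N]mulnC; apply: (@leq_trans ((2 ^ c) ^ (n * d.+1))).
  by rewrite leq_exp2r ?muln_gt0 ?n0 // ltnW // ltn_expl.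
by rewrite -expnM.
Qed.
End Heights.

(** * Noether normalization *)

Lemma mmap_rmorph n (R S S' : comNzRingType) (f : {rmorphism R -> S}) (g : {rmorphism S -> S'})
    (t : 'I_n -> S) (p : {mpoly R[n]}) :
  g (mmap f t p) = mmap (g \o f) (fun i => g (t i)) p.
Proof.
rewrite /mmap rmorph_sum; apply: eq_bigr => m _; rewrite rmorphM /=; congr (_ * _).
by rewrite /mmap1 rmorph_prod; apply: eq_bigr => i _; rewrite rmorphXn.
Qed.

Lemma eq_mmap n (R S : comNzRingType) (f f' : R -> S) (t t' : 'I_n -> S) p :
  f =1 f' -> t =1 t' -> mmap f t p = mmap f' t' p.
Proof.
move=> ff tt; rewrite /mmap; apply: eq_bigr => m _; rewrite ff; congr (_ * _).
by apply: eq_bigr => i _; rewrite tt.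
Qed.

Lemma mmapXU n (R S : comNzRingType) (f : {rmorphism R -> S}) (t : 'I_n -> S) i :
  mmap f t 'X_i = t i.
Proof. by rewrite mmapX mmap1U. Qed.

(** Uniqueness of the digits in base [r]. *)
Lemma weight_inj n r (a b : 'I_n -> nat) : (forall i, a i < r)%N -> (forall i, b i < r)%N ->
  (\sum_i a i * r ^ i = \sum_i b i * r ^ i)%N -> a =1 b.
Proof.
elim: n a b => [|n IH] a b ar br; first by move=> _ [].
have shift (c : 'I_n.+1 -> nat) :
    (\sum_i c i * r ^ i = c ord0 + r * \sum_(i < n) c (lift ord0 i) * r ^ i)%N.
  rewrite big_ord_recl expn0 muln1 big_distrr; congr (_ + _)%N; apply: eq_bigr => i _.
  by rewrite /= expnS mulnCA.
rewrite !shift => E.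
have r0 : (0 < r)%N by apply: leq_ltn_trans (ar ord0).
have e0 : a ord0 = b ord0.
  have := congr1 (modn^~ r) E; rewrite /= ![(_ + r * _)%N]addnC ![(r * _)%N]mulnC !modnMDl.
  by rewrite !modn_small.
move: E; rewrite e0 => /addnI /eqP; rewrite eqn_pmul2l // => /eqP E i.
have {}IH := IH (fun i => a (lift ord0 i)) (fun i => b (lift ord0 i)) (fun i => ar _) (fun i => br _) E.
by case: (unliftP ord0 i) => [k ->|-> //]; exact: IH.
Qed.

Lemma seq_max (T : eqType) (f : T -> nat) (s : seq T) x : x \in s ->
  exists2 y, y \in s & forall z, z \in s -> (f z <= f y)%N.
Proof.
elim: s x => [//|a s IH] x _; case: s IH => [|c s] IH.
  by exists a; rewrite ?mem_head // => z; rewrite inE => /eqP ->.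
have [y ys ymax] := IH c (mem_head _ _).
have [le|lt] := leqP (f a) (f y).
  by exists y => [|z]; rewrite inE ?ys ?orbT // => /orP[/eqP -> //|/ymax].
exists a => [|z]; rewrite inE ?eqxx // => /orP[/eqP -> //|/ymax zy].
exact: leq_trans zy (ltnW lt).
Qed.

Section Noether.
Variables (D B : comNzRingType) (j : {rmorphism D -> B}).
Hypothesis jprime : forall x y, j (x * y) = 0 -> j x = 0 \/ j y = 0.

Section AlmostIntegral.
Variables (e : nat) (t : 'I_e -> B).

(** Integral after inverting one element of the base ring. *)
Definition almost_integral (x : B) : Prop :=
  exists N, j N != 0 /\ integralOver (mmap j t) (j N * x).

Lemma integral_base c : integralOver (mmap j t) (j c).
Proof. rewrite -(mmapC t j); exact: integral_id. Qed.

Lemma jmul_neq0 x y : j x != 0 -> j y != 0 -> j (x * y) != 0.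
Proof. by move=> /eqP nx /eqP ny; apply/eqP => jxy; case: (jprime jxy). Qed.

Lemma almost_of_integral x : integralOver (mmap j t) x -> almost_integral x.
Proof. by move=> ix; exists 1; rewrite rmorph1 mul1r oner_eq0. Qed.

Lemma almost_base c : almost_integral (j c).
Proof. by apply/almost_of_integral/integral_base. Qed.

Lemma almostD x y : almost_integral x -> almost_integral y -> almost_integral (x + y).
Proof.
move=> [N [nN iN]] [M [nM iM]]; exists (N * M); split; first exact: jmul_neq0.
have -> : j (N * M) * (x + y) = j M * (j N * x) + j N * (j M * y) by rewrite rmorphM; ring.
by apply: integral_add; apply: integral_mul => //; exact: integral_base.
Qed.

Lemma almostM x y : almost_integral x -> almost_integral y -> almost_integral (x * y).
Proof.
move=> [N [nN iN]] [M [nM iM]]; exists (N * M); split; first exact: jmul_neq0.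
have -> : j (N * M) * (x * y) = (j N * x) * (j M * y) by rewrite rmorphM; ring.
exact: integral_mul.
Qed.

Lemma almost0 : almost_integral 0.
Proof. by rewrite -(rmorph0 j); exact: almost_base. Qed.

Lemma almostX x k : almost_integral x -> almost_integral (x ^+ k).
Proof.
move=> ax; elim: k => [|k IH]; first by rewrite expr0 -(rmorph1 j); exact: almost_base.
by rewrite exprS; exact: almostM.
Qed.

Lemma almost_sum (I : Type) (r : seq I) (F : I -> B) :
  (forall i, almost_integral (F i)) -> almost_integral (\sum_(i <- r) F i).
Proof. by move=> aF; elim/big_ind: _ => //; [exact: almost0 | exact: almostD]. Qed.

Definition almost_poly (q : {poly B}) := forall i, almost_integral q`_i.

Lemma almost_polyM p q : almost_poly p -> almost_poly q -> almost_poly (p * q).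
Proof.
by move=> ap aq i; rewrite coefM; apply: almost_sum => k; exact: almostM.
Qed.

Lemma almost_polyD p q : almost_poly p -> almost_poly q -> almost_poly (p + q).
Proof. by move=> ap aq i; rewrite coefD; exact: almostD. Qed.

Lemma almost_polyC c : almost_integral c -> almost_poly c%:P.
Proof. by move=> ac i; rewrite coefC; case: ifP => // _; exact: almost0. Qed.

Lemma almost_polyXn k : almost_poly 'X^k.
Proof. by move=> i; rewrite coefXn -(rmorph_nat j); exact: almost_base. Qed.

Lemma almost_poly_exp p k : almost_poly p -> almost_poly (p ^+ k).
Proof.
move=> ap; elim: k => [|k IH]; last by rewrite exprS; exact: almost_polyM.
by rewrite expr0 -(expr0 'X); exact: almost_polyXn.
Qed.

Lemma common_denominator n (F : nat -> B) : (forall i, almost_integral (F i)) ->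
  exists M, j M != 0 /\ forall i, (i < n)%N -> integralOver (mmap j t) (j M * F i).
Proof.
move=> aF; elim: n => [|n [M [nM iM]]]; first by exists 1; rewrite rmorph1 oner_eq0.
have [N [nN iN]] := aF n; exists (N * M); split; first exact: jmul_neq0.
move=> i; rewrite ltnS leq_eqVlt => /orP[/eqP ->|ltin]; rewrite rmorphM.
  by rewrite mulrAC; apply: integral_mul (integral_base _).
by rewrite -mulrA; apply: integral_mul (integral_base _) (iM i ltin).
Qed.

(** Multiplying the relation by a power of the leading coefficient and of a common
    denominator makes it monic and integral. *)
Lemma almost_root N k (q : {poly B}) x : j N != 0 -> (forall i, almost_integral q`_i) ->
  (0 < k)%N -> j N * x ^+ k + \sum_(i < k) q`_i * x ^+ i = 0 -> almost_integral x.
Proof.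
move=> nN aq k0 qx; have [M [nM iM]] := common_denominator k aq.
exists (N * M); split; first exact: jmul_neq0.
pose c (i : nat) := q`_i * j N ^+ (k.-1 - i) * j M ^+ (k - i).
pose P : {poly B} := 'X^k + \poly_(i < k) c i.
have sP : (size (\poly_(i < k) c i) < size ('X^k : {poly B}))%N by rewrite size_polyXn ltnS size_poly.
have Pm : P \is monic by apply/monicP; rewrite lead_coefDl // lead_coefXn.
apply: (integral_root_monic Pm).
  rewrite rootE /P hornerD hornerXn horner_poly.
  have -> : (j (N * M)) * x = j N * j M * x by rewrite rmorphM.
  apply/eqP; transitivity (j M ^+ k * j N ^+ k.-1 * (j N * x ^+ k + \sum_(i < k) q`_i * x ^+ i)).
    rewrite mulrDr big_distrr /=; congr (_ + _).
      by rewrite -[in LHS](prednK k0) -[in X in _ = _ * (_ * X)](prednK k0) -{2}[k](prednK k0) !exprMn !exprS; ring.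
    apply: eq_bigr => i _; rewrite /c !exprMn.
    have i1 : (i <= k.-1)%N by rewrite -ltnS prednK.
    have -> : j M ^+ k = j M ^+ (k - i) * j M ^+ i by rewrite -exprD subnK // ltnW.
    have -> : j N ^+ k.-1 = j N ^+ (k.-1 - i) * j N ^+ i by rewrite -exprD subnK.
    by ring.
  by rewrite qx mulr0.
move=> a /(nthP 0) [i iP <-]; rewrite /P coefD coefXn coef_poly.
case: ltnP => ik.
  rewrite (ltn_eqF ik) add0r /c.
  have -> : (k - i = (k - i).-1.+1)%N by rewrite prednK // subn_gt0.
  rewrite exprS -!rmorphXn.
  have -> : q`_i * j (N ^+ (k.-1 - i)) * (j M * j (M ^+ (k - i).-1)) =
    (j M * q`_i) * (j (N ^+ (k.-1 - i)) * j (M ^+ (k - i).-1)) by ring.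
  by apply: integral_mul (iM i ik) (integral_mul (integral_base _) (integral_base _)).
by rewrite addr0 -(rmorph_nat j); exact: integral_base.
Qed.

End AlmostIntegral.

(** The coefficients are only asked to be in the kernel of [j], so that the base ring
    may be the ring of integral polynomials, acting through its value at [th]. *)
Definition alg_indep e (t : 'I_e -> B) :=
  forall F, mmap j t F = 0 -> forall m, j F@_m = 0.

(** Nagata's change of variables: in terms of y = b_0 and of the differences
    [b_i - y ^ (r ^ i)], with [r] large, a relation between the [b_i] becomes a polynomial
    in [y] whose leading coefficient is a coefficient of the relation. Hence [y] is
    almost integral over the differences, to which induction applies. *)
Lemma noether_normalization m (b : 'I_m -> B) : exists e (t : 'I_e -> B),
  [/\ forall i, exists F, t i = mmap j b F, alg_indep t & forall i, almost_integral t (b i)].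
Proof.
elim: m b => [|m IH] b; have [ind|dep] := boolp.pselect (alg_indep b).
- by exists 0%N, b; split => // -[].
- case: dep => F F0 mo; have E : F = (F@_mo)%:MP.
    apply/mpolyP => mo'; rewrite mcoeffC.
    have -> : mo' = mo by apply/mnmP => -[].
    have -> : mo = 0%MM by apply/mnmP => -[].
    by rewrite eqxx mulr1.
  by move: F0; rewrite E mmapC mcoeffC; case: eqP => _; rewrite ?mulr1 ?mulr0 ?rmorph0.
- exists m.+1, b; split => // i; first by exists 'X_i; rewrite mmapXU.
  by apply: almost_of_integral; rewrite -(mmapXU j b i); exact: integral_id.
have [F [F0 [mo0 Fmo0]]] : exists F, mmap j b F = 0 /\ exists mo, j F@_mo != 0.
  apply: boolp.contrapT => no; apply: dep => F F0 mo; apply/eqP/negPn/negP => nmo.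
  by apply: no; exists F; split => //; exists mo.
(* [r] exceeds all the exponents in [F], hence [weight_inj] applies to them *)
pose r := (msize F).+1; pose y := b ord0.
pose be (i : 'I_m.+1) := b i - y ^+ (r ^ i).
have be0 : be ord0 = 0 by rewrite /be expn0 expr1 subrr.
have [e [t [tb indt aint]]] := IH (fun i => be (lift ord0 i)).
have abe i : almost_integral t (be i).
  by case: (unliftP ord0 i) => [k ->|->]; [exact: aint | rewrite be0; exact: almost0].
pose wt (mo : 'X_{1..m.+1}) := (\sum_i mo i * r ^ i)%N.
pose fac i : {poly B} := (be i)%:P + 'X^(r ^ i).
pose pr (mo : 'X_{1..m.+1}) : {poly B} := \prod_i fac i ^+ mo i.
have rk (i : 'I_m.+1) : (0 < r ^ i)%N by rewrite expn_gt0.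
have facm i : fac i \is monic.
  by apply/monicP; rewrite lead_coefDr ?lead_coefXn // size_polyXn ltnS (leq_trans (size_polyC_leq1 _)).
have facs i : size (fac i) = (r ^ i).+1.
  by rewrite /fac addrC size_polyDl size_polyXn // ltnS (leq_trans (size_polyC_leq1 _)).
have expm i k : fac i ^+ k \is monic by exact: monic_exp.
have exps i k : size (fac i ^+ k) = (k * r ^ i).+1.
  elim: k => [|k IHk]; first by rewrite expr0 size_poly1.
  by rewrite exprS size_Mmonic ?expm ?monic_neq0 // facs IHk addnS mulSn.
have prms (s : seq 'I_m.+1) (mo : 'X_{1..m.+1}) : (\prod_(i <- s) fac i ^+ mo i \is monic) /\
   size (\prod_(i <- s) fac i ^+ mo i) = (\sum_(i <- s) mo i * r ^ i).+1.
  elim: s => [|i s [IHm IHs]]; first by rewrite !big_nil monic1 size_poly1.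
  rewrite !big_cons; split; first by rewrite monicMl.
  by rewrite size_Mmonic ?monic_neq0 // IHs exps addSn addnS /=.
have prm mo : pr mo \is monic by have [] := prms (index_enum _) mo.
have prs mo : size (pr mo) = (wt mo).+1 by have [] := prms (index_enum _) mo.
pose Q : {poly B} := \sum_(mo <- msupp F) (j F@_mo) *: pr mo.
have Qy : Q.[y] = 0.
  rewrite /Q horner_sum -[RHS]F0 /mmap; apply: eq_bigr => mo _.
  rewrite hornerZ horner_prod /mmap1; congr (_ * _); apply: eq_bigr => i _.
  by rewrite horner_exp !hornerE subrK.
pose S := [seq mo <- msupp F | j F@_mo != 0].
have mo0S : mo0 \in S.
  rewrite mem_filter Fmo0 mcoeff_msupp; apply: contraNneq Fmo0 => ->.
  by rewrite rmorph0.
have [mx mxS mxP] : exists2 mx, mx \in S & forall mo, mo \in S -> (wt mo <= wt mx)%N.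
  exact: seq_max mo0S.
have small mo : mo \in S -> forall i, (mo i < r)%N.
  rewrite mem_filter => /andP[_ moF] i; rewrite /r ltnS ltnW //.
  apply: leq_ltn_trans (msize_mdeg_lt moF); rewrite mdegE (bigD1 i) //= leq_addr //.
have wtinj mo : mo \in S -> wt mo = wt mx -> mo = mx.
  by move=> moS E; apply/mnmP; apply: (weight_inj (small _ moS) (small _ mxS) E).
set N := F@_mx; set k := wt mx.
have nN : j N != 0 by move: mxS; rewrite mem_filter => /andP[].
have QE : Q = \sum_(mo <- S) (j F@_mo) *: pr mo.
  rewrite /S big_filter /Q [RHS]big_mkcond; apply: eq_bigr => mo _.
  by case: eqP => [->|_] //=; rewrite scale0r.
have uS : uniq S by rewrite filter_uniq // msupp_uniq.
have Qk : Q`_k = j N.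
  rewrite QE (bigD1_seq mx) //= coefD coefZ.
  have /monicP := prm mx; rewrite lead_coefE prs /= => ->; rewrite mulr1.
  rewrite coef_sum big_seq_cond big1 ?addr0 // => mo /andP[moS nmo].
  rewrite coefZ nth_default ?mulr0 // prs ltn_neqAle mxP // andbT.
  by apply: contra nmo => /eqP /(wtinj _ moS) ->.
have Qs : (size Q <= k.+1)%N.
  rewrite QE; apply: leq_trans (size_sum _ _ _) _; apply/bigmax_leqP_seq => mo moS _.
  by apply: leq_trans (size_scale_leq _ _) _; rewrite prs ltnS mxP.
have Qrel : j N * y ^+ k + \sum_(i < k) Q`_i * y ^+ i = 0.
  by rewrite -[RHS]Qy (horner_coef_wide _ Qs) big_ord_recr /= Qk addrC.
have k0 : (0 < k)%N.
  rewrite lt0n; apply: contraNneq nN => k0; move: Qrel; rewrite k0 big_ord0 expr0 mulr1 addr0.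
  by move=> ->.
have aQ i : almost_integral t Q`_i.
  rewrite /Q coef_sum; apply: almost_sum => mo; rewrite coefZ; apply: almostM.
    exact: almost_base.
  suff : almost_poly t (pr mo) by [].
  rewrite /pr; elim/big_ind: _ => [|p q ap aq|i0 _].
  - by rewrite -(expr0 'X); exact: almost_polyXn.
  - exact: almost_polyM.
  - by apply: almost_poly_exp; apply: almost_polyD; [apply: almost_polyC | exact: almost_polyXn].
have ay : almost_integral t y := almost_root nN aQ k0 Qrel.
exists e, t; split => // i.
  have [G ->] := tb i.
  exists (mmap (@mpolyC m.+1 D) (fun l => 'X_(lift ord0 l) - 'X_ord0 ^+ (r ^ (lift ord0 l : 'I_m.+1))) G).
  rewrite mmap_rmorph; apply: eq_mmap => [c|l] /=; first by rewrite mmapC.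
  by rewrite rmorphB rmorphXn /= !mmapXU.
have -> : b i = be i + y ^+ (r ^ i) by rewrite /be subrK.
by apply: almostD => //; exact: almostX.
Qed.

End Noether.

(** * Extension of partial homomorphisms to an algebraically closed field *)

Lemma min_natP (P : nat -> Prop) : (exists n, P n) -> exists n, P n /\ forall m, P m -> (n <= m)%N.
Proof.
move=> [n Pn]; have ex : exists n, boolp.asbool (P n) by exists n; apply/boolp.asboolP.
have [k /boolp.asboolP Pk kmin] := ex_minnP ex.
by exists k; split => // m Pm; apply: kmin; apply/boolp.asboolP.
Qed.

Record is_subring (R : comNzRingType) (T : R -> Prop) : Prop := IsSubring {
  subring1 : T 1;
  subringB : forall x y, T x -> T y -> T (x - y);
  subringM : forall x y, T x -> T y -> T (x * y)
}.

Section Subring.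
Variables (R : comNzRingType) (T : R -> Prop).
Hypothesis sT : is_subring T.

Lemma subring0 : T 0. Proof. by rewrite -(subrr 1); apply: (subringB sT); exact: (subring1 sT). Qed.
Lemma subringN x : T x -> T (- x).
Proof. by move=> Tx; rewrite -sub0r; apply: (subringB sT) => //; exact: subring0. Qed.
Lemma subringD x y : T x -> T y -> T (x + y).
Proof. by move=> Tx Ty; rewrite -[y]opprK; apply: (subringB sT) => //; exact: subringN. Qed.
Lemma subringX x n : T x -> T (x ^+ n).
Proof.
move=> Tx; elim: n => [|n IH]; first by rewrite expr0; exact: (subring1 sT).
by rewrite exprS; exact: (subringM sT).
Qed.
Lemma subring_sum (I : Type) (r : seq I) (P : pred I) (F : I -> R) :
  (forall i, P i -> T (F i)) -> T (\sum_(i <- r | P i) F i).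
Proof. by move=> TF; elim/big_ind: _ => //; [exact: subring0 | exact: subringD]. Qed.
Lemma subring_prod (I : Type) (r : seq I) (P : pred I) (F : I -> R) :
  (forall i, P i -> T (F i)) -> T (\prod_(i <- r | P i) F i).
Proof.
by move=> TF; elim/big_ind: _ => //; [exact: (subring1 sT) | exact: (subringM sT)].
Qed.
Lemma subring_nat n : T n%:R.
Proof. by elim: n => [|n IH]; [exact: subring0 | rewrite -natr1; apply: subringD (subring1 sT)]. Qed.
Lemma subring_int (z : int) : T z%:~R.
Proof. by case: z => n; [exact: subring_nat | rewrite NegzE rmorphN; apply/subringN/subring_nat]. Qed.
Lemma subring_det n (A : 'M[R]_n) : (forall i j, T (A i j)) -> T (\det A).
Proof.
move=> TA; apply: subring_sum => s _; apply: (subringM sT); last by apply: subring_prod.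
by apply: subringX; apply: subringN; exact: (subring1 sT).
Qed.
Lemma subring_mmap n (t : 'I_n -> R) (F : {mpoly int[n]}) : (forall i, T (t i)) -> T (mmap intr t F).
Proof.
move=> Tt; apply: subring_sum => m _; apply: (subringM sT); first exact: subring_int.
by apply: subring_prod => i _; apply: subringX.
Qed.

Definition coefs_in (p : {poly R}) := forall i, T p`_i.
Lemma coefs_inM p q : coefs_in p -> coefs_in q -> coefs_in (p * q).
Proof. by move=> Tp Tq i; rewrite coefM; apply: subring_sum => k _; apply: (subringM sT). Qed.
Lemma coefs_inB p q : coefs_in p -> coefs_in q -> coefs_in (p - q).
Proof. by move=> Tp Tq i; rewrite coefB; apply: (subringB sT). Qed.
Lemma coefs_inC c : T c -> coefs_in c%:P.
Proof. by move=> Tc i; rewrite coefC; case: ifP => // _; exact: subring0. Qed.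
Lemma coefs_inXn n : coefs_in 'X^n.
Proof. by move=> i; rewrite coefXn; exact: subring_nat. Qed.
Definition adjoin (x : R) : R -> Prop := fun y => exists2 g, coefs_in g & y = g.[x].
Lemma adjoin_subring x : is_subring (adjoin x).
Proof.
split.
- by exists 1; rewrite ?hornerC //; apply: coefs_inC; exact: (subring1 sT).
- by move=> _ _ [f Tf ->] [g Tg ->]; exists (f - g); rewrite ?hornerD ?hornerN //; exact: coefs_inB.
- by move=> _ _ [f Tf ->] [g Tg ->]; exists (f * g); rewrite ?hornerM //; exact: coefs_inM.
Qed.
Lemma adjoin_sub x y : T y -> adjoin x y.
Proof. by move=> Ty; exists y%:P; rewrite ?hornerC //; exact: coefs_inC. Qed.
Lemma adjoin_gen x : adjoin x x.
Proof. by exists 'X; rewrite ?hornerX // -(expr1 'X); exact: coefs_inXn. Qed.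
End Subring.

Section Extension.
Variables (B : comNzRingType) (Om : closedFieldType).
Local Notation E := (B * Om)%type.
Local Notation p1 := (@fst B Om : {rmorphism E -> B}).
Local Notation p2 := (@snd B Om : {rmorphism E -> Om}).

Record is_ideal (q : B -> Prop) : Prop := IsIdeal {
  ideal0 : q 0;
  idealD : forall x y, q x -> q y -> q (x + y);
  idealM : forall x y, q y -> q (x * y)
}.

(** For [q] an ideal, this says that the subring [T] is the graph of a homomorphism
    to [Om] from the image in [B / q] of its projection to [B]. Extending a
    homomorphism is then enlarging a subring of a product, and no quotient has to
    be formed. *)
Definition functional (q : B -> Prop) (T : E -> Prop) := forall f w, T (f, w) -> q f -> w = 0.

Variable q : B -> Prop.
Hypothesis iq : is_ideal q.

Lemma ideal_sum (I : Type) (r : seq I) (P : pred I) (F : I -> B) :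
  (forall i, P i -> q (F i)) -> q (\sum_(i <- r | P i) F i).
Proof. by move=> qF; elim/big_ind: _ => //; [exact: (ideal0 iq) | exact: (idealD iq)]. Qed.

Lemma fst_exp (x : E) n : (x ^+ n).1 = x.1 ^+ n.
Proof. exact: (rmorphXn p1). Qed.

Lemma snd_exp (x : E) n : (x ^+ n).2 = x.2 ^+ n.
Proof. exact: (rmorphXn p2). Qed.

Lemma coef_fst (g : {poly E}) i : (map_poly (@fst B Om) g)`_i = (g`_i).1.
Proof. exact: (coef_map p1). Qed.

Lemma coef_snd (g : {poly E}) i : (map_poly (@snd B Om) g)`_i = (g`_i).2.
Proof. exact: (coef_map p2). Qed.

Lemma horner_pair (g : {poly E}) b w : g.[(b, w)] = ((map_poly p1 g).[b], (map_poly p2 g).[w]).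
Proof.
rewrite [LHS]surjective_pairing; congr pair.
  by rewrite -(horner_map p1 g (b, w)).
by rewrite -(horner_map p2 g (b, w)).
Qed.

Variable T : E -> Prop.
Hypotheses (sT : is_subring T) (fT : functional q T).

Lemma adjoin_functional b w :
  (forall g, coefs_in T g -> q (map_poly p1 g).[b] -> (map_poly p2 g).[w] = 0) ->
  functional q (adjoin T (b, w)).
Proof. by move=> H f w' [g Tg]; rewrite horner_pair => -[-> ->]; exact: H. Qed.

(** Cayley and Hamilton: the determinant of [f] at the companion matrix of [mu] lies in
    [T]. Its first component annihilates the vector of the powers of [b] modulo [q],
    hence lies in [q], and its second component is a power of [c]. *)
Lemma no_constant_relation b (mu f : {poly E}) c :
  mu \is monic -> coefs_in T mu -> q (map_poly p1 mu).[b] ->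
  coefs_in T f -> q (map_poly p1 f).[b] -> map_poly p2 f = c%:P -> c = 0.
Proof.
move=> mum Tmu qmu Tf qf f2.
case sz : (size mu) => [|[|k]].
- by move: (monic_neq0 mum); rewrite -size_poly_eq0 sz.
- have m0 : mu`_0 = 1 by rewrite -(monicP mum) lead_coefE sz.
  have E1 : mu = 1 by rewrite (size1_polyC (eq_leq sz)) m0.
  have : (1 : Om) = 0.
    apply: (fT (f := 1)); first exact: (subring1 sT).
    by move: qmu; rewrite E1 rmorph1 hornerC.
  by move/eqP; rewrite oner_eq0.
pose C : 'M[E]_k.+1 := \matrix_(i, j) if i == k :> nat then - mu`_j else (i.+1 == j :> nat)%:R.
(* [C] is the companion matrix of [mu], and [M] is [f] evaluated at it *)
pose M : 'M[E]_k.+1 := \sum_(l < size f) f`_l *: C ^+ l.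
have TC i j : T (C i j).
  by rewrite mxE; case: ifP => _; [apply: subringN | apply: subring_nat].
have TCX l i j : T ((C ^+ l) i j).
  elim: l i j => [|l IH] i j; first by rewrite expr0 mxE; exact: subring_nat.
  by rewrite exprS mxE; apply: subring_sum => // h _; apply: (subringM sT).
have TM i j : T (M i j).
  rewrite summxE; apply: subring_sum => // l _; rewrite mxE; apply: (subringM sT) => //.
pose V : 'cV[B]_k.+1 := \col_i b ^+ i.
pose C1 := map_mx p1 C.
have C1V i : q ((C1 *m V - b *: V) i 0).
  rewrite !mxE; have [id|id] := eqVneq (i : nat) k; last first.
    have lti : (i.+1 < k.+1)%N by have := ltn_ord i; lia.
    rewrite (bigD1 (Ordinal lti)) //= big1 => [|l nl].
      by rewrite !mxE (negPf id) eqxx /= mul1r addr0 -exprS subrr; exact: (ideal0 iq).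
    rewrite !mxE (negPf id).
    have -> : (i.+1 == l :> nat) = false by apply: contraNF nl => /eqP il; apply/eqP/val_inj; rewrite /= il.
    by rewrite /= mul0r.
  have -> : \sum_j C1 i j * V j 0 - b * b ^+ i = - 1 * (map_poly p1 mu).[b].
    rewrite (horner_coef_wide b (n := k.+2)) ?(leq_trans (size_poly _ _)) ?sz // [in RHS]big_ord_recr /= coef_fst.
    have -> : mu`_k.+1 = 1 by rewrite -(monicP mum) lead_coefE sz.
    rewrite rmorph1 mul1r id -exprS mulN1r opprD; congr (_ - _).
    rewrite -sumrN; apply: eq_bigr => l _; rewrite !mxE id eqxx coef_fst /=.
    by rewrite mulNr.
  exact: (idealM iq).
have CX l i : q ((C1 ^+ l *m V - b ^+ l *: V) i 0).
  elim: l i => [|l IH] i; first by rewrite !expr0 mul1mx scale1r subrr mxE; exact: (ideal0 iq).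
  have -> : C1 ^+ l.+1 *m V - b ^+ l.+1 *: V = C1 *m (C1 ^+ l *m V - b ^+ l *: V) + b ^+ l *: (C1 *m V - b *: V).
    rewrite exprS mulmxBr scalerBr scalerA -exprSr -scalemxAr mulmxA.
    by rewrite addrA subrK.
  rewrite mxE; apply: (idealD iq); last by rewrite mxE; apply: (idealM iq); exact: C1V.
  by rewrite mxE; apply: ideal_sum => h _; apply: (idealM iq).
pose M1 := map_mx p1 M.
have M1E : M1 = \sum_(l < size f) p1 f`_l *: C1 ^+ l.
  by rewrite /M1 /M raddf_sum; apply: eq_bigr => l _; rewrite -[LHS]/(map_mx p1 _) map_mxZ rmorphXn.
have M1V i : q ((M1 *m V) i 0).
  have -> : M1 *m V = \sum_(l < size f) p1 f`_l *: (C1 ^+ l *m V - b ^+ l *: V) + (map_poly p1 f).[b] *: V.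
    rewrite M1E mulmx_suml (horner_coef_wide b (n := size f)) ?size_poly // scaler_suml -big_split /=.
    by apply: eq_bigr => l _; rewrite coef_fst scalerBr scalerA subrK scalemxAl.
  rewrite mxE; apply: (idealD iq); last by rewrite mxE mulrC; apply: (idealM iq).
  by rewrite summxE; apply: ideal_sum => l _; rewrite mxE; apply: (idealM iq).
have detM1 : q (\det M1).
  have <- : (\adj M1 *m (M1 *m V)) 0 0 = \det M1.
    by rewrite mulmxA mul_adj_mx mul_scalar_mx !mxE expr0 mulr1.
  by rewrite mxE; apply: ideal_sum => h _; apply: (idealM iq).
have M2E : map_mx p2 M = c%:M.
  rewrite /M raddf_sum /=.
  have -> : c%:M = \sum_(l < size f) (map_poly p2 f)`_l *: (map_mx p2 C) ^+ l :> 'M[Om]_k.+1.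
    rewrite f2; case szf: (size f) => [|n].
      move/eqP: szf f2; rewrite size_poly_eq0 => /eqP ->; rewrite rmorph0 => /esym/eqP.
      by rewrite polyC_eq0 => /eqP ->; rewrite big_ord0 raddf0.
    rewrite big_ord_recl coefC /= expr0 big1 => [|l _]; first by rewrite addr0 scalemx1.
    by rewrite coefC /= scale0r.
  by apply: eq_bigr => l _; rewrite -[LHS]/(map_mx p2 _) map_mxZ rmorphXn coef_snd.
have : c ^+ k.+1 = 0.
  apply: (fT (f := \det M1)) => //.
  have -> : (\det M1, c ^+ k.+1) = \det M.
    rewrite [RHS]surjective_pairing; congr pair; first by rewrite -(det_map_mx p1).
    by rewrite -(det_map_mx p2) M2E det_scalar.
  exact: subring_det.
by move/eqP; rewrite expf_eq0 => /andP[_ /eqP].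
Qed.

(** Integral elements: among the relations satisfied by [b] whose image in
    [Om] is not zero, take one of least degree. Its image is not constant by
    [no_constant_relation], and each of its roots is a possible value for [b], by
    pseudo-division. *)
Lemma extend_monic b (mu : {poly E}) :
  mu \is monic -> coefs_in T mu -> q (map_poly p1 mu).[b] ->
  exists w, functional q (adjoin T (b, w)).
Proof.
move=> mum Tmu qmu.
have mu2 : map_poly p2 mu != 0 by rewrite monic_neq0 // monic_map.
have [n [[f [Tf qf f2 szf]] fmin]] := min_natP (ex_intro (fun n => exists f,
   [/\ coefs_in T f, q (map_poly p1 f).[b], map_poly p2 f != 0 & size (map_poly p2 f) = n])
   _ (ex_intro _ mu (And4 Tmu qmu mu2 erefl))).
case: n szf fmin => [|n] szf fmin; first by move: f2; rewrite -size_poly_eq0 szf.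
have n0 : (0 < n)%N.
  rewrite lt0n; apply: contraNneq f2 => n0; rewrite n0 in szf.
  have fc := size1_polyC (eq_leq szf).
  by rewrite fc (no_constant_relation mum Tmu qmu Tf qf fc).
have /closed_rootP [w /rootP fw] : size (map_poly p2 f) != 1 by rewrite szf; case: (n) n0.
exists w; apply: adjoin_functional => g.
have [m] := ubnP (size (map_poly p2 g)); elim: m g => [//|m IH] g; rewrite ltnS => szg Tg qg.
have [->|g2] := eqVneq (map_poly p2 g) 0; first by rewrite horner0.
have ng : (n < size (map_poly p2 g))%N by apply: fmin; exists g.
set k := (size (map_poly p2 g)).-1; have kE : size (map_poly p2 g) = k.+1 by rewrite prednK // (leq_trans _ ng).
have nk : (n <= k)%N by rewrite -ltnS -kE.
pose g' := (f`_n)%:P * g - (g`_k)%:P * 'X^(k - n) * f.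
have lf : p2 f`_n != 0 by rewrite -[p2 _]coef_snd -[n]/(n.+1.-1) -szf -lead_coefE lead_coef_eq0.
have g'2 : map_poly p2 g' = (p2 f`_n) *: map_poly p2 g - (p2 g`_k) *: ('X^(k - n) * map_poly p2 f).
  by rewrite rmorphB !rmorphM /= !map_polyC map_polyXn -!mul_polyC -mulrA.
have : (map_poly p2 g').[w] = 0.
  apply: IH.
  - apply: leq_trans szg; rewrite kE ltnS; apply/leq_sizeP => i; rewrite leq_eqVlt => /orP[/eqP <-|ki].
      rewrite g'2 coefB !coefZ coefXnM ltnNge leq_subr /= subKn //.
      by rewrite !coef_snd mulrC subrr.
    rewrite g'2 coefB !coefZ coefXnM [in X in _ - _ * X]ifF; last by apply/negbTE; rewrite -leqNgt (leq_trans (leq_subr _ _)) // ltnW.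
    have -> : (map_poly p2 g)`_i = 0 by rewrite nth_default ?kE.
    have -> : (map_poly p2 f)`_(i - (k - n)) = 0 by rewrite nth_default // szf ltn_subRL; lia.
    by rewrite !mulr0 subrr.
  - rewrite /g'; apply: (coefs_inB sT); apply: (coefs_inM sT) => //; first exact: coefs_inC.
    by apply: (coefs_inM sT); [apply: coefs_inC | apply: coefs_inXn].
  - rewrite rmorphB !rmorphM /= hornerD hornerN !hornerM.
    by rewrite -mulNr; apply: (idealD iq); apply: (idealM iq).
rewrite g'2 hornerD hornerN !hornerZ hornerM fw !mulr0 subr0.
by move/eqP; rewrite mulf_eq0 (negPf lf) => /eqP.
Qed.

(** A homomorphism under which [n1] does not vanish extends to [b] as soon as it is
    defined at [n1 * b]: clear the denominators in a relation. *)
Lemma extend_linear b n1 n2 s : T (n1, n2) -> n2 != 0 -> T (n1 * b, s) ->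
  functional q (adjoin T (b, s / n2)).
Proof.
move=> TN n20 Tb; apply: adjoin_functional => g Tg qg; set d := size g.
pose G : E := \sum_(i < d) g`_i * ((n1 * b, s) : E) ^+ i * ((n1, n2) : E) ^+ (d - i).
have TG : T G.
  by apply: subring_sum => // i _; apply: (subringM sT); [apply: (subringM sT) => // |]; apply: subringX.
have G1 : p1 G = n1 ^+ d * (map_poly p1 g).[b].
  rewrite raddf_sum (horner_coef_wide b (n := d)) ?size_poly // big_distrr /=.
  apply: eq_bigr => i _; rewrite coef_fst /= !fst_exp /= exprMn.
  by have -> : n1 ^+ d = n1 ^+ (d - i) * n1 ^+ i by [rewrite -exprD subnK // ltnW]; ring.
have G2 : p2 G = n2 ^+ d * (map_poly p2 g).[s / n2].
  rewrite raddf_sum (horner_coef_wide _ (n := d)) ?size_poly // big_distrr /=.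
  apply: eq_bigr => i _; rewrite coef_snd /= !snd_exp /= exprMn exprVn.
  have -> : n2 ^+ d = n2 ^+ (d - i) * n2 ^+ i by rewrite -exprD subnK // ltnW.
  by field; rewrite expf_neq0.
have : p2 G = 0.
  apply: (fT (f := p1 G)); first by rewrite -surjective_pairing.
  by rewrite G1; apply: (idealM iq).
by rewrite G2 => /eqP; rewrite mulf_eq0 expf_eq0 (negPf n20) andbF => /eqP.
Qed.
End Extension.

Section ExtendAll.
Variables (B : comNzRingType) (Om : closedFieldType) (D : comNzRingType).
Variables (j : {rmorphism D -> B}) (sg : {rmorphism D -> Om}).
Variables (e : nat) (t : 'I_e -> B) (tau : 'I_e -> Om).
Variable q : B -> Prop.
Hypothesis iq : is_ideal q.

(** First extend to the integral multiples [j N * b i] of the elements, then divide. *)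
Lemma extend_all m (b : 'I_m -> B) (T0 : B * Om -> Prop) :
  is_subring T0 -> functional q T0 ->
  (forall F, T0 (mmap j t F, mmap sg tau F)) ->
  (forall i, exists N, sg N != 0 /\ integralOver (mmap j t) (j N * b i)) ->
  exists T, [/\ is_subring T, functional q T, forall x, T0 x -> T x &
    forall i, exists w, T (b i, w)].
Proof.
move=> sT0 fT0 T0F hb.
suff H : forall s : seq 'I_m, exists T, [/\ is_subring T, functional q T, forall x, T0 x -> T x &
    forall i, i \in s -> exists w, T (b i, w)].
  have [T [h1 h2 h3 h4]] := H (enum 'I_m); exists T; split => // i.
  by apply: h4; rewrite mem_enum.
elim=> [|i s [T [sT fT TT0 Ts]]]; first by exists T0.
have [N [nN [p pm pr]]] := hb i.
pose G F : B * Om := (mmap j t F, mmap sg tau F).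
pose mu := \poly_(l < size p) G p`_l.
have szp : (0 < size p)%N by rewrite size_poly_gt0 monic_neq0.
have GE : G (lead_coef p) = 1 by rewrite (monicP pm) /G !rmorph1.
have mum : mu \is monic.
  by apply/monicP; rewrite /mu lead_coef_poly // -lead_coefE GE ?oner_neq0.
have Tmu : coefs_in T mu.
  by move=> l; rewrite coef_poly; case: ifP => _; [apply/TT0/T0F | exact: subring0].
have mu1 : map_poly (@fst B Om) mu = map_poly (mmap j t) p.
  apply/polyP => l; rewrite coef_fst coef_map coef_poly; case: ltnP => // szl.
  by rewrite (nth_default _ szl) /= mmap0.
have qmu : q (map_poly (@fst B Om) mu).[j N * b i].
  by rewrite mu1; move/rootP: pr => ->; exact: (ideal0 iq).
have [w fT1] := extend_monic iq sT fT mum Tmu qmu.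
set T1 := adjoin T _ in fT1; have sT1 : is_subring T1 by exact: adjoin_subring.
have TN : T1 (j N, sg N).
  apply: adjoin_sub => //; apply: TT0; have := T0F N%:MP; by rewrite !mmapC.
have Tb : T1 (j N * b i, w) by exact: adjoin_gen.
have fT2 := extend_linear iq sT1 fT1 TN nN Tb.
exists (adjoin T1 (b i, w / sg N)); split => //.
- exact: adjoin_subring.
- by move=> x /TT0 Tx; apply: adjoin_sub => //; exact: adjoin_sub.
move=> l; rewrite inE => /orP[/eqP ->|/Ts [w' Tw']]; first by exists (w / sg N); exact: adjoin_gen.
by exists w'; apply: adjoin_sub => //; exact: adjoin_sub.
Qed.
End ExtendAll.

From mathcomp Require Import boolp classical_sets functions reals complex.
Local Open Scope classical_set_scope.
Local Open Scope ring_scope.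

(** * Finite quotients and finite index *)

Section GroupTheory.
Local Open Scope group_scope.

Section FiniteImage.
Variables (gT P : groupType) (H : set gT) (phi : gT -> P) (s : seq P).
Hypothesis sH : is_subgroup H.
Hypothesis phiM : forall x y, H x -> H y -> phi (x * y) = phi x * phi y.
Hypothesis phi_s : forall x, H x -> phi x \in s.

(** The image need not be a finite type by itself, so the quotient is built on the
    members of [s] that are attained. *)
Lemma detecting_of_finite_image g : H g -> phi g <> 1 ->
  exists2 k, (k <= size s)%N & detecting_order H g k.
Proof.
move=> Hg g1; have [H1 HM HV] := sH.
have phi1 : phi 1 = 1 by apply: (@mulgI _ (phi 1)); rewrite -phiM // !mulg1.
have phiV x : H x -> phi x^-1 = (phi x)^-1.
  by move=> Hx; apply: (@mulgI _ (phi x)); rewrite -phiM ?mulgV //; exact: HV.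
pose im := [seq z <- undup s | asbool (exists2 x, H x & phi x = z)].
have imP z : z \in im -> exists2 x, H x & phi x = z.
  by rewrite mem_filter => /andP[/asboolP].
have im_phi x : H x -> phi x \in im.
  by move=> Hx; rewrite mem_filter mem_undup phi_s // andbT; apply/asboolP; exists x.
have im1 : 1 \in im by rewrite -phi1 im_phi.
have imM (x y : seq_sub im) : val x * val y \in im.
  have [a Ha <-] := imP _ (valP x); have [b Hb <-] := imP _ (valP y).
  by rewrite -phiM // im_phi //; exact: HM.
have imV (x : seq_sub im) : (val x)^-1 \in im.
  by have [a Ha <-] := imP _ (valP x); rewrite -phiV // im_phi //; exact: HV.
pose one := SeqSub im1; pose mul x y := SeqSub (imM x y); pose inv x := SeqSub (imV x).
have mulA : associative mul by move=> x y z; apply: val_inj; exact: mulgA.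
have mul1 : left_id one mul by move=> x; apply: val_inj; exact: mul1g.
have mulV : left_inverse one inv mul by move=> x; apply: val_inj; exact: mulVg.
pose Q : finGroupType := HB.pack (seq_sub im) (Finite_isGroup.Build (seq_sub im) mulA mul1 mulV).
pose psi x : Q := insubd one (phi x).
have psiE x : H x -> val (psi x : seq_sub im) = phi x by move=> Hx; rewrite val_insubd im_phi.
exists #|Q|.
  rewrite -[#|Q|]/#|{: seq_sub im}| card_seq_sub; last by rewrite filter_uniq ?undup_uniq.
  by rewrite size_filter (leq_trans (count_size _ _)) ?size_undup.
exists Q, psi; split=> //.
- move=> x y Hx Hy; apply: (val_inj : injective (val : seq_sub im -> P)).
  by rewrite psiE ?phiM //= ?psiE //; exact: HM.
- move=> q; have [x Hx xq] := imP _ (valP (q : seq_sub im)); exists x => //.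
  by apply: (val_inj : injective (val : seq_sub im -> P)); rewrite psiE.
- by move=> /(congr1 (val : seq_sub im -> P)); rewrite psiE.
Qed.
End FiniteImage.

Section Cosets.
Variables (gT : groupType) (H N : set gT).
Hypotheses (sH : is_subgroup H) (sN : is_subgroup N).
Hypothesis fiN : finite_index N H.

(** If [g] is outside of [N], then it moves the coset [N] in the action of [H] on
    its cosets by [N]. *)
Lemma detecting_outside : exists k0, forall g, H g -> ~ N g ->
  exists2 k, (k <= k0)%N & detecting_order H g k.
Proof.
have [H1 HM HV] := sH; have [N1 NM NV] := sN; have [s [sHs sP]] := fiN.
pose cos (g : gT) : gT -> Prop := fun z => N (g^-1 * z).
have cos_eq g y : N y -> cos (g * y) = cos g.
  move=> Ny; apply: funext => z; apply: propext; rewrite /cos invgM -mulgA; split=> h.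
    by rewrite -[_ * z](mulKVg y); exact: NM.
  by apply: NM => //; exact: NV.
pose T := seq_sub [seq cos g | g <- s].
have cosT g : H g -> cos g \in [seq cos g | g <- s].
  by move=> Hg; have [a [y [sa Ny ->]]] := sP g Hg; rewrite cos_eq // map_f.
have cosP (c : T) : exists2 g, H g & val c = cos g.
  by have /mapP[g sg ->] := valP c; exists g => //; exact: sHs.
pose act x (c : T) : gT -> Prop := fun z => val c (x * z).
have actE x g : (fun z => cos g (x * z)) = cos (x^-1 * g).
  by apply: funext => z; rewrite /cos invgM invgK mulgA.
have act_in x c : H x -> act x c \in [seq cos g | g <- s].
  move=> Hx; have [g Hg cg] := cosP c; rewrite /act cg actE cosT //.
  by apply: HM => //; exact: HV.
pose actT x (c : T) : T := insubd c (act x c).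
have actTE x c : H x -> val (actT x c) = act x c by move=> Hx; rewrite val_insubd act_in.
have actT_inj x : H x -> injective (actT x).
  move=> Hx c d /(congr1 val); rewrite !actTE // => E; apply: val_inj; apply: funext => z.
  by move: (congr1 (fun h => h (x^-1 * z)) E); rewrite /act mulKVg.
pose phi x : {perm T} :=
  if pselect (H x) is left Hx then perm (@actT_inj _ Hx) else 1.
have phiE x c : H x -> phi x c = actT x c.
  by move=> Hx; rewrite /phi; case: pselect => // ?; rewrite permE.
exists #|{perm T}| => g Hg Ng.
rewrite cardE; apply: (@detecting_of_finite_image _ _ _ phi) => //.
- move=> x y Hx Hy; apply/permP => c; apply: val_inj; rewrite permM !phiE //; last exact: HM.
  rewrite !actTE //; last exact: HM.
  by apply: funext => z; rewrite /act actTE // /act mulgA.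
- by move=> x _; rewrite mem_enum.
- move=> g1; apply: Ng.
  have := phiE g (SeqSub (cosT 1 H1)) Hg; rewrite g1 perm1 => /(congr1 val).
  rewrite actTE //= /act /= => /(congr1 (fun h => h 1)).
  by rewrite /cos invg1 !mul1g mulg1 => <-.
Qed.

(** Schreier's rewriting: a word of length [n] in [X] that lies in [N] is a
    product of [n + 2] of the elements [a^-1 * (x * b)], where [a] and [b] are [1] or
    coset representatives. *)
Lemma schreier (X : seq gT) : (forall x, x \in X -> H x) ->
  exists2 Y : seq gT, (forall y, y \in Y -> N y) &
  forall n g, N g -> in_ball X n g ->
    exists w : seq gT, [/\ (size w <= n + 2)%N, forall y, y \in w -> y \in Y &
      g = (\prod_(y <- w) y)].
Proof.
move=> XH; have [H1 HM HV] := sH; have [N1 NM NV] := sN; have [s [sHs sP]] := fiN.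
pose X' := X ++ [seq x^-1 | x <- X].
pose S := 1 :: s.
pose Y := [seq z <- [seq p.1^-1 * (p.2 * b) | p <- [seq (a, x) | a <- S, x <- 1 :: X'], b <- S] | asbool (N z)].
exists Y => [y|n g Ng]; first by rewrite mem_filter => /andP[/asboolP].
have X'H x : x \in X' -> H x.
  by rewrite mem_cat => /orP[/XH //|/mapP[y /XH Hy ->]]; exact: HV.
have memY (a x b : gT) : a \in S -> x \in 1 :: X' -> b \in S -> N (a^-1 * (x * b)) -> a^-1 * (x * b) \in Y.
  move=> aS xX bS Nab; rewrite mem_filter; apply/andP; split; first exact/asboolP.
  by apply/allpairsP; exists ((a, x), b); split => //; apply/allpairsP; exists (a, x).
have wordX (w : seq gT) : (forall x, x \in w -> x \in X \/ x^-1 \in X) -> forall x, x \in w -> x \in X'.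
  move=> hw x /hw [xX|xX]; rewrite mem_cat ?xX // -[x]invgK map_f ?orbT //.
have rewr (w : seq gT) : (forall x, x \in w -> x \in X') -> exists (a : gT) v, [/\ a \in S, (size v <= (size w).+1)%N,
    forall y, y \in v -> y \in Y & \prod_(x <- w) x = a * \prod_(y <- v) y].
  elim: w => [|x w IH] hw.
    by exists 1, [::]; rewrite !big_nil mulg1 mem_head; split.
  have [|b [v [bS sv vY Ev]]] := IH; first by move=> y yw; apply: hw; rewrite in_cons yw orbT.
  have xX : x \in X' by apply: hw; exact: mem_head.
  have Hxb : H (x * b).
    apply: HM; first exact: X'H.
    by move: bS; rewrite in_cons => /orP[/eqP ->|/sHs].
  have [a [y [sa Ny xb]]] := sP _ Hxb.
  have yE : y = a^-1 * (x * b) by rewrite xb mulKg.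
  exists a, (y :: v); split => //; first by rewrite in_cons sa orbT.
    move=> z; rewrite in_cons => /orP[/eqP ->|/vY //].
    by rewrite yE memY -?yE ?in_cons ?sa ?xX ?orbT.
  by rewrite !big_cons Ev mulgA xb -mulgA.
move=> [w [sw wX gw]]; have [a [v [aS sv vY Ev]]] := rewr w (wordX w wX).
have Nv : N (\prod_(y <- v) y).
  rewrite big_seq; elim/big_ind: _ => // y /vY; by rewrite mem_filter => /andP[/asboolP].
have Na : N a.
  have -> : a = g * (\prod_(y <- v) y)^-1 by rewrite gw Ev mulgK.
  by apply: NM => //; exact: NV.
exists (a :: v); split => [|y|]; last by rewrite big_cons gw Ev.
  by rewrite /= addn2 ltnS (leq_trans sv).
rewrite in_cons => /orP[/eqP ->|/vY //].
have aE : a = 1^-1 * (1 * a) by rewrite invg1 !mul1g.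
by rewrite [a]aE memY -?aE ?mem_head.
Qed.
End Cosets.

Section Balls.
Variables (gT : groupType) (X : seq gT).

Lemma ball1 n : in_ball X n 1.
Proof. by exists [::]; rewrite big_nil. Qed.

Lemma ball_generated g : gen_subgroup (fun x => x \in X) g -> exists n, in_ball X n g.
Proof.
move=> /(_ (fun g => exists n, in_ball X n g)); apply; last first.
  by move=> x xX; exists 1%N, [:: x]; rewrite big_seq1; split => // y; rewrite inE => /eqP ->; left.
split; first by exists 0%N; exact: ball1.
  move=> _ _ [n [w [sw wX ->]]] [k [v [sv vX ->]]]; exists (n + k)%N, (w ++ v).
  rewrite big_cat size_cat leq_add //; split => // x.
  by rewrite mem_cat => /orP[/wX|/vX].
move=> _ [n [w [sw wX ->]]]; exists n, (rev [seq x^-1 | x <- w]); split.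
- by rewrite size_rev size_map.
- by move=> x; rewrite mem_rev => /mapP[y /wX [h|h] ->]; [right; rewrite invgK|left].
- elim: w {sw wX} => [|x w IH]; first by rewrite !big_nil invg1.
  by rewrite big_cons invgM IH /= rev_cons -cats1 big_cat big_seq1.
Qed.

End Balls.

(** A uniform upper bound for the detecting orders makes the depths exist. *)
Lemma farb_growth_bounded (gT : groupType) (H : set gT) (X : seq gT) (b : nat -> nat) :
  (forall n g, (0 < n)%N -> H g -> in_ball X n g -> g <> 1 ->
     exists2 k, (k <= b n)%N & detecting_order H g k) ->
  exists2 F, is_farb_growth H X F & forall n, (0 < n)%N -> (F n <= maxn 1 (b n))%N.
Proof.
move=> hb.
pose depth n k := exists g, [/\ H g, in_ball X n g, g <> 1 & is_depth H g k].
have has_depth n g : (0 < n)%N -> H g -> in_ball X n g -> g <> 1 ->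
    exists2 k, is_depth H g k & (k <= b n)%N.
  move=> n0 Hg Bg g1; have [k kb Dk] := hb n g n0 Hg Bg g1.
  have ex : exists k, asbool (detecting_order H g k) by exists k; apply/asboolP.
  have [j /asboolP Dj jmin] := ex_minnP ex.
  have jm i : detecting_order H g i -> (j <= i)%N by move=> Di; apply: jmin; apply/asboolP.
  by exists j => //; exact: leq_trans (jm _ Dk) kb.
have depth_le n k : (0 < n)%N -> depth n k -> (k <= b n)%N.
  move=> n0 [g [Hg Bg g1 [_ kmin]]]; have [j [Dj _] jb] := has_depth n g n0 Hg Bg g1.
  exact: leq_trans (kmin _ Dj) jb.
have maxF n : exists m, (0 < n)%N -> [/\ forall k, depth n k -> (k <= m)%N,
    depth n m \/ (~ (exists k, depth n k)) /\ m = 1%N & (m <= maxn 1 (b n))%N].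
  have [n0|_] := ltnP 0 n; last by exists 0%N.
  have [ex|nex] := pselect (exists k, depth n k); last first.
    by exists 1%N => _; split; [move=> k dk; case: nex; exists k | right | rewrite leq_maxl].
  have ex' : exists k, asbool (depth n k) by have [k dk] := ex; exists k; apply/asboolP.
  have ub k : asbool (depth n k) -> (k <= b n)%N by move=> /asboolP; exact: depth_le.
  have [m /asboolP dm mmax] := ex_maxnP ex' ub.
  exists m => _; split; [by move=> k dk; apply: mmax; apply/asboolP | by left |].
  by rewrite (leq_trans (depth_le _ _ n0 dm)) ?leq_maxr.
have [F FP] := choice maxF; exists F; last by move=> n n0; have [] := FP n n0.
move=> n n0; have [Fmax Fin _] := FP n n0; split.
  move=> g [Hg Bg g1]; have [k dk _] := has_depth n g n0 Hg Bg g1.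
  by exists k => //; apply: Fmax; exists g.
case: Fin => [[g [Hg Bg g1 dg]]|[nd F1]]; [left; exists g => //; by split|right; split=> //].
apply: funext => g; apply: propext; split => // -[Hg Bg g1].
by apply: nd; have [k dk _] := has_depth n g n0 Hg Bg g1; exists k, g.
Qed.
End GroupTheory.

(** * Noether normalization and the dimension of G *)

HB.instance Definition _ (G : affine_group) (R : comNzRingType) :=
  isPointed.Build (points G R) (1%g : points G R).

Lemma rmorphism_of_fun (A R : nzRingType) (f : A -> R) :
  (forall x y, f (x - y) = f x - f y) -> (forall x y, f (x * y) = f x * f y) -> f 1 = 1 ->
  exists g : {rmorphism A -> R}, g =1 f.
Proof.
move=> fB fM f1.
pose mA := GRing.isZmodMorphism.Build A R f fB.
pose mM := GRing.isMonoidMorphism.Build A R f (conj f1 fM).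
by pose g : {rmorphism A -> R} := HB.pack f mA mM; exists g.
Qed.

Section FunctionRing.
Variables (V : pointedType) (C : comNzRingType).
(** The coordinates are studied as functions on [G(C)], because closed sets and
    dimension are defined in terms of points. *)
Definition funring : comNzRingType := (V -> C)%type.
Definition eval_at (x : V) (f : funring) : C := f x.
Fact eval_at_additive x : zmod_morphism (eval_at x). Proof. by []. Qed.
Fact eval_at_multiplicative x : monoid_morphism (eval_at x). Proof. by []. Qed.
HB.instance Definition _ x := GRing.isZmodMorphism.Build funring C (eval_at x) (eval_at_additive x).
HB.instance Definition _ x := GRing.isMonoidMorphism.Build funring C (eval_at x) (eval_at_multiplicative x).
Definition constf (c : C) : funring := fun=> c.
Fact constf_additive : zmod_morphism constf. Proof. by []. Qed.
Fact constf_multiplicative : monoid_morphism constf. Proof. by []. Qed.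
HB.instance Definition _ := GRing.isZmodMorphism.Build C funring constf constf_additive.
HB.instance Definition _ := GRing.isMonoidMorphism.Build C funring constf constf_multiplicative.

Lemma mmap_eval n (t : 'I_n -> funring) (F : {mpoly int[n]}) x :
  (mmap intr t F) x = mmap intr (fun i => t i x) F.
Proof.
rewrite -[LHS]/(eval_at x _) mmap_rmorph; apply: eq_mmap => // c /=.
by rewrite rmorph_int.
Qed.

Lemma mmap_constf_eval n (t : 'I_n -> funring) (F : {mpoly C[n]}) x :
  (mmap constf t F) x = mmap idfun (fun i => t i x) F.
Proof. by rewrite -[LHS]/(eval_at x _) mmap_rmorph; apply: eq_mmap. Qed.
End FunctionRing.

Lemma generators_ind (A : comNzRingType) (s : seq A) :
  (forall S : {pred A}, GRing.subring_closed S -> {subset s <= S} -> forall a, a \in S) ->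
  forall P : A -> Prop, is_subring P -> (forall i : 'I_(size s), P s`_i) -> forall a, P a.
Proof.
move=> gen P sP Ps a.
have := gen [pred x | `[< P x >]]; move=> /(_ _ _ a)/asboolP; apply.
  split; first by apply/asboolP; exact: (subring1 sP).
    by move=> x y /asboolP Px /asboolP Py; apply/asboolP; exact: (subringB sP).
  by move=> x y /asboolP Px /asboolP Py; apply/asboolP; exact: (subringM sP).
move=> x /(nthP 0) [i si <-]; apply/asboolP; exact: (Ps (Ordinal si)).
Qed.

Section Points.
Variables (G : affine_group) (C : closedFieldType).
Hypothesis char0 : injective (intr : int -> C).
Variable gens : seq (cring G).
Hypothesis gensP : forall S : {pred cring G},
  GRing.subring_closed S -> {subset gens <= S} -> forall a, a \in S.

Local Notation V := (points G C).
Local Notation B := (funring V C).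
Local Notation m := (size gens).

Definition coordinate (a : cring G) : B := fun x => ev x a.
Definition coord (i : 'I_m) : B := coordinate gens`_i.

Lemma ev1 (R : comNzRingType) (x : points G R) : ev x 1 = 1. Proof. exact: rmorph1. Qed.
Lemma evB (R : comNzRingType) (x : points G R) a b : ev x (a - b) = ev x a - ev x b.
Proof. exact: rmorphB. Qed.
Lemma evM (R : comNzRingType) (x : points G R) a b : ev x (a * b) = ev x a * ev x b.
Proof. exact: rmorphM. Qed.

(** A value for each coordinate function, compatible with the relations between them
    at the points of [G(C)], defines a homomorphism on [cring G]. *)
Lemma functional_point (q : B -> Prop) (T : B * C -> Prop) : is_ideal q -> is_subring T -> functional q T ->
  (forall i, exists w, T (coord i, w)) ->
  exists x : V, forall a, T (coordinate a, ev x a).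
Proof.
move=> iq sT fT hT.
have all_a a : exists w, T (coordinate a, w).
  elim/(generators_ind gensP): a => //; split.
  - exists 1; suff -> : (coordinate 1, 1) = 1 :> B * C by exact: (subring1 sT).
    by congr pair; apply/funext => x; exact: ev1.
  - move=> a b [u Tu] [w Tw]; exists (u - w).
    suff -> : (coordinate (a - b), u - w) = (coordinate a, u) - (coordinate b, w) :> B * C by exact: (subringB sT).
    by congr pair; apply/funext => x; exact: evB.
  - move=> a b [u Tu] [w Tw]; exists (u * w).
    suff -> : (coordinate (a * b), u * w) = (coordinate a, u) * (coordinate b, w) :> B * C by exact: (subringM sT).
    by congr pair; apply/funext => x; exact: evM.
have [f fP] := choice all_a.
have fuv f' u w : T (f', u) -> T (f', w) -> u = w.
  move=> Tu Tw; apply/eqP; rewrite -subr_eq0; apply/eqP.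
  apply: (fT (f' - f') (u - w)); first by have := subringB sT Tu Tw.
  by rewrite subrr; exact: (ideal0 iq).
have [||| x xf] := @rmorphism_of_fun _ _ f.
- move=> a b; apply: (fuv _ _ _ (fP _)).
  have -> : coordinate (a - b) = coordinate a - coordinate b by apply/funext => y; exact: evB.
  by have := subringB sT (fP a) (fP b).
- move=> a b; apply: (fuv _ _ _ (fP _)).
  have -> : coordinate (a * b) = coordinate a * coordinate b by apply/funext => y; exact: evM.
  by have := subringM sT (fP a) (fP b).
- apply: (fuv _ _ _ (fP _)).
  have -> : coordinate 1 = 1 by apply/funext => y; exact: ev1.
  by have := subring1 sT.
by exists (x : V) => a; rewrite /ev xf.
Qed.

Lemma intr_funring_prime (a b : int) : (a * b)%:~R = 0 :> B -> a%:~R = 0 :> B \/ b%:~R = 0 :> B.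
Proof.
have at1 c : c%:~R = 0 :> B -> c = 0.
  move=> /(congr1 (eval_at (1%g : V))); rewrite rmorph_int /eval_at /= => c0.
  by apply: char0; rewrite c0.
by move=> /at1/eqP; rewrite mulf_eq0 => /orP[] /eqP ->; [left|right].
Qed.

Variables (e : nat) (t : 'I_e -> B).
Variable tpoly : 'I_e -> {mpoly int[m]}.
Hypothesis tE : forall i, t i = mmap intr coord (tpoly i).
Hypothesis tindep : forall F : {mpoly int[e]}, mmap intr t F = 0 -> F = 0.
Hypothesis tint : forall i, exists N : int, N != 0 /\ integralOver (mmap intr t) (N%:~R * coord i).

Definition tval (x : V) : 'I_e -> C := fun i => t i x.

Lemma t_of_graph (q : B -> Prop) (T : B * C -> Prop) (tau : 'I_e -> C) x :
  is_ideal q -> is_subring T -> functional q T ->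
  (forall i, T (t i, tau i)) -> (forall a, T (coordinate a, ev x a)) -> tval x = tau.
Proof.
move=> iq sT fT Tt Tx; apply/funext => i.
have Tc : T (t i, t i x).
  have -> : t i x = mmap intr (fun k => coord k x) (tpoly i) by rewrite tE mmap_eval.
  rewrite tE.
  have E : (mmap intr coord (tpoly i), mmap intr (fun k => coord k x) (tpoly i)) =
      mmap intr (fun k => (coord k, ev x gens`_k) : (B * C)%type) (tpoly i).
    rewrite [RHS]surjective_pairing; congr pair.
      rewrite -[RHS]/((@fst B C : {rmorphism _ -> _}) _) mmap_rmorph; apply: eq_mmap => // c /=.
      by rewrite (rmorph_int (@fst B C)).
    rewrite -[RHS]/((@snd B C : {rmorphism _ -> _}) _) mmap_rmorph; apply: eq_mmap => // c /=.
    by rewrite (rmorph_int (@snd B C)).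
  by rewrite E; apply: subring_mmap => // k; exact: Tx.
apply/eqP; rewrite -subr_eq0; apply/eqP.
apply: (fT (t i - t i)); first by have := subringB sT Tc (Tt i).
by rewrite subrr; exact: (ideal0 iq).
Qed.

Lemma zero_ideal : is_ideal (fun f : B => f = 0).
Proof. by split => // [x y -> ->|x y ->]; rewrite ?addr0 ?mulr0. Qed.

Let intC_neq0 N : N != 0 -> (N%:~R : C) != 0.
Proof. by apply: contra => /eqP N0; apply/eqP/char0; rewrite N0. Qed.

(** The coordinates are integral over the algebraically independent [t i] up to
    integers, which are invertible in [C], so that any values of the [t i] extend. *)
Lemma tval_surjective (tau : 'I_e -> C) : exists x, tval x = tau.
Proof.
pose T0 (z : B * C) := exists F : {mpoly int[e]}, z = (mmap intr t F, mmap intr tau F).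
have sT0 : is_subring T0.
  split; first by exists 1; rewrite !rmorph1.
    by move=> _ _ [F ->] [F' ->]; exists (F - F'); rewrite !rmorphB.
  by move=> _ _ [F ->] [F' ->]; exists (F * F'); rewrite !rmorphM.
have fT0 : functional (fun f : B => f = 0) T0.
  by move=> f w [F [-> ->]] /tindep ->; rewrite rmorph0.
have [|i|T [sT fT TT0 TB]] := @extend_all _ _ _ intr intr e t tau _ zero_ideal m coord T0 sT0 fT0.
- by move=> F; exists F.
- by have [N [N0 iN]] := tint i; exists N; split => //; exact: intC_neq0.
have [x Tx] := functional_point zero_ideal sT fT TB.
exists x; apply: (t_of_graph zero_ideal sT fT _ Tx) => i.
by apply: TT0; exists 'X_i; rewrite !mmapXU.
Qed.

(** The map [tval] is finite, hence closed: if every polynomial in the [t i] that lies in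
    the ideal [q] vanishes at [tau], then [tau] is the image of a zero of [q]. *)
Lemma image_closed (q : B -> Prop) (tau : 'I_e -> C) : is_ideal q ->
  (forall F : {mpoly C[e]}, q (mmap (@constf V C) t F) -> mmap idfun tau F = 0) ->
  exists x, tval x = tau /\ forall s, q (regular_fun s : B) -> regular_fun s x = 0.
Proof.
move=> iq hq.
pose T0 (z : B * C) := exists F : {mpoly C[e]}, z = (mmap (@constf V C) t F, mmap idfun tau F).
have sT0 : is_subring T0.
  split; first by exists 1; rewrite !rmorph1.
    by move=> _ _ [F ->] [F' ->]; exists (F - F'); rewrite !rmorphB.
  by move=> _ _ [F ->] [F' ->]; exists (F * F'); rewrite !rmorphM.
have fT0 : functional q T0 by move=> f w [F [-> ->]] /hq.
have [|i|T [sT fT TT0 TB]] := @extend_all _ _ _ intr intr e t tau q iq m coord T0 sT0 fT0.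
- move=> F; exists (mmap (fun c : int => c%:~R) (fun i => 'X_i) F); rewrite !mmap_rmorph; congr pair.
    by apply: eq_mmap => [c|i] /=; rewrite ?rmorph_int ?mmapXU.
  by apply: eq_mmap => [c|i] /=; rewrite ?rmorph_int ?mmapXU.
- by have [N [N0 iN]] := tint i; exists N; split => //; exact: intC_neq0.
have [x Tx] := functional_point iq sT fT TB.
exists x; split.
  apply: (t_of_graph iq sT fT _ Tx) => i.
  by apply: TT0; exists 'X_i; rewrite !mmapXU.
move=> s; apply: (fT _ _).
have -> : ((regular_fun s : B), regular_fun s x) =
    \sum_(p <- s) ((@constf V C p.1 : B, p.1) : (B * C)%type) * (coordinate p.2, ev x p.2).
  rewrite [RHS]surjective_pairing; congr pair.
    rewrite (raddf_sum (@fst B C)); apply/funext => y; rewrite fct_sumE.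
    by apply: eq_bigr.
  by rewrite (raddf_sum (@snd B C)).
apply: subring_sum => // p _; apply: (subringM sT) => //.
by apply: TT0; exists p.1%:MP; rewrite !mmapC.
Qed.

(** The affine space is irreducible: on the line through [u] and [v] both polynomials
    are nonzero, and [C] is infinite. *)
Lemma line_argument (F1 F2 : {mpoly C[e]}) (u v : 'I_e -> C) :
  mmap idfun u F1 != 0 -> mmap idfun v F2 != 0 ->
  exists c : C, mmap idfun (fun i => u i + c * (v i - u i)) (F1 * F2) != 0.
Proof.
move=> F1u F2v.
pose l i : {poly C} := (u i)%:P + 'X * (v i - u i)%:P.
pose P F := mmap (@polyC C) l F.
have PE F c : (P F).[c] = mmap idfun (fun i => u i + c * (v i - u i)) F.
  rewrite -[LHS]/(horner_eval c _) mmap_rmorph; apply: eq_mmap => [a|i] /=; rewrite /horner_eval.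
    by rewrite hornerC.
  by rewrite hornerD hornerM !hornerC hornerX.
have P1 : P F1 != 0.
  apply: contraNneq F1u => P10; have := PE F1 0; rewrite P10 horner0 => /esym E.
  by rewrite -[X in _ == X]E; apply/eqP/eq_mmap => // i; rewrite mul0r addr0.
have P2 : P F2 != 0.
  apply: contraNneq F2v => P20; have := PE F2 1; rewrite P20 horner0 => /esym E.
  by rewrite -[X in _ == X]E; apply/eqP/eq_mmap => // i; rewrite mul1r addrC subrK.
have P12 : P (F1 * F2) != 0 by rewrite /P rmorphM mulf_neq0.
apply: contrapT => no.
have roots0 c : (P (F1 * F2)).[c] = 0.
  by apply/eqP/negPn/negP => nc; apply: no; exists c; rewrite -PE.
pose rs := [seq (n%:Z)%:~R : C | n <- iota 0 (size (P (F1 * F2)))].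
have urs : uniq rs by rewrite map_inj_uniq ?iota_uniq // => a b /char0 [].
have ars : all (root (P (F1 * F2))) rs by apply/allP => y _; rewrite rootE roots0.
by have := max_poly_roots P12 ars urs; rewrite size_map size_iota ltnn.
Qed.

Definition vanishing (Z : set V) : B -> Prop := fun f => forall x, Z x -> f x = 0.

Lemma vanishing_ideal Z : is_ideal (vanishing Z).
Proof.
split; first by [].
  by move=> f g hf hg x Zx; rewrite -[LHS]/(f x + g x) hf // hg // addr0.
by move=> f g hg x Zx; rewrite -[LHS]/(f x * g x) hg // mulr0.
Qed.

Lemma zclosedP (Z : set V) : zclosed Z ->
  forall x, (forall s, vanishing Z (regular_fun s : B) -> regular_fun s x = 0) -> Z x.
Proof.
move=> [I ->] x hx s Is; apply: hx => y; exact.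
Qed.

Lemma zclosed_bigcap (A : set (set V)) : (forall Z, A Z -> zclosed Z) ->
  zclosed [set x | forall Z, A Z -> Z x].
Proof.
move=> cA; exists [set s | exists2 Z, A Z & vanishing Z (regular_fun s : B)].
apply/seteqP; split => x /= hx.
  by move=> s [Z AZ vs]; apply: vs; exact: hx.
by move=> Z AZ; apply: (zclosedP (cA Z AZ)) => s vs; apply: hx; exists Z.
Qed.

Lemma zclosedI (Y Z : set V) : zclosed Y -> zclosed Z -> zclosed (Y `&` Z).
Proof.
move=> cY cZ; have := @zclosed_bigcap [set W | W = Y \/ W = Z].
have -> : [set x | forall W, W = Y \/ W = Z -> W x] = Y `&` Z.
  apply/seteqP; split => x /= hx; first by split; apply: hx; [left|right].
  by move=> W [->|->]; case: hx.
by apply=> W [->|->].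
Qed.

Lemma zclosedT : zclosed [set: V].
Proof. by exists set0; apply/seteqP; split => x //= _ s []. Qed.

Lemma zclosed_tval (P : 'I_e -> Prop) : zclosed [set x : V | forall i, P i -> tval x i = 0].
Proof.
pose ti i := mmap (fun c : int => c%:~R) (fun k : 'I_m => gens`_k) (tpoly i) : cring G.
have tiE i x : tval x i = regular_fun [:: (1, ti i)] x.
  rewrite /regular_fun big_seq1 mul1r /tval tE mmap_eval /ti /ev mmap_rmorph.
  by apply: eq_mmap => c //=; rewrite rmorph_int.
exists [set s | exists2 i, P i & s = [:: (1, ti i)]].
apply/seteqP; split => x /= hx; first by move=> s [i Pi ->]; rewrite -tiE hx.
by move=> i Pi; rewrite tiE; apply: hx; exists i.
Qed.

(** The coordinate subspace of dimension [k]. *)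
Definition slice (k : nat) : set ('I_e -> C) := [set tau | forall i : 'I_e, (k <= i)%N -> tau i = 0].

Definition covers k (Z : set V) := [/\ zclosed Z, forall x, Z x -> slice k (tval x) &
  forall tau, slice k tau -> exists2 x, Z x & tval x = tau].

(** Zorn's lemma. The intersection of a chain of closed sets that cover the slice
    still covers it, by [image_closed] for the union of their ideals. *)
Lemma covers_minimal k Z : covers k Z -> exists2 W, covers k W & W `<=` Z /\
  forall Y, covers k Y -> Y `<=` W -> Y = W.
Proof.
move=> cZ; pose S := {W : set V | covers k W /\ W `<=` Z}.
pose R (W Y : S) := `[< sval Y `<=` sval W >].
have [|||A totA|W Wmax] := @Zorn S R.
- by move=> W; apply/asboolP.
- by move=> X Y W /asboolP YX /asboolP WY; apply/asboolP; exact: subset_trans WY YX.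
- move=> [X pX] [Y pY] /asboolP /= XY /asboolP /= YX.
  have E : X = Y by exact/seteqP.
  by move: pX; rewrite E => pX; congr exist; exact: Prop_irrelevance.
- have [[W0 AW0]|noA] := pselect (exists W, A W); last first.
    exists (exist _ Z (conj cZ (@subset_refl _ Z))) => W AW; by case: noA; exists W.
  pose I := [set x | forall Y, [set sval W | W in A] Y -> Y x].
  have IW W : A W -> I `<=` sval W by move=> AW x; apply; exists W.
  have cI : covers k I.
    split.
    - by apply: zclosed_bigcap => Y [W AW <-]; have [[]] := svalP W.
    - move=> x Ix; have [[_ + _] _] := svalP W0; apply; exact: IW Ix.
    (* the union of the ideals of the members of the chain *)
    pose q (f : B) := exists2 W, A W & vanishing (sval W) f.
    have iq : is_ideal q.
      split.
      - by exists W0.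
      - move=> f g [W AW vW] [Y AY vY].
        have [/asboolP WY|/asboolP YW] := totA W Y AW AY.
          exists Y => //; apply: (idealD (vanishing_ideal _)) => // x Yx; exact: vW (WY x Yx).
        exists W => //; apply: (idealD (vanishing_ideal _)) => // x Wx; exact: vY (YW x Wx).
      - move=> f g [W AW vW]; exists W => //; exact: (idealM (vanishing_ideal _)).
    move=> tau htau.
    have [|x [xt xq]] := @image_closed q tau iq.
      move=> F [W AW vF]; have [[_ _ /(_ tau htau) [x Wx <-]] _] := svalP W.
      by have := vF x Wx; rewrite mmap_constf_eval.
    exists x => // Y [W AW <-]; have [[cW _ _] _] := svalP W.
    by apply: (zclosedP cW) => s vs; apply: xq; exists W.
  have IZ : I `<=` Z by apply: subset_trans (IW W0 AW0) _; have [] := svalP W0.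
  exists (exist _ I (conj cI IZ)) => W AW; apply/asboolP; exact: IW.
have [cW WZ] := svalP W; exists (sval W) => //; split => // Y cY YW.
have := Wmax (exist _ Y (conj cY (subset_trans YW WZ))) (asboolT YW).
by move=> <-.
Qed.

(** If [W] is the union of two closed sets different from [W], then by minimality neither
    covers the slice. On each of them some polynomial in the [t i] vanishes that is
    not zero on the slice; the product of the two vanishes on [W], hence on the
    slice, which contradicts [line_argument]. *)
Lemma minimal_irreducible k W : covers k W -> (forall Y, covers k Y -> Y `<=` W -> Y = W) ->
  zirreducible W.
Proof.
move=> cW Wmin; have [clW tW sW] := cW; split.
  have [|x Wx _] := sW (fun=> 0); first by move=> i _.
  by exists x.
move=> Y1 Y2 cY1 cY2 WY; apply: contrapT => /not_orP [n1 n2].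
have miss Y : zclosed Y -> ~ (W `<=` Y) -> exists tau F, [/\ slice k tau,
    vanishing (W `&` Y) (mmap (@constf V C) t F : B) & mmap idfun tau F != 0].
  move=> clY nWY; apply: contrapT => no; apply: nWY.
  suff <- : W `&` Y = W by move=> x [].
  apply: Wmin; last by move=> x [].
  split; first exact: zclosedI.
    by move=> x [Wx _]; exact: tW.
  move=> tau htau; have [F vF|x [xt xq]] := @image_closed _ tau (vanishing_ideal (W `&` Y)).
    by apply/eqP/negPn/negP => nF; apply: no; exists tau, F.
  exists x => //; exact: (zclosedP (zclosedI clW clY)).
have [u [F1 [su v1 n1']]] := miss Y1 cY1 n1.
have [v [F2 [sv v2 n2']]] := miss Y2 cY2 n2.
have [c /eqP nc] := line_argument n1' n2'; apply: nc.
have [|x Wx xt] := sW (fun i => u i + c * (v i - u i)).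
  by move=> i ki; rewrite su // sv // subrr mulr0 addr0.
rewrite -xt rmorphM.
have E F : mmap idfun (tval x) F = (mmap (@constf V C) t F : B) x by rewrite mmap_constf_eval.
rewrite /= !E.
by have [Y1x|Y2x] := WY x Wx; [rewrite v1 ?mul0r | rewrite v2 ?mulr0].
Qed.

(** Minimal closed sets over the slices, each chosen inside the next one. They are
    distinct since their images are. *)
Lemma exists_irreducible_chain : irreducible_chain G C e.
Proof.
pose good k W := covers k W /\ forall Y, covers k Y -> Y `<=` W -> Y = W.
have start : exists W, good e W.
  have [|W cW [_ mW]] := @covers_minimal e [set: V]; last by exists W.
  split; [exact: zclosedT | by move=> x _ i; rewrite leqNgt ltn_ord |].
  by move=> tau _; have [x xt] := tval_surjective tau; exists x.
have step k W : good k.+1 W -> exists2 Y, good k Y & Y `<=` W.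
  move=> [[clW tW sW] _].
  have [|Y cY [YW mY]] := @covers_minimal k (W `&` [set x : V | forall i : 'I_e, (k <= i)%N -> tval x i = 0]).
    split; first by apply: zclosedI => //; exact: zclosed_tval.
      by move=> x [_].
    move=> tau htau; have [|x Wx xt] := sW tau; first by move=> i ki; apply: htau; exact: ltnW.
    by exists x => //; split => //=; rewrite xt.
  by exists Y => // x /YW [].
have fam n : (n <= e)%N -> exists Z : nat -> set V,
    (forall i, (i <= n)%N -> good (e - i)%N (Z i)) /\ forall i, (i < n)%N -> Z i.+1 `<=` Z i.
  elim: n => [|n IH] ne.
    have [W gW] := start; exists (fun=> W); split => // i.
    by rewrite leqn0 => /eqP ->; rewrite subn0.
  have [Z [gZ dZ]] := IH (ltnW ne).
  have [|Y gY YZ] := step (e - n.+1)%N (Z n).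
    by have := gZ n (leqnn n); rewrite -subSn // subSS.
  exists (fun i => if (i <= n)%N then Z i else Y); split => i.
    rewrite leq_eqVlt => /orP[/eqP ->|]; first by rewrite ltnn.
    by rewrite ltnS => le; rewrite le; exact: gZ.
  rewrite ltnS => le; rewrite le; case: ltnP => ni; first exact: dZ.
  by have -> : i = n by apply/eqP; rewrite eqn_leq le ni.
have [Z [gZ dZ]] := fam e (leqnn e).
exists (fun i => Z (e - i)%N); split => i ie.
  have [cZ mZ] := gZ (e - i)%N (leq_subr _ _); split; first by case: cZ.
  exact: minimal_irreducible cZ mZ.
have lt : (e - i.+1 < e)%N by rewrite ltn_subrL ltn0Sn (leq_ltn_trans _ ie).
split; first by have := dZ _ lt; rewrite -subSn // subSS.
move=> sub; have [[_ _ sW] _] := gZ (e - i.+1)%N (leq_subr _ _).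
have [[_ tW _] _] := gZ (e - i)%N (leq_subr _ _).
(* a point of the larger slice outside of the smaller one *)
pose tau (l : 'I_e) : C := ((l : nat) == i)%:R.
have [|x Zx xt] := sW tau.
  by move=> l; rewrite subKn // /tau => il; rewrite gtn_eqF.
have := tW x (sub x Zx) (Ordinal ie); rewrite subKn ?(ltnW ie) // xt /tau eqxx.
by move=> /(_ (leqnn _)) /eqP; rewrite oner_eq0.
Qed.

End Points.

(** * Points with values in subrings *)

Section SubringType.
Variables (R : comNzRingType) (T : R -> Prop).
Hypothesis sT : is_subring T.

Let S : {pred R} := fun x => `[< T x >].
Let S_closed : GRing.subring_closed S.
Proof.
split; first by apply/asboolP; exact: (subring1 sT).
  by move=> x y /asboolP Tx /asboolP Ty; apply/asboolP; exact: (subringB sT).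
by move=> x y /asboolP Tx /asboolP Ty; apply/asboolP; exact: (subringM sT).
Qed.
HB.instance Definition _ := GRing.isSubringClosed.Build R S S_closed.
Let U := {x : R | x \in S}.
HB.instance Definition _ := SubChoice.on U.
HB.instance Definition _ := [SubChoice_isSubComNzRing of U by <:].

(** Turns a subring into a ring, over which points of [G] can be considered. *)
Lemma subring_type : exists (A : comNzRingType) (h : {rmorphism A -> R}),
  injective h /\ forall x, T x <-> exists a, h a = x.
Proof.
exists (U : comNzRingType), (\val : {rmorphism U -> R}); split; first exact: val_inj.
move=> x; split; first by move=> Tx; exists (exist _ x (asboolT Tx) : U).
by move=> [a <-]; have /asboolP := valP a.
Qed.
End SubringType.

Section PointValues.
Variable G : affine_group.

Lemma point_ext (R : comNzRingType) (x y : points G R) : (forall a, ev x a = ev y a) -> x = y.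
Proof.
case: x => [f [[hf] [mf]]]; case: y => [g [[hg] [mg]]] fg.
have {fg} E : f = g by apply: funext => a; exact: fg.
case: _ / E hg mg => hg mg.
by rewrite (Prop_irrelevance hf hg) (Prop_irrelevance mf mg).
Qed.

Lemma pushM (R S : comNzRingType) (h : {rmorphism R -> S}) (x y : points G R) :
  push h (x * y)%g = (push h x * push h y)%g.
Proof. by rewrite -[RHS]/(mulp (push h x) (push h y)) /push mulp_natural. Qed.

Lemma push1 (R S : comNzRingType) (h : {rmorphism R -> S}) : push h (1%g : points G R) = 1%g.
Proof. by apply: (@mulgI _ (push h 1%g)); rewrite -pushM !mulg1. Qed.

Lemma pushV (R S : comNzRingType) (h : {rmorphism R -> S}) (x : points G R) :
  push h (x^-1)%g = ((push h x)^-1)%g.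
Proof. by apply: (@mulgI _ (push h x)); rewrite -pushM !mulgV push1. Qed.

Lemma push_injective (R S : comNzRingType) (h : {rmorphism R -> S}) :
  injective h -> injective (@push G R S h).
Proof.
move=> hI x y xy; apply: point_ext => a; apply: hI.
by rewrite -[LHS]/(ev (push h x) a) xy.
Qed.

Lemma lift_point (A R : comNzRingType) (h : {rmorphism A -> R}) (x : points G R) :
  injective h -> (forall a, exists b, h b = ev x a) -> exists y : points G A, push h y = x.
Proof.
move=> hI /choice [f hf].
have [||| y yE] := @rmorphism_of_fun _ _ f.
- by move=> a b; apply: hI; rewrite rmorphB !hf evB.
- by move=> a b; apply: hI; rewrite rmorphM !hf evM.
- by apply: hI; rewrite rmorph1 hf ev1.
exists (y : points G A); apply: point_ext => a.
by rewrite -hf /push /ev /= yE.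
Qed.

Definition values_in (R : comNzRingType) (T : R -> Prop) : set (points G R) :=
  [set x | forall a, T (ev x a)].

(** By naturality of the group law, the points with values in a subring are the
    image of a group homomorphism. *)
Lemma values_in_subgroup (R : comNzRingType) (T : R -> Prop) :
  is_subring T -> is_subgroup (values_in T).
Proof.
move=> sT; have [A [h [hI hT]]] := subring_type sT.
have lift x : values_in T x -> exists y : points G A, push h y = x.
  by move=> Tx; apply: lift_point => // a; apply/hT.
have val y : values_in T (push h y) by move=> a; apply/hT; exists (ev y a).
split; first by rewrite -(push1 h); exact: val.
  by move=> _ _ /lift[x <-] /lift[y <-]; rewrite -pushM; exact: val.
by move=> _ /lift[x <-]; rewrite -pushV; exact: val.
Qed.

Section Comultiplication.
Variable C : comNzRingType.
Local Notation V := (points G C).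
Local Notation R2 := (funring (V * V)%type C).

(** The comultiplication, seen on points: the product of the two universal
    points of [G] with values in the functions on pairs of points has its values
    in the subring of the sums of products of coordinates. *)
Lemma comultiplication a : exists s : seq (cring G * cring G), forall x y : V,
  ev (x * y)%g a = \sum_(p <- s) ev x p.1 * ev y p.2.
Proof.
pose T (f : R2) := exists s : seq (cring G * cring G), forall z,
  f z = \sum_(p <- s) ev z.1 p.1 * ev z.2 p.2.
have sT : is_subring T.
  split.
  - by exists [:: (1, 1)] => z; rewrite big_seq1 !ev1 mulr1.
  - move=> f g [s fE] [r gE]; exists (s ++ [seq (- p.1, p.2) | p <- r]) => z.
    rewrite big_cat big_map -[LHS]/(f z - g z) fE gE -sumrN; congr (_ + _).
    by apply: eq_bigr => p _; rewrite -mulNr; congr (_ * _); rewrite /ev rmorphN.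
  - move=> f g [s fE] [r gE]; exists [seq (p.1 * q.1, p.2 * q.2) | p <- s, q <- r] => z.
    rewrite big_allpairs_dep -[LHS]/(f z * g z) fE gE big_distrl; apply: eq_bigr => p _.
    by rewrite big_distrr; apply: eq_bigr => q _; rewrite !evM /=; ring.
have pt (pr : V * V -> V) : exists X : points G R2, forall a z, ev X a z = ev (pr z) a.
  have [||| X XE] := @rmorphism_of_fun (cring G) R2 (fun b z => ev (pr z) b).
  - by move=> b c; apply: funext => z; exact: evB.
  - by move=> b c; apply: funext => z; exact: evM.
  - by apply: funext => z; exact: ev1.
  by exists (X : points G R2) => b z; rewrite /ev XE.
have [X XE] := pt fst; have [Y YE] := pt snd.
have [_ TM _] := values_in_subgroup sT.
have [s sE] : T (ev (X * Y)%g a).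
  apply: TM => {}a; [exists [:: (a, 1)] | exists [:: (1, a)]] => z.
    by rewrite big_seq1 ev1 mulr1 XE.
  by rewrite big_seq1 ev1 mul1r YE.
exists s => x y; rewrite -(sE (x, y)).
have xE : push (eval_at (x, y)) X = x by apply: point_ext => b; rewrite -[LHS]/(ev X b (x, y)) XE.
have yE : push (eval_at (x, y)) Y = y by apply: point_ext => b; rewrite -[LHS]/(ev Y b (x, y)) YE.
by rewrite -[RHS]/(ev (push (eval_at (x, y)) (X * Y)%g) a) pushM xE yE.
Qed.
End Comultiplication.

(** A partial ring homomorphism, given by its graph [T], acts on the points with
    values in its domain. *)
Lemma reduction (C : comNzRingType) (Om : closedFieldType) (T : C * Om -> Prop) :
  is_subring T -> functional (fun c => c = 0) T ->
  exists phi : points G C -> points G Om,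
    (forall x, (forall a, exists w, T (ev x a, w)) -> forall a, T (ev x a, ev (phi x) a)) /\
    (forall x y, (forall a, exists w, T (ev x a, w)) -> (forall a, exists w, T (ev y a, w)) ->
       phi (x * y)%g = (phi x * phi y)%g).
Proof.
move=> sT fT; have [A [h [hI hT]]] := subring_type sT.
pose h1 : {rmorphism A -> C} := @fst C Om \o h.
pose h2 : {rmorphism A -> Om} := @snd C Om \o h.
have h1I : injective h1.
  move=> a b; move=> h1ab; apply: hI.
  have /hT Ta : exists c, h c = h (a - b) by exists (a - b).
  have : h2 (a - b) = 0.
    apply: (fT (h1 (a - b))); first by rewrite -surjective_pairing.
    by rewrite rmorphB h1ab subrr.
  rewrite rmorphB => /eqP; rewrite subr_eq0 => /eqP h2ab.
  by rewrite [LHS]surjective_pairing [RHS]surjective_pairing -[(h a).1]/(h1 a) h1ab -[(h a).2]/(h2 a) h2ab.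
have lift x : exists y : points G A, (forall a, exists w, T (ev x a, w)) -> push h1 y = x.
  have [Tx|nTx] := pselect (forall a, exists w, T (ev x a, w)); last by exists 1%g.
  have [|y yE] := @lift_point _ _ h1 x h1I; last by exists y.
  by move=> a; have [w /hT[b bE]] := Tx a; exists b; rewrite /h1 /= bE.
have [l lE] := choice lift; exists (fun x => push h2 (l x)); split.
  move=> x /lE xE a; rewrite -[in ev x a]xE.
  by apply/hT; exists (ev (l x) a); rewrite [LHS]surjective_pairing.
move=> x y Tx Ty; rewrite -pushM; congr push; apply: (push_injective h1I).
rewrite pushM !lE //.
pose T1 c := exists w, T (c, w).
have sT1 : is_subring T1.
  split; first by exists 1; exact: (subring1 sT).
    by move=> b c [u Tu] [w Tw]; exists (u - w); exact: (subringB sT Tu Tw).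
  by move=> b c [u Tu] [w Tw]; exists (u * w); exact: (subringM sT Tu Tw).
by have [_ T1M _] := values_in_subgroup sT1; apply: (T1M x y).
Qed.
End PointValues.

(** * Coordinates of products *)

Section Recognizable.
Variables (gT : groupType) (H : set gT) (K : fieldType) (f : gT -> K).
Variables (L : nat) (b c : 'I_L -> gT -> K).
Hypothesis sH : is_subgroup H.
Hypothesis fM : forall x y, H x -> H y -> f (x * y)%g = \sum_l b l x * c l y.

Let hankel k (x y : 'I_k -> gT) : 'M[K]_k := \matrix_(i, j) f (x i * y j)%g.

Let full k := exists x y : 'I_k -> gT,
  [/\ forall i, H (x i), forall i, H (y i) & hankel x y \in unitmx].

(** The decomposition of [f (x * y)] bounds the size of the invertible matrices of the
    form [f (x i * y j)]. When [F] is one of maximal size, all bordered determinants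
    vanish, which expresses [f (z * u)] bilinearly through [F^-1]; a product can then be
    evaluated one factor at a time. *)
Lemma recognizable : exists k (A : gT -> 'M[K]_k) (r : 'rV[K]_k) (v : 'cV[K]_k),
  forall w : seq gT, (forall y, y \in w -> H y) ->
    f (\prod_(y <- w) y)%g = (r *m foldr (fun y => mulmx (A y)) v w) 0 0.
Proof.
have [H1 HM HV] := sH.
have full_le k : `[< full k >] -> (k <= L)%N.
  move=> /asboolP[x [y [Hx Hy]]]; rewrite -row_free_unit => /eqP <-.
  have -> : hankel x y = (\matrix_(i, l) b l (x i)) *m (\matrix_(l, j) c l (y j)).
    by apply/matrixP => i j; rewrite !mxE fM //; apply: eq_bigr => l _; rewrite !mxE.
  exact: leq_trans (mxrankM_maxl _ _) (rank_leq_col _).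
have full0 : `[< full 0 >].
  apply/asboolP; exists (fun=> 1%g), (fun=> 1%g); split => //.
  by rewrite unitmxE det_mx00 unitr1.
have [k /asboolP[x [y [Hx Hy uF]]] kmax] := @ex_maxnP (fun k => `[< full k >]) L (ex_intro _ 0%N full0) full_le.
pose F := hankel x y.
pose row z : 'rV[K]_k := \row_j f (z * y j)%g.
pose col z : 'cV[K]_k := \col_i f (x i * z)%g.
have key z u : H z -> H u -> f (z * u)%g = (row z *m invmx F *m col u) 0 0.
  move=> Hz Hu.
  pose x' (i : 'I_(1 + k)) := match fintype.split i with inl _ => z | inr j => x j end.
  pose y' (i : 'I_(1 + k)) := match fintype.split i with inl _ => u | inr j => y j end.
  have E : hankel x' y' = block_mx (f (z * u)%g)%:M (row z) (col u) F.
    apply/matrixP => i j; rewrite !mxE /x' /y'.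
    case: (fintype.split i) => i'; rewrite !mxE; case: (fintype.split j) => j'; rewrite !mxE //.
    by rewrite !ord1.
  have : ~ (hankel x' y' \in unitmx).
    move=> u'; have := kmax k.+1; rewrite ltnn; apply/not_implyP; split => //.
    by apply/asboolP; exists x', y'; split => // i; rewrite /x' /y'; case: fintype.split.
  rewrite unitmxE unitfE => /negP; rewrite negbK E => /det0P[v v0].
  rewrite -[v]hsubmxK mul_row_block -(row_mx0 _ 1 1 k) => /eq_row_mx[].
  set v0' := lsubmx v; set v1 := rsubmx v.
  rewrite [v0']mx11_scalar; set a := v0' 0 0 => e1 e2.
  have v1E : v1 = - (a *: (row z *m invmx F)).
    have : v1 *m F = - (a *: row z).
      by move/eqP: e2; rewrite mul_scalar_mx addrC addr_eq0 => /eqP.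
    by move=> /(congr1 (mulmx^~ (invmx F))); rewrite mulmxK // mulNmx -scalemxAl.
  have a0 : a != 0.
    apply: contraNneq v0 => a0; rewrite -[v]hsubmxK -/v0' -/v1 v1E a0 scale0r oppr0.
    by rewrite [v0']mx11_scalar -/a a0 raddf0 row_mx0.
  move: e1; rewrite v1E mulNmx -scalemxAl -scalar_mxM => /matrixP/(_ 0 0).
  rewrite !mxE eqxx mulr1n -mulrBr => /eqP; rewrite mulf_eq0 (negPf a0) /= subr_eq0 => /eqP ->.
  by [].
exists k, (fun z => (\matrix_(i, j) f (x i * (z * y j))%g) *m invmx F), (row 1%g *m invmx F), (col 1%g).
move=> w Hw.
have [Hp ->] : H (\prod_(y <- w) y)%g /\
    foldr (fun z => mulmx ((\matrix_(i, j) f (x i * (z * y j))%g) *m invmx F)) (col 1%g) w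
    = col (\prod_(y <- w) y)%g; last by rewrite -key // mul1g.
elim: w Hw => [|z w IH] Hw; first by rewrite !big_nil.
have Hz : H z by apply: Hw; exact: mem_head.
have [|Hp E] := IH; first by move=> u uw; apply: Hw; rewrite in_cons uw orbT.
rewrite !big_cons; split; first exact: HM.
rewrite /= E; apply/matrixP => i j; rewrite ord1 mxE [RHS]mxE mulgA key //; last exact: HM.
rewrite [RHS]mxE; apply: eq_bigr => l _; congr (_ * _).
by rewrite !mxE; apply: eq_bigr => h _; rewrite !mxE mulgA.
Qed.
End Recognizable.

(** * Counting points over a prime field *)

Lemma roots_seq (F : closedFieldType) (p : {poly F}) : p \is monic ->
  exists s : seq F, (size s < size p)%N /\ forall y, root p y -> y \in s.
Proof.
move=> pm; have [s E] := closed_field_poly_normal p; exists s.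
rewrite (monicP pm) scale1r in E; split; first by rewrite E size_prod_XsubC.
by move=> y; rewrite E root_prod_XsubC.
Qed.

Section Counting.
Variables (G : affine_group) (C : closedFieldType) (gens : seq (cring G)).
Hypothesis gensP : forall S : {pred cring G},
  GRing.subring_closed S -> {subset gens <= S} -> forall a, a \in S.
Local Notation m := (size gens).
Local Notation B := (funring (points G C) C).
Local Notation coord := (@coord G C gens).
Local Notation coordinate := (@coordinate G C).
Variables (e : nat) (t : 'I_e -> B) (tpoly : 'I_e -> {mpoly int[m]}) (N : 'I_m -> int).
Hypothesis tE : forall i, t i = mmap intr coord (tpoly i).
Hypothesis tint : forall i, integralOver (mmap intr t) ((N i)%:~R * coord i).

Lemma point_gens_ext (R : comNzRingType) (x y : points G R) :
  (forall i : 'I_m, ev x gens`_i = ev y gens`_i) -> x = y.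
Proof.
move=> xy; apply: point_ext; apply: (generators_ind gensP) => //; split.
- by rewrite !ev1.
- by move=> a b Ea Eb; rewrite !evB Ea Eb.
- by move=> a b Ea Eb; rewrite !evM Ea Eb.
Qed.

Lemma horner_mmap_rmorph (A R : comNzRingType) (g : {rmorphism A -> R}) (u : 'I_e -> A)
    (P : {poly {mpoly int[e]}}) n a :
  g (map_poly (mmap intr u) P).[n%:~R * a] = (map_poly (mmap intr (g \o u)) P).[n%:~R * g a].
Proof.
rewrite -horner_map rmorphM rmorph_int -map_poly_comp; congr (_.[_]).
apply: eq_map_poly => F /=; rewrite mmap_rmorph; apply: eq_mmap => // k /=.
by rewrite rmorph_int.
Qed.

(** A point of [G] over an extension of ['F_p] at which the relations between the
    coordinates on [G(C)] hold is determined up to boundedly many choices by the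
    values of the [t i], because the coordinates are roots of monic polynomials
    over those. *)
Lemma count_points : exists D, forall p (Om : closedFieldType) (io : {rmorphism 'F_p -> Om}),
  prime p -> (forall i, (N i)%:~R != 0 :> Om) ->
  exists2 s : seq (points G Om), size s = (p ^ e * D)%N &
    forall z : points G Om, (forall a, coordinate a = 0 -> ev z a = 0) ->
      (forall a, exists r, io r = ev z a) -> z \in s.
Proof.
(* The relations that express integrality are lifted to [cring G], so that they can
   be evaluated at points over other rings. *)
pose ti i := mmap intr (fun k : 'I_m => gens`_k) (tpoly i) : cring G.
have coordti i : coordinate (ti i) = t i.
  apply: funext => x; rewrite tE mmap_eval /coordinate /ti /ev mmap_rmorph.
  by apply: eq_mmap => // c /=; rewrite rmorph_int.
have [P PP] := choice (fun i => let: ex_intro2 p pm pr := tint i in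
  ex_intro (fun q => q \is monic /\ root (map_poly (mmap intr t) q) ((N i)%:~R * coord i)) p (conj pm pr)).
pose rel i := (map_poly (mmap intr ti) (P i)).[(N i)%:~R * gens`_i].
have rel0 i : coordinate (rel i) = 0.
  apply: funext => x; have [_ /rootP/(congr1 (eval_at x))] := PP i.
  rewrite horner_mmap_rmorph rmorph0 => E.
  rewrite /coordinate /rel /ev horner_mmap_rmorph -[RHS]E; congr (_.[_]).
  by apply: eq_map_poly => F; apply: eq_mmap => // k /=; rewrite -coordti.
pose D := (\max_i size (P i))%N; exists (D ^ m)%N => p Om io pp N0.
pose Q (tau : {ffun 'I_e -> 'F_p}) i := map_poly (mmap intr (fun k => io (tau k))) (P i).
have [rs rsP] : exists rs : {ffun 'I_e -> 'F_p} -> 'I_m -> seq Om, forall tau i,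
    (size (rs tau i) < size (P i))%N /\ forall y, root (Q tau i) y -> y \in rs tau i.
  have h (ui : {ffun 'I_e -> 'F_p} * 'I_m) : exists s : seq Om,
      (size s < size (P ui.2))%N /\ forall y, root (Q ui.1 ui.2) y -> y \in s.
    have [Pm _] := PP ui.2; have [|s sP] := @roots_seq _ (Q ui.1 ui.2); first by rewrite monic_map.
    by exists s; rewrite size_map_poly_id0 ?(monicP Pm) ?rmorph1 ?oner_neq0 // in sP.
  by have [rs rsP] := choice h; exists (fun tau i => rs (tau, i)) => tau i; exact: (rsP (tau, i)).
pose good z tau (c : {ffun 'I_m -> 'I_D}) := forall i, (N i)%:~R * ev z gens`_i = nth 0 (rs tau i) (c i).
pose pick tau c : points G Om := xget 1%g [set z | good z tau c].
exists [seq pick tau c | tau <- enum {: {ffun 'I_e -> 'F_p}}, c <- enum {: {ffun 'I_m -> 'I_D}}].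
  by rewrite size_allpairs -!cardE !card_ffun !card_ord Fp_cast.
move=> z z0 zF; have [r rE] := choice zF.
pose tau : {ffun _ -> _} := [ffun i => r (ti i)].
have root_z i : (N i)%:~R * ev z gens`_i \in rs tau i.
  have [_] := rsP tau i; apply; rewrite /root -(z0 _ (rel0 i)) /rel /ev horner_mmap_rmorph.
  apply/eqP; congr (_.[_]); apply: eq_map_poly => F; apply: eq_mmap => // k.
  by rewrite /= ffunE rE.
have lt_D i : (index ((N i)%:~R * ev z gens`_i)%R (rs tau i) < D)%N.
  have [lt _] := rsP tau i; rewrite (leq_trans _ (leq_bigmax i)) //.
  by rewrite (leq_trans _ lt) // ltnW // ltnS index_mem.
pose c := [ffun i => Ordinal (lt_D i)].
have gz : good z tau c by move=> i; rewrite ffunE /= nth_index.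
apply/allpairsP; exists (tau, c); rewrite !mem_enum; split => //=.
have : good (pick tau c) tau c by apply: (@xgetPex _ 1%g [set z | good z tau c]); exists z.
move=> gp; apply: point_gens_ext => i; apply: (mulfI (N0 i)).
by rewrite gz gp.
Qed.
End Counting.

(** * Heights of the coordinates of words *)

Section IntegralPoints.
Variables (G : affine_group) (K : fieldExtType rat) (C : closedFieldType).
Variables (iota : {rmorphism K -> C}) (f : K).
Hypotheses (f_int : ring_of_integers f) (f0 : f <> 0).

(** Fractions with denominators [f ^ n] and [f ^ k] have the common denominator
    [f ^ (n + k)], and integral elements form a ring. *)
Lemma localized_integers_subring : is_subring (localized_integers f).
Proof.
have fX n : ring_of_integers (f ^+ n).
  elim: n => [|n IH]; first by rewrite expr0; exact: integral1.
  by rewrite exprS; exact: integral_mul f_int IH.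
have fX0 n : f ^+ n != 0 by rewrite expf_neq0 //; apply/eqP.
split.
- by exists 1, 0%N; rewrite expr0 divr1; split => //; exact: integral1.
- move=> _ _ [a [n [ia ->]]] [b [k [ib ->]]]; exists (a * f ^+ k - b * f ^+ n), (n + k)%N; split.
    exact: integral_sub (integral_mul ia (fX k)) (integral_mul ib (fX n)).
  by rewrite exprD; field; rewrite !fX0.
- move=> _ _ [a [n [ia ->]]] [b [k [ib ->]]]; exists (a * b), (n + k)%N; split.
    exact: integral_mul ia ib.
  by rewrite exprD; field; rewrite !fX0.
Qed.

Lemma integral_points_subgroup : is_subgroup (integral_points iota f : set (points G C)).
Proof.
apply: (@values_in_subgroup G C (fun c => exists2 b, localized_integers f b & c = iota b)).
have sL := localized_integers_subring.
split.
- by exists 1; [exact: (subring1 sL) | rewrite rmorph1].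
- move=> _ _ [a la ->] [b lb ->]; exists (a - b); last by rewrite rmorphB.
  exact: (subringB sL).
- move=> _ _ [a la ->] [b lb ->]; exists (a * b); last by rewrite rmorphM.
  exact: (subringM sL).
Qed.
End IntegralPoints.

Section WordHeights.
Variables (G : affine_group) (K : fieldType) (C : closedFieldType) (iota : {rmorphism K -> C}).
Variables (d : nat) (h : {poly int}) (th : K).
Variables (H : set (points G C)) (Y : seq (points G C)).
Hypotheses (sH : is_subgroup H) (YH : forall y, y \in Y -> H y).
Variable kv : cring G -> points G C -> K.
Hypothesis kvE : forall x, H x -> forall a, iota (kv a x) = ev x a.

(** The list [zs] collects the entries of the matrices of [recognizable] for the letters
    in [Y]; any common bound for their heights determines the growth. *)
Lemma height_coordinate a : exists (zs : seq K) b, forall N c,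
  (forall z, z \in zs -> has_height d h th N 1 c z) ->
  forall w : seq (points G C), (forall y, y \in w -> y \in Y) ->
    has_height d h th N (size w + 2) ((b * c) ^ (size w + 2)) (kv a (\prod_(y <- w) y)%g).
Proof.
have [s sE] := @comultiplication G C a.
have kvM x y : H x -> H y -> kv a (x * y)%g =
    \sum_(l < size s) kv (nth (0, 0) s l).1 x * kv (nth (0, 0) s l).2 y.
  have [_ HM _] := sH.
  move=> Hx Hy; apply: (fmorph_inj iota); rewrite kvE ?sE; last exact: HM.
  rewrite (big_nth (0, 0)) big_mkord rmorph_sum; apply: eq_bigr => l _.
  by rewrite rmorphM !kvE.
have [k [A [r [v AE]]]] := recognizable sH kvM.
exists ([seq r 0 j | j <- enum 'I_k] ++ [seq v i 0 | i <- enum 'I_k] ++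
  [seq A p.1 p.2.1 p.2.2 | p <- [seq (y, ij) | y <- Y, ij <- enum {: 'I_k * 'I_k}]]), k.+1.
move=> N c hz w wY; rewrite AE; last by move=> y /wY/YH.
apply: height_word.
- by move=> j; apply: hz; rewrite mem_cat map_f ?mem_enum.
- by move=> i; apply: hz; rewrite !mem_cat [X in _ || (X || _)]map_f ?mem_enum ?orbT.
- move=> y yw i j; apply: hz; rewrite !mem_cat; apply/orP; right; apply/orP; right.
  apply/mapP; exists (y, (i, j)) => //; apply/allpairsP; exists (y, (i, j)); split => //=.
    exact: wY.
  by rewrite mem_enum.
Qed.

Hypothesis hspan : forall x : K, exists u n, n != 0 /\ x * n%:~R = (map_poly intr u).[th].

Lemma height_points (gens : seq (cring G)) : exists (N : int) c, N != 0 /\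
  forall w : seq (points G C), (forall y, y \in w -> y \in Y) -> forall i : 'I_(size gens),
    has_height d h th N (size w + 2) (c ^ (size w + 2)) (kv gens`_i (\prod_(y <- w) y)%g) /\
    has_height d h th N (size w + 2) (c ^ (size w + 2))
      (kv gens`_i (\prod_(y <- w) y)%g - kv gens`_i 1%g).
Proof.
have /choice[zb zbP] : forall i : 'I_(size gens), exists zb : seq K * nat, forall N c,
    (forall z, z \in zb.1 -> has_height d h th N 1 c z) ->
    forall w : seq (points G C), (forall y, y \in w -> y \in Y) ->
    has_height d h th N (size w + 2) ((zb.2 * c) ^ (size w + 2)) (kv gens`_i (\prod_(y <- w) y)%g).
  by move=> i; have [zs [b hb]] := height_coordinate gens`_i; exists (zs, b).
have [N [c [N0 hc]]] := @common_height d h _ th hspan (1 :: flatten [seq (zb i).1 | i <- enum 'I_(size gens)]).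
pose c1 := ((\max_i (zb i).2).+1 * c)%N.
have le_c1 i : ((zb i).2 * c <= c1)%N by rewrite leq_mul // leqW // leq_bigmax.
have hw (w : seq (points G C)) (wY : forall y, y \in w -> y \in Y) (i : 'I_(size gens)) :
    has_height d h th N (size w + 2) (c1 ^ (size w + 2)) (kv gens`_i (\prod_(y <- w) y)%g).
  suff hz z : z \in (zb i).1 -> has_height d h th N 1 c z.
    by apply: height_le (zbP i N c hz w wY); rewrite leq_exp2r ?addn2.
  move=> zi; apply: hc; rewrite in_cons; apply/orP; right; apply/flattenP; exists (zb i).1 => //.
  by apply/mapP; exists i => //; rewrite mem_enum.
have raise j k x c2 : has_height d h th N k c2 x -> has_height d h th N (j + k) (c1 ^ j * c2) x.
  move=> hx; elim: j => [|j IH]; first by rewrite expn0 mul1n.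
  rewrite addSn expnS -mulnA -[x]mul1r -add1n; apply: height_mul => //.
  apply: height_le (hc 1 (mem_head _ _)); by rewrite /c1 leq_pmull.
exists N, (2 * c1)%N; split => // w wY i; split.
  by apply: height_le (hw w wY i); rewrite leq_exp2r ?addn2 // leq_pmull.
apply: height_le (height_add (hw w wY i) (height_opp _)); last first.
  have := hw [::] _ i; rewrite big_nil /= add0n => h1; apply: raise; apply: h1 => y; by rewrite in_nil.
by rewrite -expnD addnn -mul2n expnMn leq_mul // addn2 expnS leq_pmulr // expn_gt0.
Qed.
End WordHeights.

(** * Reduction modulo a prime *)

Section Specialization.
Variables (C : closedFieldType) (K : fieldType) (iota : {rmorphism K -> C}).
Variables (d : nat) (h : {poly int}) (th : K).
Hypotheses (hmon : h \is monic) (hsz : size h = d.+2) (hth : is_root h th).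
Hypothesis indep : forall a : 'rV[int]_d.+1, vev th a = 0 -> a = 0.

Definition at_th (u : {poly int}) : C := (map_poly intr u).[iota th].
Fact at_th_additive : zmod_morphism at_th.
Proof. by move=> u v; rewrite /at_th rmorphB hornerD hornerN. Qed.
Fact at_th_multiplicative : monoid_morphism at_th.
Proof. by split; [rewrite /at_th rmorph1 hornerC | move=> u v; rewrite /at_th rmorphM hornerM]. Qed.
HB.instance Definition _ := GRing.isZmodMorphism.Build {poly int} C at_th at_th_additive.
HB.instance Definition _ := GRing.isMonoidMorphism.Build {poly int} C at_th at_th_multiplicative.

Lemma at_thE u : at_th u = iota (map_poly intr u).[th].
Proof.
rewrite /at_th -horner_map -map_poly_comp; congr (_.[_]); apply: eq_map_poly => k /=.
by rewrite rmorph_int.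
Qed.

(** The homomorphism th |-> r extends to all the [b i] unless [r] is a zero of [U], the
    product of the denominators in the Noether normalization of [b] over Z[th]. The
    transcendental elements are sent to [0]. *)
Lemma specialization m (b : 'I_m -> C) : exists U : {poly int}, at_th U != 0 /\
  forall p (Om : closedFieldType) (io : {rmorphism 'F_p -> Om}) (r : 'F_p),
    is_root h r -> (map_poly intr U).[r] != 0 ->
    exists T : C * Om -> Prop, [/\ is_subring T, functional (fun c => c = 0) T,
      forall u, T (at_th u, io (map_poly intr u).[r]) & forall i, exists w, T (b i, w)].
Proof.
have jprime (x y : {poly int}) : at_th (x * y) = 0 -> at_th x = 0 \/ at_th y = 0.
  by rewrite rmorphM => /eqP; rewrite mulf_eq0 => /orP[] /eqP ->; [left | right].
have [e [t [_ tind tint]]] := @noether_normalization _ _ at_th jprime m b.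
have /choice[N NP] := tint.
exists (\prod_i N i); split.
  by rewrite rmorph_prod; apply/prodf_neq0 => i _; have [] := NP i.
move=> p Om io r hr; rewrite rmorph_prod horner_prod => /prodf_neq0 Nr.
pose sg u : Om := io (map_poly intr u).[r].
have [||| sgm sgE] := @rmorphism_of_fun _ _ sg.
- by move=> u v; rewrite /sg rmorphB hornerD hornerN rmorphB.
- by move=> u v; rewrite /sg rmorphM hornerM rmorphM.
- by rewrite /sg rmorph1 hornerC rmorph1.
have sg0 u : at_th u = 0 -> sgm u = 0.
  move=> u0; rewrite sgE /sg (@eq0_of_root d h hmon hsz K th hth indep u) ?rmorph0 //.
  by apply: (fmorph_inj iota); rewrite -at_thE u0 rmorph0.
(* the graph of the homomorphism on the polynomials in the [t i] *)
pose T0 (z : C * Om) := exists F : {mpoly {poly int}[e]}, z = (mmap at_th t F, mmap sgm (fun=> 0) F).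
have [||||i|T [sT fT TT0 TB]] := @extend_all C Om _ at_th sgm e t (fun=> 0) (fun c => c = 0) _ m b T0.
- by split => // [x y -> ->|x y ->]; rewrite ?addr0 ?mulr0.
- split; first by exists 1; rewrite !rmorph1.
    by move=> _ _ [F ->] [F' ->]; exists (F - F'); rewrite !rmorphB.
  by move=> _ _ [F ->] [F' ->]; exists (F * F'); rewrite !rmorphM.
- move=> c w [F [-> ->]] /tind F0; rewrite /mmap big1 // => k _.
  by rewrite sg0 ?mul0r.
- by move=> F; exists F.
- by have [N0 iN] := NP i; exists (N i); split => //; rewrite sgE fmorph_eq0 Nr.
exists T; split => // u; apply: TT0; exists u%:MP.
by congr pair; rewrite mmapC //; exact: esym (sgE u).
Qed.
End Specialization.

Section Reduction.
Variables (G : affine_group) (C : closedFieldType) (d : nat).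
Hypothesis char0 : injective (intr : int -> C).
Variable gens : seq (cring G).
Hypothesis gensP : forall S : {pred cring G},
  GRing.subring_closed S -> {subset gens <= S} -> forall a, a \in S.
Hypothesis dim_le : forall e, irreducible_chain G C e -> (e <= d)%N.

(** The number of algebraically independent coordinates is at most [d] because of
    [exists_irreducible_chain]. *)
Lemma count_points_dim : exists (N : 'I_(size gens) -> int) D, (forall i, N i != 0) /\
  forall p (Om : closedFieldType) (io : {rmorphism 'F_p -> Om}),
  prime p -> (forall i, (N i)%:~R != 0 :> Om) ->
  exists2 s : seq (points G Om), (size s <= p ^ d * D)%N &
    forall z : points G Om, (forall a, @coordinate G C a = 0 -> ev z a = 0) ->
      (forall a, exists r, io r = ev z a) -> z \in s.
Proof.
have [e [t [tF tind tint]]] :=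
  @noether_normalization _ _ (intr : {rmorphism int -> funring (points G C) C})
    (@intr_funring_prime G C char0) _ (@coord G C gens).
have /choice[tpoly tE] := tF.
have intB0 (n : int) : n%:~R = 0 :> funring (points G C) C -> n = 0.
  by move=> /(congr1 (eval_at (1%g : points G C))); rewrite rmorph_int rmorph0 => n0; exact: char0.
have tind' F : mmap intr t F = 0 -> F = 0.
  by move=> /tind F0; apply/mpolyP => k; rewrite mcoeff0; apply: intB0; exact: F0.
have /choice[N NP] := tint.
have N0 i : N i != 0.
  by have [n0 _] := NP i; apply: contraNneq n0 => ->.
have NI i : integralOver (mmap intr t) ((N i)%:~R * @coord G C gens i) by have [] := NP i.
have e_d : (e <= d)%N.
  apply: dim_le; apply: (@exists_irreducible_chain G C char0 gens gensP e t tpoly tE tind').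
  by move=> i; exists (N i).
have [D DP] := @count_points G C gens gensP e t tpoly N tE NI.
exists N, D; split => // p Om io pp NO; have [s ss sP] := DP p Om io pp NO.
by exists s => //; rewrite ss leq_mul // leq_pexp2l // prime_gt0.
Qed.
End Reduction.

(** * The normal Farb growth *)

Section Detection.
Variables (G : affine_group) (C : closedFieldType) (d : nat).
Hypothesis char0 : injective (intr : int -> C).
Variable gens : seq (cring G).
Hypothesis gensP : forall S : {pred cring G},
  GRing.subring_closed S -> {subset gens <= S} -> forall a, a \in S.
Hypothesis dim_le : forall e, irreducible_chain G C e -> (e <= d)%N.
Variables (K : fieldExtType rat) (iota : {rmorphism K -> C}) (f : K).
Hypotheses (f_int : ring_of_integers f) (f0 : f <> 0).
Variables (Gamma : set (points G C)) (X : seq (points G C)).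
Hypotheses (sGamma : is_subgroup Gamma) (GammaX : Gamma = gen_subgroup [set` X]).
Local Notation H := (Gamma `&` integral_points iota f).
Hypothesis fiH : finite_index H Gamma.
Variables (RR : realFieldType) (lg : nat -> RR).
Hypothesis lgM : forall m n, (0 < m)%N -> (0 < n)%N -> lg (m * n)%N = lg m + lg n.
Hypothesis lg_le : forall m n, (0 < m <= n)%N -> lg m <= lg n.
Hypothesis lg2 : lg 2 = 1.

Local Notation m := (size gens).

Lemma integral_part_subgroup : is_subgroup H.
Proof.
have [G1 GM GV] := sGamma; have [I1 IM IV] := @integral_points_subgroup G K C iota f f_int f0.
split; first by split.
  by move=> x y [Gx Ix] [Gy Iy]; split; [apply: GM | apply: IM].
by move=> x [Gx Ix]; split; [apply: GV | apply: IV].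
Qed.

Lemma ev1_int (R : comNzRingType) a : ev (1%g : points G R) a = (ev (1%g : points G int) a)%:~R.
Proof. by rewrite -[RHS]/(ev (push intr (1%g : points G int)) a) push1. Qed.

Lemma gens_neq (R : comNzRingType) (x y : points G R) : x <> y ->
  exists i : 'I_m, ev x gens`_i <> ev y gens`_i.
Proof.
move=> xy; apply: contrapT => no; apply: xy; apply: (point_gens_ext gensP) => i.
by apply: contrapT => ni; apply: no; exists i.
Qed.

(** The polynomial to which [good_prime] is applied is the product of [u], which comes
    from [g], with a fixed polynomial [U1]; where the latter does not vanish, the
    reduction is defined on [Gamma] and [count_points_dim] applies. *)
Lemma detecting_integral : exists M, forall n g, (0 < n)%N -> H g -> in_ball X n g -> g <> 1%g ->
  exists2 k, (k <= M * n ^ d)%N & detecting_order Gamma g k.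
Proof.
have sH := integral_part_subgroup; have [H1 HM HV] := sH; have [G1 GM GV] := sGamma.
have XG x : x \in X -> Gamma x by move=> xX; rewrite GammaX => S sS; apply.
have [Y YH YP] := schreier sGamma sH fiH XG.
have [reps [repsG repsP]] := fiH.
have [dK [h [th [[hmon hsz] hth indep hspan]]]] := integral_generator K.
have [kv kvE] : exists kv : cring G -> points G C -> K,
    forall x, H x -> forall a, iota (kv a x) = ev x a.
  have kvx (xa : points G C * cring G) : exists b : K, H xa.1 -> iota b = ev xa.1 xa.2.
    have [[_ Ix]|nH] := pselect (H xa.1); last by exists 0.
    by have [b _ bE] := Ix xa.2; exists b.
  by have [kv kvE] := choice kvx; exists (fun a x => kv (x, a)) => x Hx a; rewrite (kvE (x, a)).
have [N [c [N0 hN]]] := @height_points G K C iota dK h th H Y sH YH kv kvE hspan gens.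
have [c' nrmE] := nrm_le_exp dK h c.
have [N1 [D [N10 count]]] := count_points_dim char0 gensP dim_le.
(* the coordinates of the coset representatives, and the denominator of the
   coordinates of the elements of [H] *)
pose bs : seq C := (N%:~R)^-1 :: [seq ev gi.1 gens`_(gi.2 : 'I_m) | gi <- [seq (g, i) | g <- reps, i <- enum 'I_m]].
have [U [U0 spec]] := specialization iota hmon hsz hth indep (fun i : 'I_(size bs) => bs`_i).
pose U1 := U * (\prod_i (N1 i)%:P) * N%:P.
have nrm_neq0' u : (map_poly intr u).[th] != 0 -> nrm dK h u != 0 by exact: nrm_neq0.
have thE u : at_th iota th u = 0 <-> (map_poly intr u).[th] = 0.
  rewrite at_thE; split; last by move=> ->; rewrite rmorph0.
  by move=> /eqP; rewrite fmorph_eq0 => /eqP.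
have KI (k : int) : k != 0 -> (k%:~R : K) != 0.
  by move=> k0; rewrite -(rmorph0 (intr : int -> K)) (inj_eq (@rat_field_intr_inj K)).
have CI (k : int) : k != 0 -> (k%:~R : C) != 0.
  by move=> k0; rewrite -(rmorph0 (intr : int -> C)) (inj_eq char0).
have evC (S : comNzRingType) (z : S) (k : int) : (map_poly intr k%:P).[z] = k%:~R.
  by rewrite map_polyC hornerC.
have U1th : (map_poly intr U1).[th] != 0.
  rewrite !rmorphM !hornerM !mulf_neq0 //.
  - by apply/eqP => /thE; apply/eqP.
  - rewrite rmorph_prod horner_prod; apply/prodf_neq0 => i _.
    by rewrite evC KI.
  - by rewrite evC KI.
have [C0 goodp] := @good_prime dK h hmon hsz (nrm_row_neq0 hmon hsz hth indep)
  (disc_neq0 hmon hsz hth indep) RR lg lgM lg_le lg2.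
(* a word of length [n] is rewritten in at most [n + 2] letters, and the height of
   its coordinates has exponent at most [n + 4 <= 5 * n] *)
pose c1 := (5 * c' + `|nrm dK h U1|)%N.
pose c2 := (C0 * c1)%N.
exists (size reps * (c2 ^ d * D))%N => n g n0 Hg gn g1.
have [w [sw wY gw]] := YP n g Hg gn.
have [i gi] := gens_neq g1.
have [[_ _ _] [u uth uE]] := hN w wY i; rewrite -gw in uth.
have uth0 : (map_poly intr u).[th] != 0.
  rewrite uth mulf_neq0 ?expf_neq0 ?KI //; apply/eqP => /(congr1 iota).
  by rewrite rmorphB rmorph0 !kvE // => /eqP; rewrite subr_eq0 => /eqP.
have [|||p [pp pn [r [hr ur]]]] := goodp (c1 * n)%N (u * U1).
- have := nrm_neq0' _ U1th; rewrite -absz_gt0 => nU1; by rewrite muln_gt0 n0 andbT /c1 addn_gt0 nU1 orbT.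
- by apply: nrm_neq0'; rewrite rmorphM hornerM mulf_neq0.
- rewrite nrmM abszM /c1 mulnDl expnD leq_mul //.
    apply: leq_trans (nrmE _ _ _ uE) _; first by rewrite addn2.
    have w5 : (size w + 2 <= 5 * n)%N by clear -sw n0; lia.
    by rewrite leq_exp2l // [(5 * c')%N]mulnC -mulnA leq_mul.
  apply: leq_trans (ltnW (ltn_expl _ (isT : 1 < 2)%N)) _.
  by rewrite leq_exp2l // leq_pmulr.
have [Om [io _]] := countable_algebraic_closure 'F_p.
have : [/\ (map_poly intr u).[r] != 0, (map_poly intr U).[r] != 0,
    forall i, ((N1 i)%:~R : 'F_p) != 0 & (N%:~R : 'F_p) != 0].
  move: ur; rewrite !rmorphM !hornerM !mulf_eq0 !negb_or /= => /andP[-> /andP[/andP[-> ]]].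
  rewrite rmorph_prod horner_prod evC => /prodf_neq0 h1 ->; split => // l.
  by have := h1 l isT; rewrite evC.
move=> [ur0 Ur0 N1r0 Nr0].
have [T [sT fT Tth Tb]] := spec p Om io r hr Ur0.
have T0 w' : T (0, w') -> w' = 0 by move=> /fT; apply.
have Tfun b u1 u2 : T (b, u1) -> T (b, u2) -> u1 = u2.
  move=> T1 T2; apply/eqP; rewrite -subr_eq0; apply/eqP/T0.
  by have := subringB sT T1 T2; rewrite -[_ - _]/(b - b, u1 - u2) subrr.
have TN (k : int) : T (k%:~R, k%:~R).
  have := Tth k%:P; rewrite /at_th !evC rmorph_int.
  by [].
(* The elements that reduce to the prime field contain the coordinates of the
   elements of [H], and those that reduce at all the coordinates of [Gamma]. *)
pose T1 b := exists v : 'F_p, T (b, io v).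
pose T2 b := exists v : Om, T (b, v).
have sT1 : is_subring T1.
  split; first by exists 1; rewrite rmorph1; exact: (subring1 sT).
    by move=> a b [v Tv] [v' Tv']; exists (v - v'); rewrite rmorphB; exact: (subringB sT Tv Tv').
  by move=> a b [v Tv] [v' Tv']; exists (v * v'); rewrite rmorphM; exact: (subringM sT Tv Tv').
have sT2 : is_subring T2.
  split; first by exists 1; exact: (subring1 sT).
    by move=> a b [v Tv] [v' Tv']; exists (v - v'); exact: (subringB sT Tv Tv').
  by move=> a b [v Tv] [v' Tv']; exists (v * v'); exact: (subringM sT Tv Tv').
have T1V : T1 (N%:~R)^-1.
  have [v Tv] := Tb (Ordinal (isT : 0 < size bs)%N); exists (N%:~R)^-1.
  have := subringM sT Tv (TN N); rewrite -[_ * _]/(N%:~R^-1 * N%:~R, v * N%:~R) mulVf ?CI //.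
  move=> T1v; have E : v * N%:~R = 1 := Tfun _ _ _ T1v (subring1 sT).
  suff -> : io N%:~R^-1 = v by [].
  have ioN : io N%:~R = N%:~R by rewrite rmorph_int.
  have NOm : (N%:~R : Om) != 0 by rewrite -ioN fmorph_eq0.
  by rewrite fmorphV ioN; apply: (mulIf NOm); rewrite E mulVf.
have HT1 x : H x -> values_in T1 x.
  move=> Hx; have [k xk] : exists k, in_ball X k x.
    by apply: ball_generated; have [] := Hx; rewrite {1}GammaX.
  have [w1 [_ w1Y xw]] := YP k x Hx xk.
  apply: (generators_ind gensP).
    split; first by rewrite ev1; exact: (subring1 sT1).
      by move=> a b; rewrite evB; exact: (subringB sT1).
    by move=> a b; rewrite evM; exact: (subringM sT1).
  move=> l; have [[v vth _] _] := hN w1 w1Y l.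
  have -> : ev x gens`_l = N%:~R^-1 ^+ (size w1 + 2) * at_th iota th v.
    rewrite at_thE vth rmorphM rmorphXn rmorph_int kvE -xw // mulrA -exprMn mulVf ?CI //.
    by rewrite expr1n mul1r.
  by apply: (subringM sT1); [exact: (subringX sT1) | exists (map_poly intr v).[r]; exact: Tth].
have T12 b : T1 b -> T2 b by move=> [v Tv]; exists (io v).
have GT2 x : Gamma x -> values_in T2 x.
  move=> Gx; have [y [z [yr Hz ->]]] := repsP x Gx.
  have [_ TM _] := @values_in_subgroup G C T2 sT2; apply: TM; last by move=> a; apply: T12; exact: HT1.
  apply: (generators_ind gensP).
    split; first by rewrite ev1; exact: (subring1 sT2).
      by move=> a b; rewrite evB; exact: (subringB sT2).
    by move=> a b; rewrite evM; exact: (subringM sT2).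
  move=> l.
  have : ev y gens`_l \in bs.
    rewrite in_cons; apply/orP; right; apply/mapP; exists (y, l) => //.
    by apply/allpairsP; exists (y, l); rewrite mem_enum.
  by move=> /(nthP 0)[k kb <-]; exact: (Tb (Ordinal kb)).
have [phi [phiT phiM]] := @reduction G C Om T sT fT.
have phiG x y : Gamma x -> Gamma y -> phi (x * y)%g = (phi x * phi y)%g.
  by move=> Gx Gy; apply: phiM; exact: GT2.
have [|s sz sP] := count p Om io pp.
  by move=> l; rewrite -(rmorph_int io) fmorph_eq0.
pose im := [seq (phi y * z)%g | y <- reps, z <- s].
have im_phi x : Gamma x -> phi x \in im.
  move=> Gx; have [y [z [yr Hz xyz]]] := repsP x Gx.
  have Gz : Gamma z by have [] := Hz.
  rewrite xyz phiG //; last exact: repsG.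
  apply/allpairsP; exists (y, phi z); split => //=; apply: sP => a.
    move=> a0; have := phiT z (GT2 z Gz) a.
    have -> : ev z a = 0 by rewrite -[LHS]/(@coordinate G C a z) a0.
    exact: T0.
  have [v Tv] := HT1 z Hz a; exists v; apply: (Tfun (ev z a)) => //.
  by apply: phiT; exact: GT2.
have Gg : Gamma g by have [] := Hg.
have phig : phi g <> 1%g.
  move=> phi1; have Tg := phiT g (GT2 g Gg) gens`_i.
  rewrite phi1 ev1_int in Tg.
  have := subringB sT Tg (TN (ev (1%g : points G int) gens`_i)).
  rewrite -[_ - _]/(_ - _, _ - _) subrr => Td.
  have := subringM sT (subringX sT (size w + 2) (TN N)) Td.
  rewrite [_ * _]surjective_pairing /= fst_exp /= mulr0 => Tu.
  move/negP: ur0; apply; rewrite -(fmorph_eq0 io); apply/eqP.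
  apply: (Tfun (at_th iota th u)); first exact: Tth.
  by rewrite at_thE uth rmorphM rmorphXn rmorphB rmorph_int !kvE // (@ev1_int C).
have [k ks Dk] := detecting_of_finite_image sGamma phiG im_phi Gg phig.
exists k => //; apply: leq_trans ks _; rewrite size_allpairs -mulnA leq_mul //.
apply: leq_trans sz _; rewrite mulnAC leq_mul // -expnMn.
have [->|d0] := posnP d; first by rewrite !expn0.
by rewrite leq_exp2r // /c2 -mulnA.
Qed.

Lemma farb_growth_upper : exists2 F : nat -> nat, is_farb_growth Gamma X F &
  growth_le F (fun n => (n ^ d)%N).
Proof.
have [M0 hM0] := detecting_integral.
have [k0 hk0] := detecting_outside sGamma integral_part_subgroup fiH.
have [|F FP Fle] := @farb_growth_bounded _ Gamma X (fun n => (k0 + M0) * n ^ d)%N; last first.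
  exists F => //; exists (k0 + M0).+1 => // n n0; apply: leq_trans (Fle n n0) _.
  rewrite expnMn geq_max; apply/andP; split; first by rewrite !muln_gt0 !expn_gt0 n0.
  rewrite leq_mul //; apply: leq_pmull; by rewrite expn_gt0.
move=> n g n0 Gg gn g1; have nd : (0 < n ^ d)%N by rewrite expn_gt0 n0.
have [Ig|nIg] := pselect (H g).
  have [k kn Dk] := hM0 n g n0 Ig gn g1; exists k => //.
  by rewrite (leq_trans kn) // leq_mul // leq_addl.
have [k kn Dk] := hk0 g Gg nIg; exists k => //.
by rewrite (leq_trans kn) // (leq_trans (leq_addr M0 k0)) // leq_pmulr.
Qed.
End Detection.

Theorem theorem1p3 (R : realType) (G : affine_group) (d : nat)
  (K : fieldExtType rat) (iota : {rmorphism K -> R[i]}) (f : K)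
  (Gamma : set (points G R[i])) (X : seq (points G R[i])) :
  chevalley_group G ->
  zariski_dim G R[i] d ->
  ring_of_integers f -> f <> 0 ->
  is_subgroup Gamma ->
  Gamma = gen_subgroup [set` X] ->
  finite_index (Gamma `&` integral_points iota f) Gamma ->
  exists2 F : nat -> nat, is_farb_growth Gamma X F &
    growth_le F (fun n => (n ^ d)%N).
Proof.
move=> [[[gens gensP] _] _ _] [_ dim_le] f_int f0 sGamma GammaX fiH.
have ln2 : (0 < exp.ln 2 :> R)%R by rewrite exp.ln_gt0 // ltr1n.
apply: (@farb_growth_upper G R[i] d _ gens gensP dim_le K iota f f_int f0 Gamma X
  sGamma GammaX fiH R (fun n => exp.ln n%:R / exp.ln 2)).
- by move=> a b /intr_inj.
- by move=> a b a0 b0; rewrite natrM exp.lnM ?posrE ?ltr0n // mulrDl.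
- move=> a b /andP[a0 ab]; rewrite ler_pM2r ?invr_gt0 // exp.ler_ln ?posrE ?ltr0n ?ler_nat //.
  exact: leq_trans ab.
- by rewrite divff // gt_eqF.
Qed.
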